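(* Let $\mathfrak{g}$ be a root-reductive Lie algebra for which $\mathfrak{sp}(V)$ is a direct summand of $[\mathfrak{g},\mathfrak{g}]$. The following statements hold for any maximal toral subalgebra $\mathfrak{t}\subseteq\mathfrak{g}$ (with $V^\alpha=V^\alpha(\mathfrak{t})$ for $\alpha\in\mathfrak{t}^*$): (1) If $\langle V^\alpha,V^\beta\rangle\neq 0$, then $\beta=-\alpha$. If furthermore $\alpha\neq 0$, then $\dim V^\alpha=\dim V^{-\alpha}=1$. (2) If $\langle\cdot,\cdot\rangle|_{V^\alpha\times V^{-\alpha}}=0$, then $V^\alpha\,\&\,V^{-\alpha}\subseteq\mathfrak{z}(\mathfrak{z}_{\mathfrak{sp}(V)}(\mathfrak{t}))$. (3) $\langle\cdot,\cdot\rangle|_{V^0\times V^0}=0$, and $(\mathrm{Sym}^2(V^0))\cap\mathfrak{t}=0$. (4) $\mathfrak{z}_{\mathfrak{sp}(V)}(\mathfrak{t})$ is abelian. If $\mathfrak{g}=\mathfrak{sp}(V)$, a subalgebra $\mathfrak{t}\subseteq\mathfrak{g}$ is maximal toral if and only if (3), (5), and (6) hold, where (5) $\operatorname{supp}V=-\operatorname{supp}V$ and $\dim V^\alpha=1$ for any $\alpha\in\operatorname{supp}V\setminus\{0\}$; (6) $\mathfrak{t}=\bigoplus_{\alpha\in I}V^\alpha\,\&\,V^{-\alpha}$, where $I\sqcup -I=\operatorname{supp}V\setminus\{0\}$.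
   Context: Everything is over $\mathbb{C}$. An inclusion of finite-dimensional reductive Lie algebras $\mathfrak{l}\subseteq\mathfrak{m}$ is a root inclusion if, for some Cartan subalgebra $\mathfrak{h}_{\mathfrak{m}}$ of $\mathfrak{m}$, $\mathfrak{l}\cap\mathfrak{h}_{\mathfrak{m}}$ is a Cartan subalgebra of $\mathfrak{l}$ and each $\mathfrak{l}\cap\mathfrak{h}_{\mathfrak{m}}$-root space of $\mathfrak{l}$ is also a root space of $\mathfrak{m}$. A Lie algebra is root-reductive if it is isomorphic to a union $\bigcup_{i\in\mathbb{Z}_{>0}}\mathfrak{g}_i$ of nested finite-dimensional reductive Lie algebras with respect to root inclusions for a fixed choice of nested Cartan subalgebras $\mathfrak{h}_i\subseteq\mathfrak{g}_i$ with $\mathfrak{h}_{i-1}=\mathfrak{h}_i\cap\mathfrak{g}_{i-1}$. An element of $\mathfrak{g}$ is semisimple if it is semisimple in some (equivalently every large enough) $\mathfrak{g}_i$ containing it, i.e. acts semisimply on $\mathfrak{g}_i$ by the adjoint action. A subalgebra is toral if all its elements are semisimple. $V$ is a countably infinite-dimensional vector space with a nondegenerate antisymmetric bilinear form $\langle\cdot,\cdot\rangle$. $V\otimes V$ is an associative algebra with $(v\otimes w)\cdot(v'\otimes w')=\langle v',w\rangle\,v\otimes w'$, acting on $V$ by $(v\otimes w)\cdot u=\langle u,w\rangle v$. Put $a\,\&\,b:=a\otimes b+b\otimes a$; $A\,\&\,B$ is the span of all $a\,\&\,b$ with $a\in A$, $b\in B$; $\mathrm{Sym}^2(A)\subseteq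 A\otimes A$ is the space of symmetric tensors. $\mathfrak{sp}(V):=\mathrm{Sym}^2(V)\subseteq V\otimes V$ with the commutator bracket. $V$ is regarded as a $[\mathfrak{g},\mathfrak{g}]$-module on which $\mathfrak{sp}(V)$ acts naturally and all other direct summands of $[\mathfrak{g},\mathfrak{g}]$ act trivially, and it is endowed with a $\mathfrak{g}$-module structure extending this one for which $\langle\cdot,\cdot\rangle$ is $\mathfrak{g}$-invariant (for $\mathfrak{g}=\mathfrak{sp}(V)$ this is the natural module). For a subalgebra $\mathfrak{t}\subseteq\mathfrak{g}$ and $\alpha\in\mathfrak{t}^*$, $V^\alpha=V^\alpha(\mathfrak{t}):=\{m\in V:\exists\, i\in\mathbb{Z}_{>0}\text{ such that }(x-\alpha(x)1)^i\cdot m=0\ \forall x\in\mathfrak{t}\}$, and $\operatorname{supp}V:=\{\alpha\in\mathfrak{t}^*:V^\alpha\neq 0\}$. $\mathfrak{z}_{\mathfrak{k}}(\mathfrak{a})$ is the set of elements of $\mathfrak{k}$ commuting with all of $\mathfrak{a}$; $\mathfrak{z}(\mathfrak{k})$ is the center of $\mathfrak{k}$. *)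

(* Defs.v *)
From HB Require Import structures.
From mathcomp Require Import all_boot all_order all_algebra.
From mathcomp Require Import generic_quotient sesquilinear.
From mathcomp Require Import boolp classical_sets functions.

Set Implicit Arguments.
Unset Strict Implicit.
Unset Printing Implicit Defensive.

Import GRing.Theory.
Local Open Scope quotient_scope.
Local Open Scope classical_set_scope.
Local Open Scope ring_scope.

Section Subspaces.
Variables (K : fieldType) (V : lmodType K).
Implicit Types A B C S : set V.

Definition subspace A :=
  A 0 /\ forall (a : K) u v, A u -> A v -> A (a *: u + v).

Definition span S : set V := smallest subspace S.

Definition lin_indep n (e : 'I_n -> V) :=
  forall c : 'I_n -> K, \sum_(i < n) c i *: e i = 0 -> forall i, c i = 0.

Definition has_dim A n :=
  exists e : 'I_n -> V, lin_indep e /\ A = span (range e).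

Definition finite_dim A := exists n, has_dim A n.

Definition countably_infinite_dim :=
  exists e : nat -> V,
    (forall n, lin_indep (fun i : 'I_n => e i)) /\ span (range e) = setT.

Definition direct_sum2 A B C :=
  A = [set b + c | b in B & c in C] /\ B `&` C = [set 0].

Definition direct_sum (I : Type) (J : set I) (D : I -> set V) A :=
  A = span (\bigcup_(i in J) D i) /\
  forall i, J i -> D i `&` span (\bigcup_(j in J `\ i) D j) = [set 0].

(* Linear functionals on the subspace A, represented by their extension by 0  *)
(* to all of V; Leibniz equality, 0 and - of functions V -> K thus restrict   *)
(* to those of the dual space of A.                                           *)
Definition dual A : set (V -> K) :=
  [set f | (forall (a : K) u v, A u -> A v -> f (a *: u + v) = a * f u + f v)
           /\ (forall u, ~ A u -> f u = 0)].

End Subspaces.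

Section Tensor.
Variables (K : fieldType) (U W : lmodType K).
Implicit Types s : seq (U * W).

(* A list of pairs stands for the sum of the corresponding pure tensors.      *)
Definition fsum (Z : lmodType K) (f : U -> W -> Z) s : Z :=
  \sum_(p <- s) f p.1 p.2.

(* Two formal sums are equal in the tensor product iff every bilinear map, to *)
(* every vector space, identifies them.                                       *)
Definition tens_rel s1 s2 : bool :=
  `[< forall (Z : lmodType K) (f : {bilinear U -> W -> Z}),
        fsum f s1 = fsum f s2 >].

Lemma tens_rel_refl : reflexive tens_rel.
Proof. by move=> s; apply/asboolP. Qed.

Lemma tens_rel_sym : symmetric tens_rel.
Proof.
by move=> s1 s2; apply/asboolP/asboolP => h Z f; rewrite (h Z f).
Qed.

Lemma tens_rel_trans : transitive tens_rel.
Proof.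
move=> s2 s1 s3 /asboolP h12 /asboolP h23; apply/asboolP => Z f.
by rewrite (h12 Z f) (h23 Z f).
Qed.

Canonical tens_equiv :=
  EquivRel tens_rel tens_rel_refl tens_rel_sym tens_rel_trans.

Definition tensor := {eq_quot tens_equiv}.
HB.instance Definition _ := Choice.on tensor.
HB.instance Definition _ := EqQuotient.on tensor.

(* The linear map on the tensor product induced by a bilinear map f. *)
Definition lift (Z : lmodType K) (f : U -> W -> Z) (x : tensor) : Z :=
  fsum f (repr x).

Lemma lift_pi (Z : lmodType K) (f : {bilinear U -> W -> Z}) s :
  lift f (\pi_tensor s) = fsum f s.
Proof.
rewrite /lift; have : repr (\pi_tensor s) = s %[mod tensor] by rewrite reprK.
by move=> /eqmodP/asboolP; apply.
Qed.

Lemma tensor_eqP (x y : tensor) :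
  (forall (Z : lmodType K) (f : {bilinear U -> W -> Z}), lift f x = lift f y) ->
  x = y.
Proof.
by move=> h; rewrite -[x]reprK -[y]reprK; apply/eqmodP/asboolP => Z f; apply: h.
Qed.

Definition tens_zero : tensor := \pi_tensor [::].
Definition tens_add (x y : tensor) : tensor := \pi_tensor (repr x ++ repr y).
Definition tens_scale (a : K) (x : tensor) : tensor :=
  \pi_tensor [seq (a *: p.1, p.2) | p <- repr x].
Definition tens_opp (x : tensor) : tensor := tens_scale (-1) x.

Section LiftOps.
Variables (Z : lmodType K) (f : {bilinear U -> W -> Z}).

Lemma lift0_subproof : lift f tens_zero = 0.
Proof. by rewrite lift_pi /fsum big_nil. Qed.

Lemma liftD_subproof x y : lift f (tens_add x y) = lift f x + lift f y.
Proof. by rewrite lift_pi /fsum big_cat. Qed.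

Lemma liftZ_subproof a x : lift f (tens_scale a x) = a *: lift f x.
Proof.
rewrite lift_pi /fsum big_map /lift /fsum scaler_sumr.
by apply: eq_bigr => p _ /=; rewrite linearZl_LR.
Qed.

End LiftOps.

Let liftE := (lift0_subproof, liftD_subproof, liftZ_subproof).

Fact tens_addA : associative tens_add.
Proof. by move=> x y z; apply: tensor_eqP => Z f; rewrite !liftE addrA. Qed.
Fact tens_addC : commutative tens_add.
Proof. by move=> x y; apply: tensor_eqP => Z f; rewrite !liftE addrC. Qed.
Fact tens_add0 : left_id tens_zero tens_add.
Proof. by move=> x; apply: tensor_eqP => Z f; rewrite !liftE add0r. Qed.
Fact tens_addN : left_inverse tens_zero tens_opp tens_add.
Proof.
by move=> x; apply: tensor_eqP => Z f; rewrite !liftE scaleN1r addNr.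
Qed.

HB.instance Definition _ := GRing.isZmodule.Build tensor
  tens_addA tens_addC tens_add0 tens_addN.

Fact tens_scaleA a b x : tens_scale a (tens_scale b x) = tens_scale (a * b) x.
Proof. by apply: tensor_eqP => Z f; rewrite !liftE scalerA. Qed.
Fact tens_scale1 : left_id 1 tens_scale.
Proof. by move=> x; apply: tensor_eqP => Z f; rewrite !liftE scale1r. Qed.
Fact tens_scaleDr : right_distributive tens_scale +%R.
Proof.
by move=> a x y; apply: tensor_eqP => Z f; rewrite !liftE scalerDr.
Qed.
Fact tens_scaleDl x : {morph tens_scale^~ x : a b / a + b}.
Proof. by move=> a b; apply: tensor_eqP => Z f; rewrite !liftE scalerDl. Qed.

HB.instance Definition _ := GRing.Zmodule_isLmodule.Build K tensor
  tens_scaleA tens_scale1 tens_scaleDr tens_scaleDl.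

Definition tens (u : U) (w : W) : tensor := \pi_tensor [:: (u, w)].

Lemma lift_tens (Z : lmodType K) (f : {bilinear U -> W -> Z}) u w :
  lift f (tens u w) = f u w.
Proof. by rewrite lift_pi /fsum big_seq1. Qed.

Lemma lift_is_linear (Z : lmodType K) (f : {bilinear U -> W -> Z}) :
  linear (lift f).
Proof. by move=> a x y; rewrite liftD_subproof liftZ_subproof. Qed.

HB.instance Definition _ (Z : lmodType K) (f : {bilinear U -> W -> Z}) :=
  GRing.isLinear.Build K tensor Z *:%R (lift f) (lift_is_linear f).

Lemma tens_is_bilinear :
  bilinear_for
    (GRing.Scale.Law.clone _ _ *:%R _) (GRing.Scale.Law.clone _ _ *:%R _) tens.
Proof.
split=> [w|u] a x y /=; apply: tensor_eqP => Z f;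
  rewrite linearP /= !lift_tens.
- by rewrite linearPl.
- by rewrite linearPr.
Qed.

HB.instance Definition _ :=
  bilinear_isBilinear.Build K U W tensor _ _ tens tens_is_bilinear.

Lemma tensorE (x : tensor) : x = \sum_(p <- repr x) tens p.1 p.2.
Proof.
apply: tensor_eqP => Z f; rewrite linear_sum /=.
by apply: eq_bigr => p _; rewrite lift_tens.
Qed.

Lemma tensor_linear_ext (Z : lmodType K) (f g : {linear tensor -> Z}) :
  (forall u w, f (tens u w) = g (tens u w)) -> f =1 g.
Proof.
move=> fg x; rewrite (tensorE x) !linear_sum.
by apply: eq_bigr => p _; exact: fg.
Qed.

End Tensor.

Notation "V ⊗t W" := (tensor V W) (at level 40, left associativity) : type_scope.
Notation "v ⊗ w" := (tens v w) (at level 40, left associativity) : ring_scope.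

Section TensorSquare.
Variables (K : fieldType) (V : lmodType K).

Definition swap_pure (v w : V) : V ⊗t V := w ⊗ v.

Lemma swap_pure_is_bilinear :
  bilinear_for
    (GRing.Scale.Law.clone _ _ *:%R _) (GRing.Scale.Law.clone _ _ *:%R _)
    swap_pure.
Proof.
by split=> [w|u] a x y /=; rewrite /swap_pure ?linearPl ?linearPr.
Qed.
HB.instance Definition _ :=
  bilinear_isBilinear.Build K V V (V ⊗t V) _ _ swap_pure swap_pure_is_bilinear.

Definition swap : V ⊗t V -> V ⊗t V := lift swap_pure.
HB.instance Definition _ := GRing.Linear.on swap.

Lemma swap_tens v w : swap (v ⊗ w) = w ⊗ v.
Proof. exact: lift_tens. Qed.

(* The image of the tensor product of the subspaces A and B. *)
Definition tens_set (A B : set V) : set (V ⊗t V) :=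
  span [set a ⊗ b | a in A & b in B].

Definition Sym2 (A : set V) : set (V ⊗t V) :=
  [set x | tens_set A A x /\ swap x = x].

Lemma tens_setT x : tens_set setT setT x.
Proof.
move=> S [[S0 SD] Ssub]; rewrite (tensorE x).
elim/big_rec: _ => // p y _ Sy; rewrite -[X in X + _]scale1r; apply: SD => //.
by apply: Ssub; exists p.1 => //; exists p.2.
Qed.

End TensorSquare.

HB.mixin Record Lmodule_isLie (K : fieldType) L of GRing.Lmodule K L := {
  lie : L -> L -> L ;
  lie_linearl : forall y, linear (lie ^~ y) ;
  lie_linearr : forall x, linear (lie x) ;
  liexx : forall x, lie x x = 0 ;
  lie_jacobi : forall x y z,
    lie x (lie y z) + lie y (lie z x) + lie z (lie x y) = 0
}.

#[short(type="lieAlgType")]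
HB.structure Definition LieAlgebra (K : fieldType) :=
  { L of GRing.Lmodule K L & Lmodule_isLie K L }.

Lemma lie_is_bilinear (K : fieldType) (L : lieAlgType K) :
  bilinear_for
    (GRing.Scale.Law.clone _ _ *:%R _) (GRing.Scale.Law.clone _ _ *:%R _)
    (@lie K L).
Proof. by split; [exact: lie_linearl | exact: lie_linearr]. Qed.
HB.instance Definition _ (K : fieldType) (L : lieAlgType K) :=
  bilinear_isBilinear.Build K L L L _ _ (@lie K L) (@lie_is_bilinear K L).

Section LieNotions.
Variables (K : fieldType) (g : lieAlgType K).
Implicit Types (l m h t I A : set g) (x y : g).

Definition lie_set A B : set g := span [set lie x y | x in A & y in B].

Definition subalgebra l :=
  subspace l /\ forall x y, l x -> l y -> l (lie x y).

Definition ideal_of l I :=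
  [/\ subspace I, I `<=` l & forall x y, l x -> I y -> I (lie x y)].

(* The adjoint representation of l is completely reducible. *)
Definition reductive l :=
  subalgebra l /\
  forall I, ideal_of l I -> exists2 J, ideal_of l J & direct_sum2 l I J.

Fixpoint lower_central l n : set g :=
  if n is n'.+1 then lie_set l (lower_central l n') else l.

Definition nilpotent l := exists n, lower_central l n = [set 0].

Definition normalizer l h : set g :=
  [set x | l x /\ forall y, h y -> h (lie x y)].

Definition cartan_subalgebra l h :=
  [/\ subalgebra h, h `<=` l, nilpotent h & normalizer l h = h].

Definition root_space l h (a : g -> K) : set g :=
  [set x | l x /\ forall y, h y -> lie y x = a y *: x].

Definition is_root l h (a : g -> K) :=
  [/\ dual h a, a <> 0 & root_space l h a <> [set 0]].

Definition root_inclusion l m h :=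
  [/\ l `<=` m, cartan_subalgebra m h, cartan_subalgebra l (l `&` h) &
      forall a, is_root l (l `&` h) a ->
        exists2 b, is_root m h b & root_space l (l `&` h) a = root_space m h b].

(* The pair (G, H) exhibits g as a root-reductive Lie algebra. *)
Record root_reductive (G H : nat -> set g) : Prop := RootReductive {
  rr_reductive : forall i, reductive (G i) ;
  rr_finite_dim : forall i, finite_dim (G i) ;
  rr_cartan : forall i, cartan_subalgebra (G i) (H i) ;
  rr_inclusion : forall i, root_inclusion (G i) (G i.+1) (H i.+1) ;
  rr_cartanI : forall i, H i = H i.+1 `&` G i ;
  rr_union : \bigcup_i G i = setT
}.

(* ad x acts semisimply on l: every invariant subspace of l has an invariant  *)
(* complement.                                                                *)
Definition ad_stable x A := forall y, A y -> A (lie x y).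

Definition ad_semisimple l x :=
  forall A, subspace A -> A `<=` l -> ad_stable x A ->
  exists B, [/\ subspace B, ad_stable x B & direct_sum2 l A B].

Definition semisimple_elt (G : nat -> set g) x :=
  exists i, G i x /\ ad_semisimple (G i) x.

Definition toral (G : nat -> set g) t :=
  subalgebra t /\ forall x, t x -> semisimple_elt G x.

Definition maximal_toral (G : nat -> set g) t :=
  toral G t /\ forall t', toral G t' -> t `<=` t' -> t' = t.

Definition center_of l : set g :=
  [set x | l x /\ forall y, l y -> lie x y = 0].

Definition abelian_set l := forall x y, l x -> l y -> lie x y = 0.

Definition is_module (M : lmodType K) (rho : g -> M -> M) :=
  [/\ forall v, linear (rho ^~ v), forall x, linear (rho x) &
      forall x y v, rho (lie x y) v = rho x (rho y v) - rho y (rho x v)].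

Section Weights.
Variables (M : lmodType K) (rho : g -> M -> M) (t : set g).

Definition weight_space (a : g -> K) : set M :=
  [set m | exists2 i, (0 < i)%N &
           forall x, t x -> iter i (fun v => rho x v - a x *: v) m = 0].

Definition supp : set (g -> K) :=
  [set a | dual t a /\ weight_space a <> [set 0]].

End Weights.

End LieNotions.

Definition lie_hom (K : fieldType) (g1 g2 : lieAlgType K) (f : g1 -> g2) :=
  linear f /\ forall x y, f (lie x y) = lie (f x) (f y).

(* f embeds l as a direct summand of the Lie algebra [g, g], with             *)
(* complementary ideal k.                                                     *)
Definition derived_summand (K : fieldType) (l g : lieAlgType K) (f : l -> g)
    (k : set g) :=
  let g' := lie_set [set: g] [set: g] in
  [/\ lie_hom f, injective f, ideal_of g' (range f), ideal_of g' k
    & direct_sum2 g' (range f) k].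

Definition centralizer_in (K : fieldType) (l g : lieAlgType K) (f : l -> g)
    (t : set g) : set l := [set x | forall y, t y -> lie (f x) y = 0].

Section Symplectic.
Variables (K : fieldType) (V : lmodType K) (w : {skew_symmetric V}).

Definition nondegenerate_form := forall u, (forall v, w u v = 0) -> u = 0.

Definition act_pure (u a b : V) : V := w u b *: a.

Lemma act_pure_is_bilinear u :
  bilinear_for
    (GRing.Scale.Law.clone _ _ *:%R _) (GRing.Scale.Law.clone _ _ *:%R _)
    (act_pure u).
Proof.
split=> [b|a] c x y /=; rewrite /act_pure.
- by rewrite scalerDr !scalerA mulrC.
- by rewrite linearPr /= scalerDl scalerA.
Qed.
HB.instance Definition _ u :=
  bilinear_isBilinear.Build K V V V _ _ (act_pure u) (act_pure_is_bilinear u).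

Definition tens_act (x : V ⊗t V) (u : V) : V := lift (act_pure u) x.

Lemma tens_act_tens a b u : tens_act (a ⊗ b) u = w u b *: a.
Proof. exact: lift_tens. Qed.

(* (a ⊗ b) · (a' ⊗ b') = <a', b> a ⊗ b' = ((a ⊗ b) a') ⊗ b' *)
Definition mul_pure (x : V ⊗t V) (a' b' : V) : V ⊗t V := tens_act x a' ⊗ b'.

Lemma tens_act_linearl u : linear (tens_act ^~ u).
Proof. by move=> c x y; rewrite /tens_act linearP. Qed.

Lemma tens_act_linearr x : linear (tens_act x).
Proof.
move=> c u v; rewrite /tens_act /lift /fsum scaler_sumr -big_split /=.
apply: eq_bigr => p _; rewrite /act_pure.
by rewrite linearPl /= scalerDl scalerA.
Qed.

Lemma mul_pure_is_bilinear x :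
  bilinear_for
    (GRing.Scale.Law.clone _ _ *:%R _) (GRing.Scale.Law.clone _ _ *:%R _)
    (mul_pure x).
Proof.
split=> [b|a] c u v /=; rewrite /mul_pure.
- by rewrite tens_act_linearr linearPl.
- by rewrite linearPr.
Qed.
HB.instance Definition _ x :=
  bilinear_isBilinear.Build K V V (V ⊗t V) _ _ (mul_pure x)
    (mul_pure_is_bilinear x).

Definition tens_mul (x y : V ⊗t V) : V ⊗t V := lift (mul_pure x) y.

Lemma tens_mul_tens a b a' b' :
  tens_mul (a ⊗ b) (a' ⊗ b') = w a' b *: (a ⊗ b').
Proof. by rewrite /tens_mul lift_tens /= /mul_pure tens_act_tens linearZl_LR. Qed.

Lemma tens_mul_linearr x : linear (tens_mul x).
Proof. by move=> c y z; rewrite /tens_mul linearP. Qed.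

Lemma tens_mul_linearl y : linear (tens_mul ^~ y).
Proof.
move=> c x z; rewrite /tens_mul /lift /fsum scaler_sumr -big_split /=.
apply: eq_bigr => p _; rewrite /mul_pure.
by rewrite tens_act_linearl linearPl.
Qed.

Lemma tens_mulE x y : tens_mul x y = \sum_(p <- repr y) tens_act x p.1 ⊗ p.2.
Proof. by []. Qed.

Lemma tens_actE x u : tens_act x u = \sum_(p <- repr x) w u p.2 *: p.1.
Proof. by []. Qed.

HB.instance Definition _ :=
  bilinear_isBilinear.Build K (V ⊗t V) V V (GRing.Scale.Law.clone _ _ *:%R _)
    (GRing.Scale.Law.clone _ _ *:%R _) tens_act
    (tens_act_linearl, tens_act_linearr).

HB.instance Definition _ :=
  bilinear_isBilinear.Build K (V ⊗t V) (V ⊗t V) (V ⊗t V)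
    (GRing.Scale.Law.clone _ _ *:%R _) (GRing.Scale.Law.clone _ _ *:%R _)
    tens_mul (tens_mul_linearl, tens_mul_linearr).

Lemma tens_mul_act x y u : tens_act (tens_mul x y) u = tens_act x (tens_act y u).
Proof.
rewrite tens_mulE (tens_actE y) linear_sumr linear_sumlz.
by apply: eq_bigr => p _; rewrite /= tens_act_tens linearZr_LR.
Qed.

Lemma tens_mulA : associative tens_mul.
Proof.
move=> x y z; rewrite (tens_mulE y) (tens_mulE (tens_mul x y)) linear_sumr.
by apply: eq_bigr => p _; rewrite /= /tens_mul lift_tens /mul_pure tens_mul_act.
Qed.

Lemma swap_mul x y : swap (tens_mul x y) = - tens_mul (swap y) (swap x).
Proof.
have skew u v : w u v = - w v u by rewrite hermC /= expr1 mulN1r.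
have mulss (I J : Type) (r : seq I) (r' : seq J) (F : I -> V ⊗t V) G :
    tens_mul (\sum_(p <- r) F p) (\sum_(q <- r') G q)
    = \sum_(p <- r) \sum_(q <- r') tens_mul (F p) (G q).
  by rewrite linear_sumlz; apply: eq_bigr => p _; rewrite /= linear_sumr.
have swaps (I : Type) (r : seq I) (F : I -> V ⊗t V) :
    swap (\sum_(p <- r) F p) = \sum_(p <- r) swap (F p).
  by rewrite linear_sum.
rewrite (tensorE x) (tensorE y) mulss !swaps mulss exchange_big /= -sumrN.
apply: eq_bigr => q _; rewrite swaps -sumrN; apply: eq_bigr => p _.
rewrite !swap_tens !tens_mul_tens linearZ /= swap_tens -scaleNr.
by rewrite skew.
Qed.

Definition sp_pred : {pred V ⊗t V} := fun x => `[< Sym2 [set: V] x >].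

Lemma sp_predE x : (x \in sp_pred) = (swap x == x).
Proof.
apply/asboolP/eqP => [[]//|sx]; split=> //; exact: tens_setT.
Qed.

Fact sp_submod_closed : subsemimod_closed sp_pred.
Proof.
split; first split; first by rewrite sp_predE linear0.
- by move=> x y; rewrite !sp_predE => /eqP sx /eqP sy; rewrite linearD /= sx sy.
- by move=> a x; rewrite !sp_predE => /eqP sx; rewrite linearZ /= sx.
Qed.
HB.instance Definition _ :=
  GRing.isSubmodClosed.Build K (V ⊗t V) sp_pred sp_submod_closed.

(* The form is a phantom parameter: the bracket depends on it. *)
Record sp (f : {skew_symmetric V}) : Type :=
  Sp { sp_val :> V ⊗t V ; sp_valP : sp_val \in sp_pred }.
HB.instance Definition _ (f : {skew_symmetric V}) := [isSub for @sp_val f].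
HB.instance Definition _ (f : {skew_symmetric V}) := [Choice of sp f by <:].
HB.instance Definition _ (f : {skew_symmetric V}) := [SubChoice_isSubLmodule of sp f by <:].

Lemma sp_lie_subproof (x y : sp w) :
  tens_mul x y - tens_mul y x \in sp_pred.
Proof.
have /eqP sx : swap (sp_val x) == sp_val x by rewrite -sp_predE sp_valP.
have /eqP sy : swap (sp_val y) == sp_val y by rewrite -sp_predE sp_valP.
rewrite sp_predE linearB /= !swap_mul. by rewrite sx sy opprK addrC.
Qed.

Definition sp_lie (x y : sp w) : sp w := Sp w (sp_lie_subproof x y).

Fact sp_lie_linearl y : linear (sp_lie ^~ y).
Proof.
move=> a x z; apply: val_inj => /=.
rewrite tens_mul_linearl tens_mul_linearr opprD addrACA.
by rewrite scalerBr.
Qed.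

Fact sp_lie_linearr x : linear (sp_lie x).
Proof.
move=> a y z; apply: val_inj => /=.
rewrite tens_mul_linearl tens_mul_linearr opprD addrACA.
by rewrite scalerBr.
Qed.

Fact sp_liexx x : sp_lie x x = 0.
Proof. by apply: val_inj; rewrite /= subrr. Qed.

Fact sp_lie_jacobi x y z :
  sp_lie x (sp_lie y z) + sp_lie y (sp_lie z x) + sp_lie z (sp_lie x y) = 0.
Proof.
have mBr a b c : tens_mul a (b - c) = tens_mul a b - tens_mul a c.
  by have := tens_mul_linearr a (-1) c b; rewrite !scaleN1r ![- _ + _]addrC.
have mBl a b c : tens_mul (b - c) a = tens_mul b a - tens_mul c a.
  by have := tens_mul_linearl a (-1) c b; rewrite !scaleN1r ![- _ + _]addrC.
apply: val_inj => /=; rewrite !mBr !mBl !tens_mulA.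
set a1 := tens_mul (tens_mul x y) z; set a2 := tens_mul (tens_mul x z) y.
set a3 := tens_mul (tens_mul y x) z; set a4 := tens_mul (tens_mul y z) x.
set a5 := tens_mul (tens_mul z x) y; set a6 := tens_mul (tens_mul z y) x.
rewrite !opprB !addrA !subrK (addrAC _ (- a3) a2) (addrAC _ a6 a2) subrK.
by rewrite (addrAC _ (- a3) (- a6)) addrK subrK subrr.
Qed.

HB.instance Definition _ := Lmodule_isLie.Build K (sp w)
  sp_lie_linearl sp_lie_linearr sp_liexx sp_lie_jacobi.

Definition sp_act (x : sp w) (u : V) : V := tens_act x u.

Lemma amp_subproof (a b : V) : a ⊗ b + b ⊗ a \in sp_pred.
Proof. by rewrite sp_predE linearD /= !swap_tens addrC. Qed.

Definition amp (a b : V) : sp w := Sp w (amp_subproof a b).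

Definition amp_set (A B : set V) : set (sp w) :=
  span [set amp a b | a in A & b in B].

Definition Sym2_sp (A : set V) : set (sp w) := @sp_val w @^-1` Sym2 A.

End Symplectic.

Arguments amp {K V} w a b.
Arguments amp_set {K V} w A B.
Arguments Sym2_sp {K V} w A.
Arguments sp_act {K V} w x u.

(* Main.v *)
Require Import Defs.
From mathcomp Require Import all_boot all_order all_algebra sesquilinear.
From mathcomp Require Import boolp classical_sets functions reals complex.
From mathcomp Require Import ring.

Set Implicit Arguments.
Unset Strict Implicit.
Unset Printing Implicit Defensive.

Local Open Scope classical_set_scope.
Local Open Scope ring_scope.

Import GRing.Theory Num.Theory.
Local Notation span := (@Defs.span _ _).

(* Every element x of a toral subalgebra acts diagonalizably on all of g.     *)
(* Indeed, suppose that ad x is semisimple on G i and let N be the nilpotent  *)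
(* part of ad x on a larger G j. Then N commutes with ad (G i), hence         *)
(* T |-> tr (N T) is a G i-invariant functional on End (G j) that kills the   *)
(* G i-invariant T. The center of G i lies in H j, which acts diagonalizably  *)
(* on G j, so the Casimir elements of the minimal ideals of G i force this    *)
(* functional to be 0, i.e., N = 0. Consequently toral subalgebras are        *)
(* abelian, and, ad x being diagonalizable on Sym^2 V, x acts diagonalizably  *)
(* on V: generalized weight vectors are weight vectors.                       *)
(*   If u and v have opposite weights and <u, v> <> 0, then u & v is          *)
(* semisimple and commutes with t, so it lies in t when t is maximal;         *)
(* evaluating it on vectors of the same weight as u shows that this weight is *)
(* nonzero and that its weight space is a line. The centralizer of t in sp(V) *)
(* is always spanned by the u & v with u and v of opposite weights: the image *)
(* of a finite-rank operator commuting with t is a sum of weight spaces.      *)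

(** * Operators and generalized eigenvectors *)

(** Everything is reduced to diagonalizability. By [semisimple_eltP], [x] is semisimple exactly when
    [lie x] is diagonalizable on the whole algebra. The hard step is [ldiag_extend]: semisimplicity
    on a reductive [l] persists on a larger reductive [m]. It combines [invariant_functional0],
    proved with Casimir elements and Cartan's criterion, with [cartan_ldiag], which says that a
    Cartan subalgebra of a reductive algebra acts diagonalizably. A toral subalgebra is then a
    subalgebra of ad-diagonalizable elements, and it is abelian.

    To reach [V], the weight of [u] is read off from the tensor u & u: by [act_ldiag] an
    ad-diagonalizable [x] is diagonalizable on [V]. So each weight space of t is a common
    eigenspace, and two weights can pair under the form only if they are opposite. [V] is not
    assumed to be a sum of weight spaces, but finite-dimensional t-stable subspaces lie in such a
    sum ([weight_decomposition]). As elements of sp(V) have finite rank, this suffices to span the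
    centralizer of t by the u & v with u, v of opposite weights ([centralizer_amp]).

    Let t be maximal. If u, v have opposite weights and <u,v> is nonzero, then u & v is
    diagonalizable ([iota_amp_ldiag]) and commutes with t, so it lies in t ([amp_in_torus]). It
    scales u by <u,v>, so weight 0 is impossible ([zero_weight_isotropic]); applied to the whole
    weight space of u it shows that this space is a line ([weight_line]). Generators of the
    centralizer therefore either are multiples of elements of t or come from weights that do not
    pair, and in both cases they commute with all others ([opposite_amps_commute]). This gives (4),
    and (2) follows from it. Tensors in Sym^2 of the isotropic space V^0 square to 0, so a
    diagonalizable one vanishes ([Sym2_spP]).

    For g = sp(V), an element x of a toral subalgebra containing t centralizes t, so x = y + z with
    y from the nonzero weights and z in Sym^2(V^0) ([sp_centralizer_sum]). Under either side of the
    equivalence y lies in t, and then z is diagonalizable, hence 0. With t itself as the toral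
    subalgebra this proves (6); with an arbitrary one it proves the maximality of t from (3), (5),
    (6). *)

Section Subspace.
Variables (K : fieldType) (M : lmodType K).
Implicit Types (A B C : set M).

Lemma subspace0 A : subspace A -> A 0. Proof. by case. Qed.

Lemma subspaceD A u v : subspace A -> A u -> A v -> A (u + v).
Proof. by move=> [_ h] Au Av; rewrite -[u]scale1r; exact: h. Qed.

Lemma subspaceZ A c u : subspace A -> A u -> A (c *: u).
Proof. by move=> [h0 h] Au; rewrite -[c *: u]addr0; exact: h. Qed.

Lemma subspaceN A u : subspace A -> A u -> A (- u).
Proof. by move=> hA Au; rewrite -scaleN1r; exact: subspaceZ. Qed.

Lemma subspaceB A u v : subspace A -> A u -> A v -> A (u - v).
Proof. by move=> hA Au Av; apply: subspaceD => //; exact: subspaceN. Qed.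

Lemma subspaceZN A c u : subspace A -> c != 0 -> A (c *: u) -> A u.
Proof.
by move=> hA c0 /(subspaceZ c^-1 hA); rewrite scalerA mulVf // scale1r.
Qed.

Lemma subspace_sum A : subspace A ->
  forall (I : Type) (r : seq I) (P : pred I) (F : I -> M),
  (forall i, P i -> A (F i)) -> A (\sum_(i <- r | P i) F i).
Proof.
move=> hA I r P F AF; elim/big_rec: _ => [|i x Pi Ax]; first exact: subspace0.
by apply: subspaceD => //; exact: AF.
Qed.

Lemma subspaceI A B : subspace A -> subspace B -> subspace (A `&` B).
Proof.
move=> hA hB; split; first by split; exact: subspace0.
move=> c u v [Au Bu] [Av Bv]; split; apply: subspaceD => //; exact: subspaceZ.
Qed.

Lemma subspaceT : subspace [set: M]. Proof. by []. Qed.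

Lemma subspace_set0 : subspace [set (0 : M)].
Proof. by split=> // c u v /= -> ->; rewrite scaler0 addr0. Qed.

Lemma span_sub (S : set M) A : subspace A -> S `<=` A -> span S `<=` A.
Proof. by move=> hA SA; exact: smallest_sub. Qed.

Lemma sub_span (S : set M) : S `<=` span S.
Proof. exact: sub_smallest. Qed.

Lemma mem_span (S : set M) v : S v -> span S v.
Proof. exact: sub_span. Qed.

Lemma subspace_span (S : set M) : subspace (span S).
Proof.
split=> [B [hB _]|c u v Su Sv B hB]; first exact: subspace0.
have [Bu Bv] := (Su _ hB, Sv _ hB); case: hB => hB _.
by apply: subspaceD => //; exact: subspaceZ.
Qed.

Lemma span_mono (S S' : set M) : S `<=` S' -> span S `<=` span S'.
Proof.
by move=> SS'; apply: span_sub; [exact: subspace_span|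
  exact: subset_trans (@sub_span _)].
Qed.

Definition addset A B : set M := [set x | exists a b, [/\ A a, B b & x = a +
  b]].

Lemma subspace_add A B : subspace A -> subspace B -> subspace (addset A B).
Proof.
move=> hA hB; split.
  by exists 0, 0; rewrite addr0; split=> //; exact: subspace0.
move=> c _ _ [a [b [Aa Bb ->]]] [a' [b' [Aa' Bb' ->]]].
exists (c *: a + a'), (c *: b + b'); split.
- by apply: subspaceD => //; exact: subspaceZ.
- by apply: subspaceD => //; exact: subspaceZ.
- by rewrite scalerDr addrACA.
Qed.

Lemma subl_addset A B : subspace B -> A `<=` addset A B.
Proof. by move=> hB a Aa; exists a, 0; rewrite addr0; split=> //;
  exact: subspace0. Qed.

Lemma subr_addset A B : subspace A -> B `<=` addset A B.
Proof. by move=> hA b Bb; exists 0, b; rewrite add0r; split=> //;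
  exact: subspace0. Qed.

End Subspace.

Section LinearFun.
Variables (K : fieldType) (M N : lmodType K) (T : M -> N).
Hypothesis lT : linear T.

Lemma lin0 : T 0 = 0.
Proof. by rewrite -[0 in LHS](addNr 0) -scaleN1r lT scaleN1r addNr. Qed.
Lemma linD u v : T (u + v) = T u + T v.
Proof. by rewrite -[u in LHS]scale1r lT scale1r. Qed.
Lemma linZ c u : T (c *: u) = c *: T u.
Proof. by rewrite -[c *: u in LHS]addr0 lT lin0 addr0. Qed.
Lemma linN u : T (- u) = - T u.
Proof. by rewrite -scaleN1r linZ scaleN1r. Qed.
Lemma linB u v : T (u - v) = T u - T v.
Proof. by rewrite linD linN. Qed.
Lemma lin_sum (I : Type) (r : seq I) (P : pred I) (F : I -> M) :
  T (\sum_(i <- r | P i) F i) = \sum_(i <- r | P i) T (F i).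
Proof. by apply: (big_morph T linD lin0). Qed.

Lemma subspace_preim (A : set N) : subspace A -> subspace (T @^-1` A).
Proof.
move=> hA; split; rewrite /preimage /=; first by rewrite lin0; exact: subspace0.
by move=> c u v Au Av; rewrite lT; apply: subspaceD => //; exact: subspaceZ.
Qed.

Lemma subspace_image (A : set M) : subspace A -> subspace (T @` A).
Proof.
move=> hA; split; first by exists 0; [exact: subspace0|exact: lin0].
move=> c _ _ [u Au <-] [v Av <-]; exists (c *: u + v); last exact: lT.
by apply: subspaceD => //; exact: subspaceZ.
Qed.

End LinearFun.

Section OperatorPolynomial.
Variables (K : fieldType) (M : lmodType K).
Implicit Types (T : M -> M) (p q : {poly K}) (v : M) (A : set M).

(** The polynomial [p] evaluated at [T], applied to [v]. [T] is a bare function, so that [lie x] on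
    an infinite-dimensional algebra is covered. *)
Definition pop T p v : M := \sum_(i < size p) p`_i *: iter i T v.

Lemma pop_widen T p v n :
  (size p <= n)%N -> pop T p v = \sum_(i < n) p`_i *: iter i T v.
Proof.
move=> hn; rewrite /pop (big_ord_widen _ (fun i => p`_i *: iter i T v) hn).
rewrite big_mkcond; apply: eq_bigr => i _; case: ltnP => // hi.
by rewrite nth_default // scale0r.
Qed.

Lemma pop0 T v : pop T 0 v = 0.
Proof. by rewrite /pop size_poly0 big_ord0. Qed.

Lemma popD T p q v : pop T (p + q) v = pop T p v + pop T q v.
Proof.
set n := maxn (size p) (size q).
rewrite (@pop_widen _ (p + q) _ n) ?size_polyD // (@pop_widen _ p _ n)
  ?leq_maxl //.
rewrite (@pop_widen _ q _ n) ?leq_maxr // -big_split.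
by apply: eq_bigr => i _; rewrite coefD scalerDl.
Qed.

Lemma popZ T c p v : pop T (c *: p) v = c *: pop T p v.
Proof.
rewrite (@pop_widen _ _ _ (size p)) ?size_scale_leq // /pop scaler_sumr.
by apply: eq_bigr => i _; rewrite coefZ scalerA.
Qed.

Lemma popC T c v : pop T c%:P v = c *: v.
Proof.
by rewrite (@pop_widen _ _ _ 1) ?size_polyC_leq1 // big_ord1 coefC.
Qed.

Lemma pop_mulX T p v : pop T (p * 'X) v = pop T p (T v).
Proof.
rewrite (@pop_widen _ _ _ (size p).+1).
  rewrite big_ord_recl coefMX eqxx scale0r add0r; apply: eq_bigr => i _.
  by rewrite coefMX /= -iterS iterSr.
by rewrite (leq_trans (size_polyMleq _ _)) // size_polyX addn2.
Qed.

Lemma pop_linear T p : linear T -> linear (pop T p).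
Proof.
move=> lT c u v; rewrite /pop scaler_sumr -big_split; apply: eq_bigr => i _ /=.
have -> : iter i T (c *: u + v) = c *: iter i T u + iter i T v.
  by elim: (nat_of_ord i) => //= j ->; rewrite lT.
by rewrite scalerDr !scalerA mulrC.
Qed.

Lemma popX T v : pop T 'X v = T v.
Proof. by rewrite -['X]mul1r pop_mulX -[1]/(1%:P) popC scale1r. Qed.

Lemma popM T p q v : linear T -> pop T (p * q) v = pop T p (pop T q v).
Proof.
move=> lT; elim/poly_ind: q v => [|q c IH] v.
  by rewrite mulr0 !pop0 (lin0 (pop_linear _ lT)).
rewrite mulrDr mulrA !popD !pop_mulX (mulrC p c%:P) mul_polyC popZ popC IH.
by rewrite (linD (pop_linear _ lT)) (linZ (pop_linear _ lT)).
Qed.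

Lemma pop1 T v : pop T 1 v = v.
Proof. by rewrite -[1]/(1%:P) popC scale1r. Qed.

Lemma popMC T p q v : linear T -> pop T p (pop T q v) = pop T q (pop T p v).
Proof. by move=> lT; rewrite -!popM // mulrC. Qed.

Lemma popXsubC T l v : pop T ('X - l%:P) v = T v - l *: v.
Proof. by rewrite popD popX -polyCN popC scaleNr. Qed.

Lemma pop_dvd T p q v : linear T -> p %| q -> pop T p v = 0 -> pop T q v = 0.
Proof.
move=> lT pq pv0; have [r ->] := dvdpP _ _ pq.
by rewrite popM // pv0 (lin0 (pop_linear _ lT)).
Qed.

Lemma pop_eig T p l v : linear T -> T v = l *: v -> pop T p v = p.[l] *: v.
Proof.
move=> lT Tv; rewrite /pop horner_coef scaler_suml; apply: eq_bigr => i _.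
have -> : iter i T v = l ^+ i *: v; last by rewrite scalerA.
by elim: (nat_of_ord i) => [|j /= ->];
  rewrite ?scale1r // linZ // Tv scalerA exprSr.
Qed.

Definition stable T A := forall v, A v -> A (T v).

Lemma stable_pop T p A : subspace A -> stable T A -> stable (pop T p) A.
Proof.
move=> hA sT v Av; apply: (subspace_sum hA) => i _; apply: subspaceZ => //.
by elim: (nat_of_ord i) => //= j; exact: sT.
Qed.

Lemma pop_comm T S p v : linear S -> (forall u, S (T u) = T (S u)) ->
  S (pop T p v) = pop T p (S v).
Proof.
move=> lS ST; rewrite (lin_sum lS); apply: eq_bigr => i _.
rewrite (linZ lS); congr (_ *: _).
by elim: (nat_of_ord i) => //= j <-; rewrite ST.
Qed.

Definition geig T l v := exists k, iter k (fun u => T u - l *: u) v = 0.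

Lemma iter_pop T l k v : linear T ->
  iter k (fun u => T u - l *: u) v = pop T (('X - l%:P) ^+ k) v.
Proof.
move=> lT; elim: k v => [|k IH] v; first by rewrite pop1.
by rewrite exprS popM //= IH popXsubC.
Qed.

Lemma geigP T l v : linear T ->
  geig T l v <-> exists k, pop T (('X - l%:P) ^+ k) v = 0.
Proof. by move=> lT; split=> -[k hk]; exists k; rewrite -hk iter_pop. Qed.

Lemma geig_eig T l v : T v = l *: v -> geig T l v.
Proof. by move=> Tv; exists 1; rewrite /= Tv subrr. Qed.

Lemma subspace_geig T l : linear T -> subspace (geig T l).
Proof.
move=> lT; split; first by exists 0.
move=> c u v /(geigP _ _ lT)[k uk] /(geigP _ _ lT)[j vj]; apply/geigP => //.
exists (k + j)%N; rewrite exprD pop_linear // !popM // vj popMC // uk.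
by rewrite !(lin0 (pop_linear _ lT)) scaler0 addr0.
Qed.

Lemma geig_neq T l c v :
  linear T -> geig T l v -> T v = c *: v -> c != l -> v = 0.
Proof.
move=> lT /(geigP _ _ lT)[k + Tv cl]; rewrite (pop_eig _ lT Tv).
rewrite horner_exp hornerXsubC => /eqP; rewrite scaler_eq0 expf_eq0 subr_eq0.
by rewrite (negPf cl) andbF => /eqP.
Qed.

Lemma stable_XsubC T l A : subspace A -> stable T A ->
  stable (fun u => T u - l *: u) A.
Proof.
move=> hA sT v Av; apply: subspaceB => //; first exact: sT.
exact: subspaceZ.
Qed.

End OperatorPolynomial.

Section ClosedField.
Variables (K : closedFieldType) (M : lmodType K).
Implicit Types (T : M -> M) (p q : {poly K}) (v : M) (A C : set M).

(** The whole power of ['X - l] is split off, so that the cofactor is smaller and coprime to every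
    power of ['X - l]; this drives the induction of [geig_span]. *)
Lemma coprime_split p l : p != 0 -> root p l ->
  exists (q : {poly K}) m, [/\ (0 < m)%N, (size q < size p)%N, q != 0,
    p = q * ('X - l%:P) ^+ m & forall k, coprimep q (('X - l%:P) ^+ k)].
Proof.
move=> p0 pl; have [m [q + pE]] := multiplicity_XsubC p l.
rewrite p0 /= => ql; have q0 : q != 0.
  by apply: contraNneq ql => ->; exact: root0.
have m0 : (0 < m)%N.
  by case: m pE => // pE; move: pl; rewrite pE expr0 mulr1 (negPf ql).
exists q, m; split=> //.
  rewrite pE size_Mmonic ?monic_exp ?monicXsubC // size_exp_XsubC addnS /=.
  by rewrite -[X in (X < _)%N]addn0 ltn_add2l.
by move=> k; apply: coprimep_expr; rewrite coprimep_XsubC.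
Qed.

(* Decomposes v into generalized eigenvectors, each of which is a polynomial  *)
(* in T applied to v.                                                         *)
Lemma geig_span T p v C : linear T -> p != 0 -> pop T p v = 0 -> subspace C ->
  (forall q l, geig T l (pop T q v) -> C (pop T q v)) -> C v.
Proof.
move=> lT + + hC; have [n] := ubnP (size p); elim: n => // n IH in p v *.
rewrite ltnS => pn p0 pv0 Cv; have [p1|p1] := eqVneq (size p) 1%N.
  suff -> : v = 0 by exact: subspace0.
  have /size_poly1P[c c0 pE] : size p == 1%N by rewrite p1.
  move: pv0; rewrite pE popC => /eqP; rewrite scaler_eq0 (negPf c0).
  by move/eqP.
have [l pl] := closed_rootP _ p1.
have [q [m [m0 qp q0 pE cop]]] := coprime_split p0 pl.
have /Bezout_eq1_coprimepP[[a b] /= ab] := cop m.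
have vE : v = pop T (a * q) v + pop T (b * ('X - l%:P) ^+ m) v.
  by rewrite -popD ab pop1.
rewrite vE; apply: subspaceD => //.
  apply: (Cv _ l); apply/geigP => //; exists m; rewrite -popM //.
  by rewrite mulrCA (mulrC _ q) -pE popM // pv0 (lin0 (pop_linear _ lT)).
apply: (IH q) => //; first exact: leq_trans qp pn.
  by rewrite -popM // mulrCA -pE popM // pv0 (lin0 (pop_linear _ lT)).
by move=> r l'; rewrite -popM //; exact: Cv.
Qed.

(** Chinese remainder theorem: the moduli for distinct roots are coprime, so one polynomial takes
    all prescribed constant residues. *)
Lemma crt_XsubC (f : K -> K) m (rs : seq K) :
  exists q, forall l, l \in rs -> ('X - l%:P) ^+ m %| q - (f l)%:P.
Proof.
elim: rs => [|l rs [q IH]]; first by exists 0.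
have [lrs|lrs] := boolP (l \in rs).
  by exists q => l'; rewrite inE => /orP[/eqP->|]; exact: IH.
pose P : {poly K} := \prod_(r <- rs) ('X - r%:P) ^+ m.
have cop : coprimep P (('X - l%:P) ^+ m).
  apply: coprimep_expr; rewrite coprimep_XsubC /root horner_prod prodf_seq_neq0.
  apply/allP => r rrs /=; rewrite horner_exp hornerXsubC expf_neq0 // subr_eq0.
  by apply: contraNneq lrs => ->.
have /Bezout_eq1_coprimepP[[a b] /= ab] := cop.
exists (q * (b * ('X - l%:P) ^+ m) + (f l)%:P * (a * P)) => l'.
rewrite inE => /orP[/eqP->|l'rs].
  have -> : q * (b * ('X - l%:P) ^+ m) + (f l)%:P * (a * P) - (f l)%:P
    = (q - (f l)%:P) * b * ('X - l%:P) ^+ m.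
    have -> : a * P = 1 - b * ('X - l%:P) ^+ m by rewrite -ab addrK.
    by ring.
  exact: dvdp_mulIr.
have -> : q * (b * ('X - l%:P) ^+ m) + (f l)%:P * (a * P) - (f l')%:P
  = (q - (f l')%:P) + ((f l)%:P - q) * a * P.
  have -> : b * ('X - l%:P) ^+ m = 1 - a * P by rewrite -ab; ring.
  by ring.
rewrite dvdp_addl ?IH //; apply/dvdp_mull.
by rewrite /P (big_rem l') //= dvdp_mulIl.
Qed.

(** A generalized eigenvector for [l] that [p] kills is already killed by [('X - l) ^+ m], where [m]
    is the multiplicity of [l] in [p]; modulo that power [q] is the constant [f l]. The identity for
    [f] yields the semisimple part of [T], complex conjugation its conjugate. *)
Lemma functional_calculus (f : K -> K) p : p != 0 -> exists q, forall l,
  forall (N : lmodType K) (T : N -> N) (v : N), linear T ->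
    pop T p v = 0 -> geig T l v -> pop T q v = f l *: v.
Proof.
move=> p0; have [rs pE] := closed_field_poly_normal p.
have [q qP] := crt_XsubC f (size p) rs; exists q => l N T v lT pv.
move=> /(geigP _ _ lT)[k kv].
have [/negPf pl|pl] := boolP (~~ root p l).
  have /Bezout_eq1_coprimepP[[a b] /= ab] : coprimep p (('X - l%:P) ^+ k).
    by apply: coprimep_expr; rewrite coprimep_XsubC pl.
  suff -> : v = 0 by rewrite scaler0 (lin0 (pop_linear _ lT)).
  by rewrite -[v](pop1 T) -ab popD !popM // pv kv !(lin0 (pop_linear _ lT))
    addr0.
rewrite negbK in pl; have [r [m [m0 rp r0 prE cop]]] := coprime_split p0 pl.
have /Bezout_eq1_coprimepP[[a b] /= ab] := cop k.
have mv : pop T (('X - l%:P) ^+ m) v = 0.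
  have -> : v = pop T (a * r) v.
    by rewrite -{1}[v](pop1 T) -ab popD [pop T (b * _) v]popM // kv
      (lin0 (pop_linear _ lT)) addr0.
  rewrite -popM // mulrCA (mulrC _ r) -prE popM // pv.
  exact: lin0 (pop_linear _ lT).
have lrs : l \in rs.
  move: pl; rewrite pE rootZ ?lead_coef_eq0 //.
  by rewrite root_prod_XsubC.
have mp : (m <= size p)%N.
  have : ('X - l%:P) ^+ m %| p by rewrite prE dvdp_mulIr.
  by move/(dvdp_leq p0); rewrite size_exp_XsubC => /ltnW.
apply/eqP; rewrite -subr_eq0 -(popC T) -scaleN1r -popZ -popD scaleN1r.
apply/eqP/(pop_dvd lT _ mv)/(dvdp_trans _ (qP _ lrs)).
exact: dvdp_exp2l.
Qed.

(* T acts on the cyclic space of v diagonalizably.                            *)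
Definition ldiag T v :=
  exists2 rs, uniq rs & pop T (\prod_(r <- rs) ('X - r%:P)) v = 0.

Lemma ldiag_pop T v : ldiag T v -> exists2 p, p != 0 & pop T p v = 0.
Proof.
move=> [rs _ pv]; exists (\prod_(r <- rs) ('X - r%:P)) => //.
exact/monic_neq0/monic_prod_XsubC.
Qed.

(** For a sum, the product over the union of the two root sets, without repetition, kills both
    vectors. *)
Lemma subspace_ldiag T : linear T -> subspace (ldiag T).
Proof.
move=> lT; split; first by exists [::]; rewrite ?big_nil ?pop1.
move=> c u v [r ur pu] [s us pv]; exists (undup (r ++ s));
  first exact: undup_uniq.
have sub z w : uniq z -> {subset z <= undup (r ++ s)} ->
    pop T (\prod_(r <- z) ('X - r%:P)) w = 0 ->
    pop T (\prod_(r <- undup (r ++ s)) ('X - r%:P)) w = 0.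
  move=> uz zs; apply: pop_dvd => //; apply: uniq_roots_dvdp.
    by apply/allP => x /zs; rewrite root_prod_XsubC.
  by rewrite uniq_rootsE.
rewrite (pop_linear _ lT) (sub r) // ?(sub s) // ?scaler0 ?addr0 //.
- by move=> x; rewrite mem_undup mem_cat => ->; rewrite orbT.
- by move=> x; rewrite mem_undup mem_cat => ->.
Qed.

Lemma eig_ldiag T l v : linear T -> T v = l *: v -> ldiag T v.
Proof.
by move=> lT Tv; exists [:: l]; rewrite ?big_seq1 // popXsubC Tv subrr.
Qed.

Lemma ldiag_stable T S v : linear T -> linear S ->
  (forall u, S (T u) = T (S u)) -> ldiag T v -> ldiag T (S v).
Proof.
by move=> lT lS ST [rs urs pv]; exists rs => //; rewrite -pop_comm // pv lin0.
Qed.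

(** The product [P] over the roots other than [l] is coprime to [('X - l) ^+ k], so Bezout writes
    [v] as a polynomial in [T] applied to [P(T) v], and [T - l] kills [P(T) v]. *)
Lemma ldiag_geig T l v : linear T -> ldiag T v -> geig T l v -> T v = l *: v.
Proof.
move=> lT [rs urs pv] /(geigP _ _ lT)[k kv].
suff : pop T ('X - l%:P) v = 0 by rewrite popXsubC => /eqP;
  rewrite subr_eq0 => /eqP.
pose P : {poly K} := \prod_(r <- rem l rs) ('X - r%:P).
have /Bezout_eq1_coprimepP[[a b] /= ab] : coprimep P (('X - l%:P) ^+ k).
  apply: coprimep_expr; rewrite coprimep_XsubC root_prod_XsubC.
  by rewrite mem_rem_uniq // !inE eqxx.
have -> : v = pop T (a * P) v.
  by rewrite -{1}[v](pop1 T) -ab popD [pop T (b * _) v]popM // kv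
    (lin0 (pop_linear _ lT)) addr0.
rewrite -popM // mulrCA.
have [lrs|lrs] := boolP (l \in rs); last first.
  move: pv; rewrite -(rem_id lrs) -/P => pv.
  by rewrite !popM // pv !(lin0 (pop_linear _ lT)).
rewrite popM // /P; move: pv; rewrite (big_rem l) //= => ->.
exact: lin0 (pop_linear _ lT).
Qed.

Lemma eig_span T v C : linear T -> ldiag T v -> subspace C ->
  (forall q l, T (pop T q v) = l *: pop T q v -> C (pop T q v)) -> C v.
Proof.
move=> lT dv hC Cv; have [p p0 pv] := ldiag_pop dv.
apply: (geig_span lT p0 pv hC) => q l gv; apply: (Cv q l);
  apply: ldiag_geig => //.
apply: ldiag_stable => //; first exact: pop_linear.
by move=> u; rewrite pop_comm.
Qed.

Lemma geig_ldiag T p v : linear T -> p != 0 -> pop T p v = 0 ->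
  (forall q l, geig T l (pop T q v) -> T (pop T q v) = l *: pop T q v) ->
  ldiag T v.
Proof.
move=> lT p0 pv h; apply: (geig_span lT p0 pv); first exact: subspace_ldiag.
by move=> q l /h; exact: eig_ldiag.
Qed.

(** Simultaneous diagonalization: polynomials in [S] preserve the eigenvectors of [T], so the
    [S]-components of a [T]-eigenvector are common eigenvectors. *)
Lemma ldiag_comm_add T S c : linear T -> linear S ->
  (forall u, S (T u) = T (S u)) -> (forall v, ldiag T v) ->
  (forall v, ldiag S v) -> forall v, ldiag (fun u => c *: T u + S u) v.
Proof.
move=> lT lS ST dT dS v.
have lU : linear (fun u => c *: T u + S u).
  by move=> a x y /=; rewrite lT lS !scalerDr !scalerA addrACA (mulrC c).
have hU := subspace_ldiag lU.
apply: (eig_span lT (dT v) hU) => q l; move: (pop T q v) => {}v Tv.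
apply: (eig_span lS (dS v) hU) => r k Sv;
  apply: (@eig_ldiag _ (c * l + k)) => //.
rewrite Sv [T _](@pop_comm _ _ S T) // Tv.
by rewrite (linZ (pop_linear _ lS)) scalerA scalerDl.
Qed.

End ClosedField.

Section GeigBilinear.
Variables (K : fieldType) (U V W : lmodType K) (b : U -> V -> W).
Variables (A : set U) (B : set V).
Variables (T : U -> U) (S : V -> V) (R : W -> W).
Hypotheses (hA : subspace A) (hB : subspace B) (sT : stable T A) (sS : stable S
  B).
Hypothesis lb1 :
  forall v c x y, A x -> A y -> b (c *: x + y) v = c *: b x v + b y v.
Hypothesis lb2 :
  forall u c x y, B x -> B y -> b u (c *: x + y) = c *: b u x + b u y.
Hypothesis lR : linear R.
Hypothesis der : forall u v, A u -> B v -> R (b u v) = b (T u) v + b u (S v).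

(** Leibniz rule: [R - (l + m)] sends [b u v] to [b ((T - l) u) v + b u ((S - m) v)], so [i + j]
    iterations leave no term. The bracket, representations, trace forms and the symplectic form all
    serve as [b], which is why bilinearity is asked on [A] and [B] only. *)
Lemma geig_bilin l m u v : A u -> B v -> geig T l u -> geig S m v ->
  geig R (l + m) (b u v).
Proof.
move=> Au Bv [i iu] [j jv]; exists (i + j)%N.
have lQ : linear (fun w => R w - (l + m) *: w).
  by move=> c x y; rewrite lR scalerDr opprD addrACA scalerBr !scalerA (mulrC
    c).
have iter0 k : iter k (fun w => R w - (l + m) *: w) 0 = 0.
  by elim: k => //= k ->; rewrite (lin0 lR) scaler0 subr0.
have itD k x y : iter k (fun w => R w - (l + m) *: w) (x + y) =
  iter k (fun w => R w - (l + m) *: w) x + iter k (fun w => R w - (l + m) *: w)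
    y.
  by elim: k => //= k ->; rewrite (linD lQ).
have b0v x : b 0 x = 0.
  have := lb1 x (-1) (subspace0 hA) (subspace0 hA).
  by rewrite scaler0 addr0 scaleN1r addNr.
have bv0 x : b x 0 = 0.
  have := lb2 x (-1) (subspace0 hB) (subspace0 hB).
  by rewrite scaler0 addr0 scaleN1r addNr.
have [n] := ubnP (i + j)%N.
elim: n => // n IH in i j u v Au Bv iu jv *; rewrite ltnS => ijn.
case: i iu ijn => [/= ->|i iu] ijn; first by rewrite b0v iter0.
case: j jv ijn => [v0|j jv] ijn.
  by move: v0; rewrite -[iter _ _ _]/v => ->; rewrite bv0 iter0.
have ATu : A (T u - l *: u) := @stable_XsubC _ _ T l A hA sT u Au.
have BSv : B (S v - m *: v) := @stable_XsubC _ _ S m B hB sS v Bv.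
rewrite addSn iterSr der //.
have -> : b (T u) v + b u (S v) - (l + m) *: b u v =
    b (T u - l *: u) v + b u (S v - m *: v).
  have -> : b (T u - l *: u) v = b (T u) v - l *: b u v.
    by rewrite addrC -scaleNr lb1 ?scaleNr 1?addrC //; exact: sT.
  have -> : b u (S v - m *: v) = b u (S v) - m *: b u v.
    by rewrite addrC -scaleNr lb2 ?scaleNr 1?addrC //; exact: sS.
  by rewrite scalerDl opprD addrACA.
have h1 : iter (i + j.+1) (fun w => R w - (l + m) *: w) (b (T u - l *: u) v) =
  0.
  by apply: (IH i j.+1) => //; rewrite -iu iterSr.
have h2 : iter (i + j.+1) (fun w => R w - (l + m) *: w) (b u (S v - m *: v)) =
  0.
  rewrite addnS -addSn; apply: (IH i.+1 j) => //.
  - by rewrite -jv iterSr.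
  - by rewrite addSn -addnS.
by rewrite itD h1 h2 addr0.
Qed.

End GeigBilinear.

(** * Finite-dimensional subspaces *)

Section Frames.
Variables (K : fieldType) (V : lmodType K).
Implicit Types (A B C : set V).

(** A basis of [A] in the form of a coordinate isomorphism, through which Cayley-Hamilton, Schur
    form and traces apply to subspaces of an abstract module. *)
Definition frame n (d : 'rV[K]_n -> V) A :=
  [/\ linear d, injective d & A = range d].

Lemma finite_dim_frame A : finite_dim A -> exists n d, @frame n d A.
Proof.
move=> [n [e [ie ->]]]; exists n, (fun v : 'rV_n => \sum_i v 0 i *: e i).
have ld : linear (fun v : 'rV_n => \sum_i v 0 i *: e i).
  move=> c u v; rewrite scaler_sumr -big_split; apply: eq_bigr => i _ /=.
  by rewrite !mxE scalerDl scalerA.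
split=> //.
  move=> u v /eqP; rewrite -subr_eq0 -(linB ld) => /eqP /ie uv.
  by apply/rowP => i; apply/eqP; rewrite -subr_eq0; have := uv i;
    rewrite !mxE => ->.
rewrite eqEsubset; split.
  apply: span_sub; first exact: subspace_image.
  move=> _ [i _ <-]; exists (delta_mx 0 i) => //.
  rewrite (bigD1 i) //= mxE !eqxx scale1r big1 ?addr0 // => j ji.
  by rewrite mxE eqxx (negPf ji) scale0r.
have hs := subspace_span (range e).
move=> _ [v _ <-] /=; apply: (subspace_sum hs) => i _; apply: (subspaceZ _ hs).
by apply: mem_span; exists i.
Qed.

Lemma frame_subspace n (d : 'rV_n -> V) A : frame d A -> subspace A.
Proof. by move=> [ld _ ->]; exact: subspace_image. Qed.

Lemma finite_dim_subspace A : finite_dim A -> subspace A.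
Proof. by move=> /finite_dim_frame[n [d /frame_subspace]]. Qed.

Lemma frame_finite_dim n (d : 'rV_n -> V) A : frame d A -> finite_dim A.
Proof.
move=> [ld id ->]; exists n, (fun i => d (delta_mx 0 i)).
have dE (c : 'I_n -> K) :
    \sum_i c i *: d (delta_mx 0 i) = d (\row_i c i).
  rewrite [\row_i _]row_sum_delta (lin_sum ld).
  by apply: eq_bigr => i _; rewrite mxE (linZ ld).
split=> [c|]; first rewrite dE -(lin0 ld) => /id c0 i.
  by have /rowP/(_ i) := c0; rewrite !mxE.
rewrite eqEsubset; split; last first.
  apply: span_sub; first exact: subspace_image.
  by move=> _ [i _ <-]; exists (delta_mx 0 i).
move=> _ [v _ <-]; rewrite [v]row_sum_delta (lin_sum ld).
have hs := subspace_span (range (fun i => d (delta_mx 0 i))).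
apply: (subspace_sum hs) => i _; rewrite (linZ ld); apply: (subspaceZ _ hs).
by apply: mem_span; exists i.
Qed.

(** A matrix of maximal rank with row space inside [P] works: a further vector of [P] would raise
    the rank. *)
Lemma subspace_rowspace n (P : set 'rV[K]_n) : subspace P ->
  exists U : 'M[K]_n, forall v, P v <-> (v <= U)%MS.
Proof.
move=> hP; pose Q k := `[< exists2 U : 'M[K]_n,
  forall v : 'rV_n, (v <= U)%MS -> P v & \rank U = k >].
have exQ : exists k, Q k.
  exists 0; apply/asboolP; exists 0; rewrite ?mxrank0 // => v.
  by rewrite submx0 => /eqP->; exact: subspace0.
have ubQ k : Q k -> (k <= n)%N by move=> /asboolP[U _ <-]; exact: rank_leq_row.
have [k /asboolP[U UP Uk] kmax] := ex_maxnP exQ ubQ.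
exists U => v; split=> [Pv|/UP//]; apply: contrapT => /negP vU.
have : (\rank (U + v)%MS <= k)%N.
  apply: kmax; apply/asboolP;
    exists (U + v)%MS => // w /sub_addsmxP[[a b] /= ->].
  apply: subspaceD => //; first by apply: UP; exact: submxMl.
  by rewrite [b]mx11_scalar mul_scalar_mx; apply: subspaceZ.
rewrite -Uk leqNgt => /negP; apply.
have : (U < U + v)%MS by rewrite ltmxE addsmxSl addsmx_sub submx_refl.
by rewrite ltmxErank => /andP[].
Qed.

Lemma finite_dim_sub A B : finite_dim A -> subspace B -> B `<=` A ->
  finite_dim B.
Proof.
move=> /finite_dim_frame[n [d [ld id AE]]] hB BA.
have [U UP] := subspace_rowspace (subspace_preim ld hB).
apply: (@frame_finite_dim _ (fun v => d (v *m row_base U))); split.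
- by move=> c u v; rewrite mulmxDl -scalemxAl ld.
- by move=> u v /id /(row_free_inj (row_base_free _)).
rewrite eqEsubset; split.
  move=> b Bb; have := BA _ Bb; rewrite AE => -[v _ vb].
  have /UP : (d @^-1` B) v by rewrite /preimage /= vb.
  by rewrite -(eq_row_base U) => /submxP[u uv]; exists u => //; rewrite -uv.
move=> _ [v _ <-]; apply/UP; rewrite (submx_trans (submxMl _ _)) //.
by rewrite eq_row_base.
Qed.

(** A witness of least dimension is minimal for inclusion. Minimal counterexamples obtained this way
    replace inductions on composition series. *)
Lemma min_subspace A (P : set V -> Prop) : finite_dim A -> P A ->
  exists B, [/\ subspace B, B `<=` A, P B &
    forall C, subspace C -> C `<=` B -> P C -> C = B].
Proof.
move=> fA PA; have hA := finite_dim_subspace fA.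
have /finite_dim_frame[n [d [ld id AE]]] := fA.
pose Q k := `[< exists B, [/\ subspace B, B `<=` A, P B & exists2 U : 'M[K]_n,
  (forall v, B (d v) <-> (v <= U)%MS) & \rank U = k] >].
have [|k /asboolP[B [hB BA PB [U UB Uk]]] kmin] := @ex_minnP Q.
  have [U UP] := subspace_rowspace (subspace_preim ld hA).
  exists (\rank U); apply/asboolP; exists A; split=> //; by exists U.
exists B; split=> // C hC CB PC.
have [W WC] := subspace_rowspace (subspace_preim ld hC).
have WU : (W <= U)%MS.
  apply/row_subP => i; apply/UB/CB/WC; exact: row_sub.
rewrite eqEsubset; split=> // b Bb.
have := BA _ Bb; rewrite AE => -[v _ vb]; rewrite -vb; apply/WC.
suff UW : (U <= W)%MS by apply: submx_trans UW; apply/UB; rewrite vb.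
rewrite -(geq_leqif (mxrank_leqif_sup WU)) Uk; apply: kmin.
apply/asboolP; exists C; split=> //; first exact: subset_trans BA.
by exists W.
Qed.

Lemma max_subspace A (P : set V -> Prop) B0 : finite_dim A -> subspace B0 ->
  B0 `<=` A -> P B0 ->
  exists B, [/\ subspace B, B `<=` A, P B &
    forall C, subspace C -> C `<=` A -> B `<=` C -> P C -> C = B].
Proof.
move=> fA hB0 B0A PB0; have /finite_dim_frame[n [d [ld id AE]]] := fA.
pose Q k := `[< exists B, [/\ subspace B, B `<=` A, P B & exists2 U : 'M[K]_n,
  (forall v, B (d v) <-> (v <= U)%MS) & \rank U = k] >].
have exQ : exists k, Q k.
  have [U UP] := subspace_rowspace (subspace_preim ld hB0).
  by exists (\rank U); apply/asboolP; exists B0; split=> //; exists U.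
have ubQ k : Q k -> (k <= n)%N.
  by move=> /asboolP[B [_ _ _ [U _ <-]]]; exact: rank_leq_row.
have [k /asboolP[B [hB BA PB [U UB Uk]]] kmax] := ex_maxnP exQ ubQ.
exists B; split=> // C hC CA BC PC.
have [W WC] := subspace_rowspace (subspace_preim ld hC).
have UW : (U <= W)%MS.
  apply/row_subP => i; apply/WC/BC/UB; exact: row_sub.
rewrite eqEsubset; split=> // c Cc.
have := CA _ Cc; rewrite AE => -[v _ vc]; rewrite -vc; apply/UB.
suff WU : (W <= U)%MS by apply: submx_trans WU; apply/WC;
  rewrite /preimage /= vc.
rewrite -(geq_leqif (mxrank_leqif_sup UW)) Uk; apply: kmax.
by apply/asboolP; exists C; split=> //; exists W.
Qed.

Definition frame_coord n (d : 'rV[K]_n -> V) (y : V) : 'rV[K]_n :=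
  if pselect (exists x, d x = y) is left h then projT1 (cid h) else 0.

Lemma frame_coordK n (d : 'rV_n -> V) A y : frame d A -> A y ->
  d (frame_coord d y) = y.
Proof.
move=> [_ _ ->] [x _ xy]; rewrite /frame_coord; case: pselect => [h|[]].
  by case: cid.
by exists x.
Qed.

(* Endomorphisms act on row vectors by right multiplication.                  *)
Definition frame_mx n (d : 'rV[K]_n -> V) (T : V -> V) : 'M[K]_n :=
  \matrix_i frame_coord d (T (d (delta_mx 0 i))).

Lemma frame_mxE n (d : 'rV_n -> V) A T v : frame d A -> linear T -> stable T A
  ->
  T (d v) = d (v *m frame_mx d T).
Proof.
move=> fd lT sT; have [ld _ AE] := fd.
rewrite mulmx_sum_row {1}[v]row_sum_delta !(lin_sum ld) (lin_sum lT).
apply: eq_bigr => i _; rewrite !(linZ ld) (linZ lT) rowK.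
by rewrite (frame_coordK fd) //; apply: sT; rewrite AE; exists (delta_mx 0 i).
Qed.

Lemma frame_mx_eq n (d : 'rV_n -> V) A T X : frame d A -> linear T ->
  stable T A -> (forall v, T (d v) = d (v *m X)) -> frame_mx d T = X.
Proof.
move=> fd lT sT TX; have [ld id _] := fd.
apply/row_matrixP => i; rewrite !rowE; apply: id.
by rewrite -TX -(frame_mxE _ fd).
Qed.

Lemma pop_frame n (d : 'rV_n -> V) A T p v : frame d A -> linear T ->
  stable T A -> pop T p (d v) = d (pop (fun u => u *m frame_mx d T) p v).
Proof.
move=> fd lT sT; have [ld _ _] := fd; rewrite /pop (lin_sum ld).
apply: eq_bigr => i _; rewrite (linZ ld); congr (_ *: _).
by elim: (nat_of_ord i) => //= j ->; rewrite (frame_mxE _ fd lT sT).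
Qed.

Lemma mulmxr_linear m n (X : 'M[K]_n) : linear (fun u : 'M_(m, n) => u *m X).
Proof. by move=> c u v; rewrite mulmxDl -scalemxAl. Qed.

Lemma pop_mulmx m n (X : 'M[K]_n.+1) p (v : 'M_(m, n.+1)) :
  pop (fun u => u *m X) p v = v *m horner_mx X p.
Proof.
elim/poly_ind: p v => [|p c IH] v; first by rewrite pop0 rmorph0 mulmx0.
rewrite popD pop_mulX popC IH rmorphD rmorphM /= horner_mx_X horner_mx_C.
rewrite mulmxDr mul_mx_scalar -!mulmxA; congr (_ *m _ + _).
exact: comm_mx_horner.
Qed.

End Frames.

Section FiniteDim.
Variables (K : fieldType) (V W : lmodType K).

Lemma finite_dim_rV n : finite_dim [set: 'rV[K]_n].
Proof.
apply: (@frame_finite_dim _ _ n id); split=> //.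
by rewrite image_id.
Qed.

Lemma finite_dim_image (T : V -> W) (A : set V) : linear T -> finite_dim A ->
  finite_dim (T @` A).
Proof.
move=> lT /finite_dim_frame[n [d [ld id AE]]].
have lTd : linear (T \o d) by move=> c u v /=; rewrite ld lT.
have [U UP] := subspace_rowspace (subspace_preim lTd (@subspace_set0 _ W)).
(* [U] is the kernel of [T \o d], so [T \o d] is injective on the complement spanned by [R], with
   the same image. *)
pose R := row_base (U^C)%MS.
have freeR : row_free R by exact: row_base_free.
apply: (@frame_finite_dim _ _ _ (fun v => T (d (v *m R)))); split.
- by move=> c u v; rewrite mulmxDl -scalemxAl ld lT.
- move=> u v /eqP; rewrite -subr_eq0 -(linB lT) -(linB ld) -mulmxBl => /eqP.
  move=> /UP h; apply/eqP;
    rewrite -subr_eq0 -(inj_eq (row_free_inj freeR)) mul0mx.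
  rewrite -submx0 -(capmx_compl U) sub_capmx h /= (submx_trans (submxMl _ _))
    //.
  by rewrite eq_row_base.
rewrite eqEsubset AE; split=> [_ [_ [v _ <-] <-]|_ [v _ <-]]; last first.
  by exists (d (v *m R)) => //; exists (v *m R).
have /sub_addsmxP[[a b] /= vE] : (v <= U + U^C)%MS.
  by rewrite submx_full ?addsmx_compl_full.
have /submxP[c cE] : (b *m U^C <= R)%MS by rewrite eq_row_base submxMl.
exists c => //; rewrite -cE vE; have /= := linD lTd (a *m U) (b *m U^C)%MS.
move=> ->; suff -> : T (d (a *m U)) = 0 by rewrite add0r.
by have /UP := submxMl a U.
Qed.

Lemma finite_dim_set0 : finite_dim [set (0 : V)].
Proof.
apply: (@frame_finite_dim _ _ 0 (fun=> 0)); split.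
- by move=> c u v; rewrite scaler0 addr0.
- by move=> u v _; rewrite !(flatmx0, thinmx0).
- by rewrite eqEsubset; split=> [_ ->|_ [v _ <-]] //; exists 0.
Qed.

End FiniteDim.

Lemma finite_dim_add (K : fieldType) (V : lmodType K) (A B : set V) :
  finite_dim A -> finite_dim B -> finite_dim (addset A B).
Proof.
move=> /finite_dim_frame[n [d [ld id ->]]] /finite_dim_frame[m [e [le ie ->]]].
have -> : addset (range d) (range e) =
    (fun v : 'rV_(n + m) => d (lsubmx v) + e (rsubmx v)) @` setT.
  rewrite eqEsubset; split=> [_ [_ [_ [[u _ <-] [v _ <-] ->]]]|_ [v _ <-]].
    by exists (row_mx u v) => //; rewrite row_mxKl row_mxKr.
  by exists (d (lsubmx v)), (e (rsubmx v)); split;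
    [exists (lsubmx v)|exists (rsubmx v)|].
apply: finite_dim_image; last exact: finite_dim_rV.
by move=> c u v; rewrite !linearP /= ld le scalerDr addrACA.
Qed.

Lemma finite_dim_line (K : fieldType) (V : lmodType K) (v : V) :
  finite_dim (range (fun c : K => c *: v)).
Proof.
have -> : range (fun c : K => c *: v) =
    (fun u : 'rV[K]_1 => u 0 0 *: v) @` setT.
  rewrite eqEsubset; split=> [_ [c _ <-]|_ [u _ <-]]; last by exists (u 0 0).
  by exists (c%:M : 'rV_1) => //; rewrite mxE eqxx mulr1n.
apply: finite_dim_image; last exact: finite_dim_rV.
by move=> c u u'; rewrite !mxE scalerDl scalerA.
Qed.

Lemma finite_dim_span_seq (K : fieldType) (V : lmodType K) (s : seq V) :
  exists2 A : set V, finite_dim A & forall v, v \in s -> A v.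
Proof.
elim: s => [|v s [A fA sA]]; first by exists [set 0]; [exact: finite_dim_set0|].
exists (addset (range (fun c : K => c *: v)) A).
  exact: finite_dim_add (finite_dim_line v) fA.
move=> u; rewrite inE => /orP[/eqP->|us].
  exists v, 0; rewrite addr0; split=> //; first by exists 1; rewrite ?scale1r.
  exact: subspace0 (finite_dim_subspace fA).
exists 0, u; rewrite add0r; split=> //; last exact: sA.
by exists 0; rewrite ?scale0r.
Qed.

(** * Semisimple operators are the diagonalizable ones *)

Section Semisimple.
Variables (K : closedFieldType) (V : lmodType K).
Implicit Types (A B C : set V) (T : V -> V).

Lemma fin_pop T A : linear T -> finite_dim A -> stable T A ->
  exists2 p : {poly K}, p != 0 & forall v, A v -> pop T p v = 0.
Proof.
move=> lT /finite_dim_frame[[|n] [d fd]] sT; have [ld id AE] := fd.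
  exists 1; first exact: oner_neq0.
  by move=> v; rewrite AE => -[x _ <-]; rewrite thinmx0 pop1 (lin0 ld).
exists (char_poly (frame_mx d T)); first exact/monic_neq0/char_poly_monic.
move=> v; rewrite AE => -[x _ <-]; rewrite (pop_frame _ _ fd lT sT) pop_mulmx.
by rewrite Cayley_Hamilton mulmx0 (lin0 ld).
Qed.

Lemma geig_eigenvector T l v A : subspace A -> stable T A -> A v ->
  geig T l v -> v != 0 -> exists u, [/\ A u, u != 0 & T u = l *: u].
Proof.
move=> hA sT Av [k]; elim: k v Av => [|k IH] v Av; first by move=> /= ->;
  rewrite eqxx.
rewrite iterSr => kv v0; have [/eqP|] := eqVneq (T v - l *: v) 0.
  by rewrite subr_eq0 => /eqP Tv; exists v.
by apply: IH => //; exact: (@stable_XsubC _ _ T l A hA sT v Av).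
Qed.

(** A stable complement of the span of the eigenvectors would, if nonzero, contain an
    eigenvector. *)
Lemma semisimple_ldiag T A : linear T -> finite_dim A -> stable T A ->
  (forall B, subspace B -> B `<=` A -> stable T B ->
    exists C, [/\ subspace C, stable T C & direct_sum2 A B C]) ->
  forall v, A v -> ldiag T v.
Proof.
move=> lT fA sT ss; have hA := finite_dim_subspace fA.
have [p p0 pA] := fin_pop lT fA sT.
have hD := subspace_ldiag lT.
have [||v []|C [hC sC [AE BC]]] := ss (A `&` ldiag T).
- exact: subspaceI.
- by move=> v [].
- by move=> Av Dv; split; [exact: sT|exact: ldiag_stable].
have h0 := @subspace_set0 _ V.
have CA c : C c -> A c.
  by move=> Cc; rewrite AE; exists 0; [split; exact: subspace0|exists c;
    rewrite ?add0r].
have C0 c : C c -> c = 0.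
  move=> Cc; apply: (geig_span lT p0 (pA _ (CA _ Cc)) h0) => q l gq /=.
  have Cq : C (pop T q c) by exact: stable_pop.
  apply/eqP/negPn/negP => q0.
  have [u [Cu /eqP u0 Tu]] := geig_eigenvector hC sC Cq gq q0; apply: u0.
  have : ((A `&` ldiag T) `&` C) u.
    by split=> //; split; [exact: CA|exact: eig_ldiag Tu].
  by rewrite BC.
by move=> v; rewrite AE => -[b [_ Db] [c /C0-> <-]]; rewrite addr0.
Qed.

(** [C] is a maximal stable subspace meeting [B] trivially: an eigenvector outside [B + C] could be
    added to [C]. *)
Lemma ldiag_semisimple T A : linear T -> finite_dim A -> stable T A ->
  (forall v, A v -> ldiag T v) ->
  forall B, subspace B -> B `<=` A -> stable T B ->
    exists C, [/\ subspace C, stable T C & direct_sum2 A B C].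
Proof.
move=> lT fA sT dT B hB BA sB; have hA := finite_dim_subspace fA.
have [|||C [hC CA [sC BC] Cmax]] := @max_subspace _ _ A
    (fun C => stable T C /\ B `&` C = [set 0]) [set 0] fA.
- exact: subspace_set0.
- by move=> _ ->; exact: subspace0.
- split=> [_ ->|]; first by rewrite /= (lin0 lT).
  by rewrite eqEsubset; split=> [v []|_ ->] //; split=> //; exact: subspace0.
exists C; split=> //; split=> //; have hBC := subspace_add hB hC.
suff sub : A `<=` addset B C.
  rewrite eqEsubset; split=> [v /sub[b [c [Bb Cc ->]]]|_ [b Bb [c Cc <-]]].
    by exists b => //; exists c.
  by apply: subspaceD => //; [exact: BA|exact: CA].
move=> v Av; apply: (eig_span lT (dT v Av) hBC) => q l.
have Aq : A (pop T q v) by exact: stable_pop.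
move: (pop T q v) Aq => {Av}{}v Av Tv; apply: contrapT => nv.
pose D := addset C (range (fun c : K => c *: v)).
have hL : subspace (range (fun c : K => c *: v)).
  exact: finite_dim_subspace (finite_dim_line v).
have hD : subspace D := subspace_add hC hL.
have Dv : D v by apply: subr_addset => //; exists 1; rewrite ?scale1r.
have DC : D = C.
  apply: Cmax => //; last split; last first.
  - rewrite eqEsubset; split=> [u [Bu [c [_ [Cc [a _ <-] uE]]]]|_ ->];
    last first.
      by split; exact: subspace0.
    have [a0|a0] := eqVneq a 0.
      by rewrite uE a0 scale0r addr0 in Bu *; rewrite -BC; split.
    case: nv; apply: (subspaceZN hBC a0); exists u, (- c); split=> //.
      exact: subspaceN.
    by rewrite uE addrC addKr.
  - move=> _ [c [_ [Cc [a _ <-] ->]]]; exists (T c), (T (a *: v)); split.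
    + exact: sC.
    + by exists (a * l); rewrite // (linZ lT) Tv scalerA.
    + by rewrite (linD lT).
  - exact: subl_addset.
  - move=> _ [c [_ [Cc [a _ <-] ->]]]; apply: subspaceD => //; first exact: CA.
    exact: subspaceZ.
by apply: nv; apply: subr_addset => //; rewrite -DC.
Qed.

End Semisimple.

(** * Ideals and nilpotent actions *)

Section LieBasics.
Variables (K : fieldType) (g : lieAlgType K).
Implicit Types (x y z : g) (l I J A B : set g).

Lemma lie0r x : lie x 0 = 0. Proof. exact: lin0 (lie_linearr x). Qed.
Lemma lie0l x : lie 0 x = 0. Proof. exact: lin0 (lie_linearl x). Qed.
Lemma lieDr x y z : lie x (y + z) = lie x y + lie x z.
Proof. exact: linD (lie_linearr x) _ _. Qed.
Lemma lieDl x y z : lie (y + z) x = lie y x + lie z x.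
Proof. exact: linD (lie_linearl x) _ _. Qed.
Lemma lieZr c x y : lie x (c *: y) = c *: lie x y.
Proof. exact: linZ (lie_linearr x) _ _. Qed.
Lemma lieZl c x y : lie (c *: y) x = c *: lie y x.
Proof. exact: linZ (lie_linearl x) _ _. Qed.

Lemma lieC x y : lie x y = - lie y x.
Proof.
apply/eqP; rewrite -addr_eq0; have := liexx (x + y).
by rewrite lieDl !lieDr !liexx add0r addr0 => ->.
Qed.

Lemma lieNr x y : lie x (- y) = - lie x y.
Proof. exact: linN (lie_linearr x) _. Qed.

Lemma lie_der x y z : lie x (lie y z) = lie (lie x y) z + lie y (lie x z).
Proof.
have := lie_jacobi x y z; rewrite (lieC z x) lieNr (lieC z (lie x y)).
by move/eqP; rewrite -addrA -opprD subr_eq0 addrC => /eqP.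
Qed.

(** The axioms are required on [l] only, since maps built from matrices of [lie x] in a frame are
    meaningful only for [x] in a subalgebra. *)
Definition lie_rep l (M : lmodType K) (rho : g -> M -> M) :=
  [/\ forall x, l x -> linear (rho x),
      forall a x y v, l x -> l y -> rho (a *: x + y) v = a *: rho x v + rho y v
    & forall x y v, l x -> l y ->
        rho (lie x y) v = rho x (rho y v) - rho y (rho x v)].

Lemma lie_rep_ad l : lie_rep l (@lie _ g).
Proof.
split=> [x _|a x y v _ _|x y v _ _]; [exact: lie_linearr|exact: lie_linearl|].
by rewrite (lie_der x) addrK.
Qed.

Definition rstable l (M : lmodType K) (rho : g -> M -> M) (A : set M) :=
  forall x, l x -> stable (rho x) A.

Lemma rep0 l (M : lmodType K) (rho : g -> M -> M) v :
  subspace l -> lie_rep l rho -> rho 0 v = 0.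
Proof.
move=> [l0 _] [_ h _]; have := h (-1) 0 0 v l0 l0.
by rewrite scaler0 addr0 scaleN1r addNr.
Qed.

Lemma lie_setP A B x y : A x -> B y -> lie_set A B (lie x y).
Proof. by move=> Ax By; apply: mem_span; exists x => //; exists y. Qed.

Lemma lie_set_sub A B C : subspace C ->
  (forall x y, A x -> B y -> C (lie x y)) -> lie_set A B `<=` C.
Proof. by move=> hC h; apply: span_sub => // _ [x Ax [y By <-]]; exact: h. Qed.

Lemma lower_central_sub l n : subalgebra l -> lower_central l n `<=` l.
Proof.
move=> [hl bl]; elim: n => //= n IH; apply: lie_set_sub => // x y lx /IH.
exact: bl.
Qed.

Lemma ideal_subspace l I : ideal_of l I -> subspace I. Proof. by case. Qed.

Lemma ideal_opp l I x y : ideal_of l I -> I x -> l y -> I (lie x y).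
Proof.
by move=> [hI _ h] Ix ly; rewrite lieC; apply: subspaceN => //; exact: h.
Qed.

Lemma idealI l I J : ideal_of l I -> ideal_of l J -> ideal_of l (I `&` J).
Proof.
move=> [hI Il h] [hJ _ h']; split; first exact: subspaceI.
  by move=> x [/Il].
by move=> x y lx [Iy Jy]; split; [exact: h|exact: h'].
Qed.

Lemma lie_set_ideal l I J : ideal_of l I -> ideal_of l J ->
  ideal_of l (lie_set I J).
Proof.
move=> iI iJ; have [hI Il bI] := iI; have [hJ Jl bJ] := iJ.
have hS : subspace (lie_set I J) by exact: subspace_span.
split=> //.
  apply: subset_trans Il; apply: lie_set_sub => // x y Ix /Jl ly.
  exact: (ideal_opp iI).
move=> x y lx; move: y; suff: lie_set I J `<=` lie x @^-1` lie_set I J by apply.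
apply: (lie_set_sub (subspace_preim (lie_linearr x) hS)) => y z Iy Jz;
  rewrite /preimage /= lie_der.
apply: (subspaceD hS); apply: lie_setP => //; [exact: bI|exact: bJ].
Qed.

Lemma center_ideal l : subalgebra l -> ideal_of l (center_of l).
Proof.
move=> [hl bl]; split.
- split=> [|c u v [lu cu] [lv cv]].
    by split=> [|y _]; [exact: subspace0|rewrite lie0l].
  split=> [|y ly]; first by apply: subspaceD => //; exact: subspaceZ.
  by rewrite lieDl lieZl cu // cv // scaler0 addr0.
- by move=> x [].
- move=> x y lx [ly cy]; have -> : lie x y = 0 by rewrite lieC cy ?oppr0.
  by split=> [|z _]; [exact: subspace0|rewrite lie0l].
Qed.

Lemma whole_ideal l : subalgebra l -> ideal_of l l.
Proof. by move=> [hl bl]; split. Qed.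

Lemma disjoint_ideals l I J x y : ideal_of l I -> ideal_of l J ->
  I `&` J = [set 0] -> I x -> J y -> lie x y = 0.
Proof.
move=> iI iJ IJ Ix Jy; have [_ Il _] := iI; have [_ Jl bJ] := iJ.
have : (I `&` J) (lie x y).
  by split; [apply: (ideal_opp iI) => //; exact: Jl|apply: bJ => //; exact: Il].
by rewrite IJ.
Qed.

Definition minimal_ideal l J :=
  [/\ ideal_of l J, J <> [set 0] &
      forall I, ideal_of l I -> I `<=` J -> I = [set 0] \/ I = J].

Lemma minimal_ideal_ex l I : finite_dim l -> ideal_of l I -> I <> [set 0] ->
  exists2 J, minimal_ideal l J & J `<=` I.
Proof.
move=> fl iI I0; have [hI Il _] := iI.
have fI := finite_dim_sub fl hI Il.
have [J [hJ JI [iJ J0] Jmin]] :=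
  @min_subspace _ _ I (fun C => ideal_of l C /\ C <> [set 0]) fI (conj iI I0).
exists J => //; split=> // I' iI' I'J; have [->|I'0] := pselect (I' = [set 0]).
  by left.
by right; apply: Jmin => //; exact: ideal_subspace iI'.
Qed.

(** By minimality [[J, J]] is [J] or 0; in the second case [J] also commutes with its complementary
    ideal, hence with [l]. *)
Lemma minimal_ideal_cases l J : reductive l -> minimal_ideal l J ->
  J `<=` center_of l \/ lie_set J J = J.
Proof.
move=> [[hl bl] rl] [iJ J0 Jmin]; have [hJ Jl bJ] := iJ.
have JJ : lie_set J J `<=` J.
  by apply: lie_set_sub => // x y Jx Jy; apply: bJ => //; exact: Jl.
have [JJ0|->] := Jmin _ (lie_set_ideal iJ iJ) JJ; last by right.
left=> x Jx; split; first exact: Jl.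
have [J' iJ' [lE JJ'0]] := rl _ iJ; move=> y; rewrite lE => -[a Ja [b J'b <-]].
rewrite lieDr (disjoint_ideals iJ iJ' JJ'0 Jx J'b) addr0.
by have := lie_setP Jx Ja; rewrite JJ0.
Qed.

End LieBasics.

Section NilpotentAction.
Variables (K : numClosedFieldType) (g : lieAlgType K) (M : lmodType K).
Implicit Types (A B C : set M) (h : set g) (T Y : M -> M).

Lemma subset_neq_ex (X : Type) (A B : set X) : B `<=` A -> B <> A -> exists2 a,
  A a & ~ B a.
Proof.
move=> BA nBA; apply: contrapT => h; apply: nBA; rewrite eqEsubset;
  split=> // a Aa.
by apply: contrapT => nBa; apply: h; exists a.
Qed.

(** Some generalized eigencomponent of a vector outside [B] is outside [B]; its last iterate under
    [T - l] that is not in [B] is the desired vector. *)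
Lemma relative_eigenvector T A B : linear T -> finite_dim A -> subspace B ->
  stable T A -> stable T B -> B `<=` A -> B <> A ->
  exists l a, [/\ A a, ~ B a & B (T a - l *: a)].
Proof.
move=> lT fA hB sA sB BA nBA; have hA := finite_dim_subspace fA.
have [a Aa Ba] := subset_neq_ex BA nBA; have [p p0 pA] := fin_pop lT fA sA.
apply: contrapT => h; apply: Ba.
apply: (geig_span lT p0 (pA _ Aa) hB) => q l.
have := @stable_pop _ _ T q A hA sA a Aa.
move: (pop T q a) => {Aa}{}a Aa [k ka].
elim: k a Aa ka => [|k IH] a Aa; first by move=> /= ->; exact: subspace0.
rewrite iterSr => /IH; have := @stable_XsubC _ _ T l A hA sA a Aa.
by move=> At /(_ At) Bt; apply: contrapT => Ba; apply: h; exists l, a.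
Qed.

(* A commutator cannot be a nonzero scalar on a finite-dimensional quotient.  *)
Lemma commutator_scalar T Y A B b a : linear T -> linear Y -> finite_dim A ->
  subspace B -> stable Y A -> stable T B -> stable Y B -> B `<=` A ->
  (forall v, A v -> B (T (Y v) - Y (T v) - b *: v)) ->
  A a -> ~ B a -> B (T a) -> b = 0.
Proof.
move=> lT lY fA hB sA sT sY BA TY Aa Ba BTa; have hA := finite_dim_subspace fA.
have [p p0 pA] := fin_pop lY fA sA.
apply/eqP/negPn/negP => b0.
(* Modulo [B], [T] acts on polynomials in [Y] applied to [a] as [b] times differentiation. If
   [q(Y) a] is in [B] and [b] is nonzero, the same holds for the derivative of [q]; in
   characteristic 0 this forces [q = 0], against the existence of [p]. *)
have main q : B (T (pop Y q a) - b *: pop Y q^`() a).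
  elim/poly_ind: q => [|q c IH].
    by rewrite deriv0 !pop0 (lin0 lT) scaler0 subr0; exact: subspace0.
  rewrite derivD derivC addr0 derivM derivX mulr1 mulrC [q^`() * _]mulrC popD
    popM // popX popC.
  rewrite popD popM // popX (linD lT) (linZ lT).
  set u := pop Y q a; set u' := pop Y q^`() a in IH *.
  have -> : T (Y u) + c *: T a - b *: (Y u' + u) =
    (T (Y u) - Y (T u) - b *: u) + (Y (T u - b *: u') + c *: T a).
    rewrite (linB lY) (linZ lY) scalerDr opprD !addrA.
    by rewrite [RHS](ACl (1*6*5*3*2*4)) /= subrK.
  apply: (subspaceD hB); first by apply: TY; exact: stable_pop.
  by apply: (subspaceD hB); [exact: sY|exact: subspaceZ].
suff : forall n (q : {poly K}), (size q < n)%N -> B (pop Y q a) -> q = 0.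
  move=> /(_ (size p).+1 p (ltnSn _)) h; move/eqP: p0; apply; apply: h.
  by rewrite pA //; exact: subspace0.
elim=> // n IH q; rewrite ltnS => qn Bq.
have q'0 : q^`() = 0.
  have [->|q0] := eqVneq q 0; first exact: deriv0.
  apply: IH; first by apply: leq_trans qn; exact: lt_size_deriv.
  apply: (subspaceZN hB b0); have := subspaceB hB (sT _ Bq) (main q).
  by rewrite opprB addrC subrK.
have : (size q <= 1)%N.
  apply/leq_sizeP => -[//|j] _; have /polyP/(_ j) := q'0.
  by rewrite coef_deriv coef0 => /eqP; rewrite mulrn_eq0 => /eqP.
move/size1_polyC => qE; move: Bq; rewrite qE popC => Bq.
have [->//|c0] := eqVneq q`_0 0.
by case: Ba; exact: subspaceZN Bq.
Qed.

(* Downward induction along the lower central series: once [y, z] acts by a    *)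
(* scalar on the minimal quotient A / B, this scalar is 0, so the eigenspaces *)
(* of z on A / B are stable under h.                                          *)
Lemma nilpotent_scalar h (rho : g -> M -> M) A B : subalgebra h -> nilpotent h
  ->
  lie_rep h rho -> finite_dim A -> subspace B -> B `<=` A -> B <> A ->
  rstable h rho A -> rstable h rho B ->
  (forall C, subspace C -> rstable h rho C -> B `<=` C -> C `<=` A ->
    C = B \/ C = A) ->
  forall z, h z -> exists c, forall a, A a -> B (rho z a - c *: a).
Proof.
move=> sh [n hn] rh fA hB BA nBA sA sB minA.
have [hh bh] := sh; have [rl rD rM] := rh; have hA := finite_dim_subspace fA.
suff H k : (k <= n)%N -> forall z, lower_central h (n - k) z ->
    exists c, forall a, A a -> B (rho z a - c *: a).
  by move=> z hz; apply: (H n) => //; rewrite subnn.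
elim: k => [_ z|k IH kn z].
  rewrite subn0 hn => ->; exists 0 => a Aa.
  by rewrite (rep0 _ hh rh) scale0r subr0; exact: subspace0.
move=> cz; have hz := lower_central_sub sh cz.
have [l [a0 [Aa0 Ba0 Bl]]] := relative_eigenvector (rl _ hz) fA hB (sA _ hz)
  (sB _ hz) BA nBA.
pose T v := rho z v - l *: v.
have lT : linear T.
  move=> c u v; rewrite /T rl // scalerDr opprD addrACA scalerBr !scalerA.
  by rewrite (mulrC c).
have sTB : stable T B by apply: stable_XsubC => //; exact: sB.
have comm y : h y -> forall v, A v -> B (T (rho y v) - rho y (T v)).
  move=> hy; have [] := IH (ltnW kn) (lie y z).
    have -> : (n - k = (n - k.+1).+1)%N by rewrite subnSK.
    exact: lie_setP.
  move=> b bP; have TY v : A v -> B (T (rho y v) - rho y (T v) - (- b) *: v).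
    move=> Av; have := subspaceN hB (bP v Av); rewrite rM // /T.
    rewrite (linB (rl _ hy)) (linZ (rl _ hy)) scaleNr opprK.
    congr (B _); rewrite !opprB !addrA subrK.
    by rewrite [LHS](ACl (2*3*1)).
  have b0 : - b = 0.
    exact: (commutator_scalar lT (rl _ hy) fA hB (sA _ hy) sTB (sB _ hy) BA TY
      Aa0).
  by move=> v /TY; rewrite b0 scale0r subr0.
pose C := [set v | A v /\ B (T v)].
have [||||CB|CA] := minA C.
- by apply: subspaceI => //; exact: subspace_preim.
- move=> y hy v [Av BTv]; split; first exact: sA.
  have := subspaceD hB (comm y hy v Av) (sB _ hy _ BTv).
  by rewrite subrK.
- by move=> v Bv; split; [exact: BA|exact: sTB].
- by move=> v [].
- by case: Ba0; rewrite -CB; split.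
by exists l => a; rewrite -CA => -[].
Qed.

(** [C] is minimal among the stable subspaces strictly above [B], so [h] acts on [C / B] by scalars,
    and the scalar of an element acting nilpotently is 0. *)
Lemma nilpotent_flag h (rho : g -> M -> M) A B : subalgebra h -> nilpotent h ->
  lie_rep h rho -> finite_dim A -> subspace B -> B `<=` A -> B <> A ->
  rstable h rho A -> rstable h rho B ->
  exists C, [/\ subspace C, B `<=` C /\ C `<=` A, C <> B, rstable h rho C &
    forall z, h z -> (forall a, A a -> exists k, B (iter k (rho z) a)) ->
      forall a, C a -> B (rho z a)].
Proof.
move=> sh nh rh fA hB BA nBA sA sB.
have hA := finite_dim_subspace fA; have [rl _ _] := rh.
have [C [hC CA [sC BC nC] Cmin]] := @min_subspace _ _ A
  (fun C => [/\ rstable h rho C, B `<=` C & C <> B]) fA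
  (And3 sA BA (fun e => nBA (esym e))).
exists C; split=> // z hz nz.
have fC := finite_dim_sub fA hC CA.
have [||c cP] := nilpotent_scalar sh nh rh fC hB BC _ sC sB _ hz.
- by move=> e; apply: nC.
- move=> D hD sD BD DC; have [->|nD] := pselect (D = B); first by left.
  by right; apply: Cmin.
have [a Ca Ba] := subset_neq_ex BC (fun e => nC (esym e)).
have [k Bk] := nz _ (CA _ Ca).
have ck : B (c ^+ k *: a).
  have it : forall j, B (iter j (rho z) a - c ^+ j *: a).
    elim=> [|j IH]; first by rewrite scale1r subrr; exact: subspace0.
    have := subspaceD hB (sB _ hz _ IH) (subspaceZ (c ^+ j) hB (cP _ Ca)).
    rewrite (linB (rl _ hz)) (linZ (rl _ hz)) scalerBr addrA subrK scalerA.
    by rewrite -exprSr.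
  by have := subspaceB hB Bk (it k); rewrite opprB addrC subrK.
have c0 : c = 0.
  apply/eqP/negPn/negP => c0; apply: Ba.
  by apply: (subspaceZN hB _ ck); rewrite expf_neq0.
by move=> b /cP; rewrite c0 scale0r subr0.
Qed.

(** On each layer of a flag with scalar action [x] acts by 0, so [x y] moves one layer down. The
    flag is implicit: a maximal stable subspace on which [x y] is locally nilpotent could be
    enlarged by one layer. *)
Lemma nilpotent_mul h (rho : g -> M -> M) A x y : subalgebra h -> nilpotent h ->
  lie_rep h rho -> finite_dim A -> rstable h rho A -> h x -> h y ->
  (forall a, A a -> exists k, iter k (rho x) a = 0) ->
  forall a, A a -> exists k, iter k (rho x \o rho y) a = 0.
Proof.
move=> sh nh rh fA sA hx hy nx; have hA := finite_dim_subspace fA.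
have [|_ ->||] := @max_subspace _ _ A (fun B => rstable h rho B /\
  forall a, B a -> exists k, iter k (rho x \o rho y) a = 0) [set 0] fA.
- exact: subspace_set0.
- exact: subspace0.
- split=> [z hz _ ->|_ ->]; last by exists 0%N.
  by have [rl _ _] := rh; rewrite /= (lin0 (rl _ hz)).
move=> B [hB BA [sB nB] Bmax]; suff <- : B = A by [].
apply: contrapT => nBA.
have [C [hC [BC CA] nC sC Cn]] := nilpotent_flag sh nh rh fA hB BA nBA sA sB.
apply: nC; apply: Bmax => //; split=> // a Ca.
have [|k kn] := nB (rho x (rho y a)).
  apply: Cn => //; last exact: sC.
  by move=> b /nx[k kb]; exists k; rewrite kb; exact: subspace0.
by exists k.+1; rewrite iterSr.
Qed.

End NilpotentAction.

Section Cartan.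
Variables (K : numClosedFieldType) (g : lieAlgType K).
Implicit Types (A l h : set g).

(** Otherwise [(h + A) / h] has a nonzero subspace killed by [h]; its preimage normalizes [h],
    although a Cartan subalgebra is its own normalizer. *)
Lemma cartan_engel l h A : finite_dim l -> cartan_subalgebra l h ->
  subspace A -> A `<=` l -> rstable h (@lie _ g) A ->
  (forall z a, h z -> A a -> exists k, iter k (lie z) a = 0) -> A `<=` h.
Proof.
move=> fl [sh hl nh hN] hA Al sA nA; apply: contrapT => nAh.
have [hh bh] := sh; have fh := finite_dim_sub fl hh hl.
have fD := finite_dim_add fh (finite_dim_sub fl hA Al).
have ad := lie_rep_ad h.
have sh' : rstable h (@lie _ g) h by move=> x hx y; exact: bh.
have [||C [hC [hC' CD] nC sC Cn]] :=
  nilpotent_flag sh nh ad fD hh (subl_addset hA) _ _ sh'.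
- by move=> e; apply: nAh; rewrite e; exact: subr_addset.
- move=> x hx _ [y [a [hy Aa ->]]]; rewrite lieDr.
  by exists (lie x y), (lie x a); split=> //; [exact: bh|exact: sA].
apply: nC; rewrite eqEsubset; split=> // c Cc.
rewrite -hN; split.
  have [y [a [hy Aa ->]]] := CD _ Cc.
  have [fhl _] := fl; have hsl := finite_dim_subspace fl.
  by apply: subspaceD => //; [exact: hl|exact: Al].
move=> y hy; rewrite lieC; apply: subspaceN => //; apply: Cn => //.
move=> _ [u [a [hu Aa ->]]]; have [k kn] := nA _ _ hy Aa; exists k.
have -> : iter k (lie y) (u + a) = iter k (lie y) u + iter k (lie y) a.
  by elim: k {kn} => //= k ->; rewrite lieDr.
by rewrite kn addr0; elim: k {kn} => //= k; exact: bh.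
Qed.

End Cartan.

(** * Cartan's criterion and the Casimir element *)

Section Traces.
Variable K : numClosedFieldType.

Lemma trig_mul n (A B : 'M[K]_n) : is_trig_mx A -> is_trig_mx B ->
  is_trig_mx (A *m B) /\ forall i, (A *m B) i i = A i i * B i i.
Proof.
move=> /is_trig_mxP tA /is_trig_mxP tB; split=> [|i].
  apply/is_trig_mxP => i j ij; rewrite mxE big1 // => k _.
  have [ik|ki] := ltnP i k; first by rewrite tA // mul0r.
  by rewrite tB ?mulr0 // (leq_ltn_trans ki).
rewrite mxE (bigD1 i) //= big1 ?addr0 // => k ki.
have [ik|ki'] := ltnP i k; first by rewrite tA // mul0r.
rewrite tB ?mulr0 // ltn_neqAle ki' andbT.
by apply: contraNneq ki => e; apply/eqP/val_inj.
Qed.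

Lemma trig_horner n (A : 'M[K]_n.+1) q : is_trig_mx A ->
  is_trig_mx (horner_mx A q) /\ forall i, (horner_mx A q) i i = q.[A i i].
Proof.
move=> tA; elim/poly_ind: q => [|q c [IH1 IH2]].
  by rewrite rmorph0 mx0_is_trig; split=> // i; rewrite mxE horner0.
have [t1 t2] := trig_mul IH1 tA.
rewrite rmorphD rmorphM /= horner_mx_X horner_mx_C; split=> [|i].
  apply/is_trig_mxP => i j ij; rewrite mxE.
  move/is_trig_mxP: t1 => -> //; rewrite add0r mxE.
  by case: eqP ij => [->|//]; rewrite ltnn.
by rewrite mxE [X in X + _]t2 IH2 hornerD hornerM hornerX hornerC mxE eqxx.
Qed.

Lemma schur_form n (X : 'M[K]_n.+1) : exists P T : 'M[K]_n.+1,
  [/\ P \in unitmx, is_trig_mx T, T = P *m X *m invmx P &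
      forall a, eigenvalue X a = [exists i, T i i == a]].
Proof.
have [P Pu tP] := @Schur K n.+1 X (ltn0Sn n).
have uP := unitarymx_unit Pu.
have tT : is_trig_mx (P *m X *m invmx P) by rewrite -(pinvmxE uP); exact: tP.
exists P, (P *m X *m invmx P); split=> // a.
transitivity (eigenvalue (P *m X *m invmx P) a); last first.
  rewrite eigenvalue_root_char char_poly_trig // rootE horner_prod.
  apply/prodf_eq0/existsP => [[i _]|[i /eqP <-]]; last first.
    by exists i => //; rewrite hornerXsubC subrr.
  by rewrite hornerXsubC subr_eq0 => /eqP ->; exists i.
apply/eigenvalueP/eigenvalueP => -[v vX v0].
  exists (v *m invmx P); first by rewrite !mulmxA mulmxKV // vX scalemxAl.
  by apply: contraNneq v0 => e; rewrite -(mulmxKV uP v) e mul0mx.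
exists (v *m P); last first.
  by apply: contraNneq v0 => e; rewrite -(mulmxK uP v) e mul0mx.
have -> : v *m P *m X = v *m (P *m X *m invmx P) *m P by rewrite !mulmxA
  mulmxKV.
by rewrite vX scalemxAl.
Qed.

Lemma tr_conj n (P X : 'M[K]_n) : P \in unitmx -> \tr (P *m X *m invmx P) = \tr
  X.
Proof. by move=> uP; rewrite mxtrace_mulC mulmxA mulVmx // mul1mx. Qed.

Lemma nilpotent_mxtrace n (X : 'M[K]_n) :
  (forall v : 'rV_n, geig (fun u => u *m X) 0 v) -> \tr X = 0.
Proof.
case: n X => [|n] X nX; first by rewrite /mxtrace big_ord0.
have [P [T [uP tT TE eT]]] := schur_form X.
rewrite -(tr_conj X uP) -TE /mxtrace big1 // => i _.
have /eigenvalueP[v vX v0] : eigenvalue X (T i i).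
  by rewrite eT; apply/existsP; exists i.
apply/eqP/negPn/negP => t0; case/eqP: v0.
exact: (geig_neq (mulmxr_linear X) (nX v) vX t0).
Qed.

(** In triangular form the trace is the sum of the squared moduli of the eigenvalues. *)
Lemma trace_conj_nilpotent n (X : 'M[K]_n.+1) q :
  (forall a, eigenvalue X a -> q.[a] = a^*) ->
  \tr (X *m horner_mx X q) = 0 -> forall a, eigenvalue X a -> a = 0.
Proof.
move=> qX; have [P [T [uP tT TE eT]]] := schur_form X.
have [tq dq] := trig_horner q tT; have [_ dT] := trig_mul tT tq.
have eTi i : eigenvalue X (T i i) by rewrite eT; apply/existsP; exists i.
have -> : \tr (X *m horner_mx X q) = \sum_i `|T i i| ^+ 2.
  rewrite -(tr_conj _ uP).
  have -> : P *m (X *m horner_mx X q) *m invmx P = T *m horner_mx T q.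
    rewrite TE horner_mx_uconj; last by [].
    by rewrite !mulmxA mulmxKV.
  by apply: eq_bigr => i _; rewrite dT dq qX // normCK.
move=> /eqP; rewrite psumr_eq0 => [/allP h a|i _]; last exact: exprn_ge0.
rewrite eT => /existsP[i /eqP <-].
by have := h i (mem_index_enum _); rewrite /= expf_eq0 normr_eq0 /= => /eqP.
Qed.

(** As [f] kills [T A], each application of [T - l] multiplies the value of [f] by [- l]. *)
Lemma geig_functional (M : lmodType K) (T : M -> M) (f : M -> K) l v A :
  (forall a u w, f (a *: u + w) = a * f u + f w) -> subspace A -> stable T A ->
  (forall u, A u -> f (T u) = 0) -> A v -> l != 0 -> geig T l v -> f v = 0.
Proof.
move=> lf hA sT fT Av l0 [k kv].
have f0 : f 0 = 0 by have := lf (-1) 0 0; rewrite scaler0 addr0 mulN1r addNr.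
have : (- l) ^+ k * f v = 0.
  rewrite -f0 -kv; elim: k {kv} v Av => [|k IH] v Av; first by rewrite mul1r.
  rewrite iterSr -IH; last exact: (@stable_XsubC _ _ T l A hA sT v Av).
  by rewrite addrC -scaleNr lf fT // addr0 mulrA exprSr.
by move/eqP; rewrite mulf_eq0 expf_eq0 oppr_eq0 (negPf l0) andbF => /eqP.
Qed.

Lemma mulmx_eq_rows m p (A B : 'M[K]_(m, p)) :
  (forall u : 'rV_m, u *m A = u *m B) -> A = B.
Proof. by move=> AB; apply/row_matrixP => i; rewrite !rowE AB. Qed.

Lemma char_poly_pop m (X : 'M[K]_m.+1) (u : 'rV_m.+1) :
  pop (fun v => v *m X) (char_poly X) u = 0.
Proof. by rewrite pop_mulmx Cayley_Hamilton mulmx0. Qed.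

Lemma char_poly_neq0 m (X : 'M[K]_m) : char_poly X != 0.
Proof. exact/monic_neq0/char_poly_monic. Qed.

End Traces.

Section MatrixReps.
Variables (K : numClosedFieldType) (g : lieAlgType K).
Implicit Types (l h I J : set g) (x y z : g).

(* Matrices act on the right, whence the order of the products.               *)
Definition mx_rep l n (R : g -> 'M[K]_n) :=
  (forall a x y, l x -> l y -> R (a *: x + y) = a *: R x + R y) /\
  (forall x y, l x -> l y -> R (lie x y) = R y *m R x - R x *m R y).

Lemma frame_mx_rep l (M : lmodType K) (rho : g -> M -> M) n (d : 'rV_n -> M) U :
  subalgebra l -> lie_rep l rho -> frame d U -> rstable l rho U ->
  mx_rep l (fun x => frame_mx d (rho x)).
Proof.
move=> [hl bl] [rl rD rM] fd sU; have [ld _ _] := fd.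
have hU := frame_subspace fd.
have rE x v : l x -> rho x (d v) = d (v *m frame_mx d (rho x)).
  by move=> lx; apply: (frame_mxE _ fd (rl _ lx) (sU _ lx)).
split=> [a x y lx ly|x y lx ly].
  have lz : l (a *: x + y) by apply: subspaceD => //; exact: subspaceZ.
  apply: (frame_mx_eq fd (rl _ lz) (sU _ lz)) => v.
  by rewrite rD // !rE // mulmxDr -scalemxAr ld.
have lz := bl _ _ lx ly; apply: (frame_mx_eq fd (rl _ lz) (sU _ lz)) => v.
by rewrite rM // !rE // mulmxBr !mulmxA (linB ld).
Qed.

Variables (l : set g) (n : nat) (R : g -> 'M[K]_n).
Hypotheses (hl : subspace l) (rR : mx_rep l R).

Lemma mx_rep0 : R 0 = 0.
Proof.
have [h _] := rR; have := h (-1) 0 0 (subspace0 hl) (subspace0 hl).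
by rewrite scaler0 addr0 scaleN1r addNr.
Qed.

Lemma mx_repZ a x : l x -> R (a *: x) = a *: R x.
Proof.
move=> lx; have [h _] := rR; rewrite -[a *: x]addr0 h ?mx_rep0 ?addr0 //.
exact: subspace0.
Qed.

Lemma mx_repD x y : l x -> l y -> R (x + y) = R x + R y.
Proof. by move=> lx ly; have [h _] := rR;
  rewrite -[x in LHS]scale1r h // scale1r. Qed.

Lemma mx_rep_sum (I : finType) (F : I -> g) : (forall i, l (F i)) ->
  R (\sum_i F i) = \sum_i R (F i).
Proof.
move=> lF; suff: R (\sum_i F i) = \sum_i R (F i) /\ l (\sum_i F i) by case.
apply: (big_ind2 (fun u U => R u = U /\ l u)) => //.
- by split; [exact: mx_rep0|exact: subspace0].
- by move=> u1 u2 v1 v2 [<- lu] [<- lv]; rewrite mx_repD //; split=> //;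
  exact: subspaceD.
Qed.

Lemma geig_mx_rep x y a b v : subalgebra l -> l x -> l y ->
  geig (fun u : 'rV_n => u *m R x) a v -> geig (lie x) b y ->
  geig (fun u : 'rV_n => u *m R x) (a + b) (v *m R y).
Proof.
move=> [_ bl] lx ly gv gy; have [rD rM] := rR.
apply: (@geig_bilin _ _ _ _ (fun (u : 'rV_n) y => u *m R y) setT l
  (fun u => u *m R x) (lie x)) => //.
- by move=> z lz; exact: bl.
- by move=> z c u u' _ _; rewrite mulmxDl -scalemxAl.
- by move=> u c z z' lz lz'; rewrite rD // mulmxDr -scalemxAr.
- exact: mulmxr_linear.
- by move=> u z _ lz; rewrite rM // mulmxBr !mulmxA addrC subrK.
Qed.

End MatrixReps.

Section CartanCriterion.
Variables (K : numClosedFieldType) (g : lieAlgType K).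
Variables (l h J : set g) (n : nat) (R : g -> 'M[K]_n.+1).
Hypotheses (fl : finite_dim l) (rl : reductive l) (ch : cartan_subalgebra l h).
Hypotheses (mJ : minimal_ideal l J) (pJ : lie_set J J = J) (rR : mx_rep l R).
Hypothesis fR : forall x, J x -> R x = 0 -> x = 0.
Hypothesis trJ0 : forall x y, J x -> J y -> \tr (R x *m R y) = 0.

Let sl : subalgebra l. Proof. by case: rl. Qed.
Let hl : subspace l. Proof. by case: sl. Qed.
Let iJ : ideal_of l J. Proof. by case: mJ. Qed.
Let hJ : subspace J. Proof. by case: iJ. Qed.
Let Jl : J `<=` l. Proof. by case: iJ. Qed.
Let fJ : finite_dim J. Proof. exact: finite_dim_sub fl hJ Jl. Qed.
Let sJ x : l x -> stable (lie x) J.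
Proof. by move=> lx y; case: iJ => _ _; apply. Qed.

Lemma criterion_nilpotent x : J x -> forall a, eigenvalue (R x) a -> a = 0.
Proof.
move=> Jx; pose X := R x; have lx := Jl Jx.
have lX := @mulmxr_linear K 1 _ X.
have [q qP] := functional_calculus (fun a : K => a^*) (char_poly_neq0 X).
(* S is the conjugate of the semisimple part of R x, and ad S preserves R J;  *)
(* hence R x and S are trace-orthogonal, i.e., the eigenvalues a of R x have  *)
(* sum of squared moduli 0.                                                   *)
pose S := horner_mx X q; have Sg a (u : 'rV_n.+1) :
    geig (fun v => v *m X) a u -> u *m S = a^* *: u.
  by move=> gu; rewrite -pop_mulmx; apply: qP => //; exact: char_poly_pop.
have trS0 z : J z -> \tr (R z *m S) = 0.
  (* For [b] in the generalized eigenspace of [lie x] for [m], [R b] raises the eigenvalues of [R x]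
     by [m], so its commutator with [S] is minus the conjugate of [m] times [R b]; the sign comes
     from the action on the right. *)
  have comm b : J b -> exists2 b', J b' & S *m R b - R b *m S = R b'.
    have [p p0 pJ0] := fin_pop (lie_linearr x) fJ (sJ lx).
    pose C := [set b | J b /\ exists2 b', J b' & S *m R b - R b *m S = R b'].
    move=> Jb; suff : C b by case.
    apply: (geig_span (lie_linearr x) p0 (pJ0 _ Jb)).
      split=> [|c b1 b2 [Jb1 [b1' Jb1' e1]] [Jb2 [b2' Jb2' e2]]].
        split; first exact: subspace0.
        exists 0; first exact: subspace0.
        by rewrite (mx_rep0 hl rR) mulmx0 mul0mx subr0.
      split; first by apply: subspaceD => //; exact: subspaceZ.
      exists (c *: b1' + b2'); first by apply: subspaceD => //;
        exact: subspaceZ.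
      have [rD _] := rR; rewrite !rD //; try exact: Jl.
      rewrite mulmxDr mulmxDl -scalemxAr -scalemxAl opprD addrACA -scalerBr.
      by rewrite e1 e2.
    move=> r m; have := @stable_pop _ _ _ r _ hJ (sJ lx) _ Jb.
    move: (pop (lie x) r b) => {Jb}{}b Jb gb; split=> //.
    exists (- m^* *: b); first exact: subspaceZ.
    rewrite (mx_repZ hl rR) //; last exact: Jl.
    apply: mulmx_eq_rows => u.
    pose D := [set u : 'rV_n.+1 |
      u *m (S *m R b - R b *m S) = u *m (- m^* *: R b)].
    suff : D u by [].
    apply: (geig_span lX (char_poly_neq0 X) (char_poly_pop X u)).
      split=> [|c u1 u2]; first by rewrite /D /= !mul0mx.
      by rewrite /D /= !mulmxDl -!scalemxAl => -> ->.
    move=> r' a; move: (pop _ r' u) => {}u gu; rewrite /D /=.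
    have gub := geig_mx_rep hl rR sl lx (Jl Jb) gu gb.
    rewrite mulmxBr !mulmxA (Sg _ _ gub) (Sg _ _ gu) -scalemxAl -scalerBl.
    by rewrite rmorphD /= opprD addrA subrr sub0r -scalemxAr.
  pose C := [set z | J z /\ \tr (R z *m S) = 0].
  move=> Jz; suff : C z by case.
  have : J `<=` C; last by apply.
  rewrite -{1}pJ; apply: lie_set_sub.
    split=> [|c u v [Ju eu] [Jv ev]].
      by split; [exact: subspace0|rewrite (mx_rep0 hl rR) mul0mx mxtrace0].
    split; first by apply: subspaceD => //; exact: subspaceZ.
    have [rD _] := rR; rewrite rD //; try exact: Jl.
    by rewrite mulmxDl -scalemxAl mxtraceD mxtraceZ eu ev mulr0 addr0.
  move=> a b Ja Jb; split; first by apply: sJ => //; exact: Jl.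
  have [_ rM] := rR; rewrite rM //; try exact: Jl.
  have [b' Jb' bE] := comm b Jb.
  (* Cyclicity turns the trace of [R [a, b] S] into that of [R a] times the commutator of [S] and
     [R b], that is, of [R a R b'], which is 0 by hypothesis. *)
  rewrite mulmxBl linearB /= -[R b *m R a *m S]mulmxA mxtrace_mulC -!mulmxA.
  by rewrite -linearB /= -mulmxBr bE trJ0.
apply: (@trace_conj_nilpotent _ _ _ q); last exact: trS0.
move=> a /eigenvalueP[v vX v0].
have := Sg a v (geig_eig vX); rewrite -pop_mulmx (pop_eig _ lX vX).
by move/eqP; rewrite -subr_eq0 -scalerBl scaler_eq0 (negPf v0) orbF subr_eq0 =>
  /eqP.
Qed.

(** A component of [b] for a nonzero eigenvalue [m] of [lie x] would shift the eigenvalues of [R x]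
    by [m]; since 0 is the only one, [R] kills this component, and [R] is faithful on [J]. *)
Lemma criterion_ad_nilpotent x b : J x -> J b -> exists k, iter k (lie x) b = 0.
Proof.
move=> Jx Jb; have lx := Jl Jx.
have [p p0 pJ0] := fin_pop (lie_linearr x) fJ (sJ lx).
have lX := @mulmxr_linear K 1 _ (R x).
have g0 a u : geig (fun v : 'rV_n.+1 => v *m R x) a u -> a != 0 -> u = 0.
  move=> gu a0; apply/eqP/negPn/negP => u0.
  have [|v [_ v0 vX]] := geig_eigenvector (@subspaceT _ _) _ I gu u0;
    first by [].
  case/eqP: a0; apply: (criterion_nilpotent Jx).
  by apply/eigenvalueP; exists v.
suff : geig (lie x) 0 b.
  case=> k kb; exists k; rewrite -kb; apply: eq_iter => u.
  by rewrite scale0r subr0.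
apply: (geig_span (lie_linearr x) p0 (pJ0 _ Jb)).
  exact: subspace_geig (lie_linearr x).
move=> r m; have := @stable_pop _ _ _ r _ hJ (sJ lx) _ Jb.
move: (pop (lie x) r b) => {Jb}{}b Jb gb; have [<-//|m0] := eqVneq m 0.
suff -> : b = 0 by exists 0%N.
apply: fR => //; apply: mulmx_eq_rows => u; rewrite mulmx0.
pose D := [set u : 'rV_n.+1 | u *m R b = 0]; suff : D u by [].
apply: (geig_span lX (char_poly_neq0 (R x)) (char_poly_pop (R x) u)).
  split=> [|c u1 u2]; first by rewrite /D /= mul0mx.
  by rewrite /D /= mulmxDl -scalemxAl => -> ->; rewrite scaler0 addr0.
move=> r' a; move: (pop _ r' u) => {}u gu; rewrite /D /=.
have [a0|a0] := eqVneq a 0; last by rewrite (g0 _ _ gu a0) mul0mx.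
apply: (g0 _ _ (geig_mx_rep hl rR sl lx (Jl Jb) gu gb)).
by rewrite a0 add0r.
Qed.

(** The complement of [J] commutes with [J] and [J] acts nilpotently on itself, so [h] acts
    nilpotently on [J] and [J] lies in [h]. But [h] is nilpotent, while [J] is perfect and
    nonzero. *)
Lemma cartan_criterion : False.
Proof.
have [_ rI] := rl; have [J' iJ' [lE JJ'0]] := rI _ iJ.
have [sh hhl nh hN] := ch.
have nil y b : h y -> J b -> exists k, iter k (lie y) b = 0.
  move=> /hhl; rewrite lE => -[a Ja [c J'c <-]] Jb.
  have [k kb] := criterion_ad_nilpotent Ja Jb; exists k; rewrite -kb.
  elim: k {kb} => //= k ->.
  have : J (iter k (lie a) b).
    by elim: k => //= k; apply: sJ; exact: Jl.
  move: (iter k _ b) => u Ju; rewrite lieDl [lie c u]lieC.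
  by rewrite (disjoint_ideals iJ iJ' JJ'0 Ju J'c) oppr0 addr0.
have Jh : J `<=` h.
  apply: (cartan_engel fl ch hJ Jl) => // y hy; apply: sJ; exact: hhl.
have [k kn] := nh; have JC : J `<=` lower_central h k.
  elim: k {kn} => //= k IH; rewrite -{1}pJ; apply: lie_set_sub.
    exact: subspace_span.
  by move=> a b Ja Jb; apply: lie_setP; [exact: Jh|exact: IH].
have [_ J0 _] := mJ; apply: J0; rewrite eqEsubset; split=> [x /JC|_ ->].
  by rewrite kn.
exact: subspace0.
Qed.

End CartanCriterion.

Section Casimir.
Variables (K : numClosedFieldType) (g : lieAlgType K).
Variables (l h J : set g) (n : nat) (R : g -> 'M[K]_n.+1).
Hypotheses (fl : finite_dim l) (rl : reductive l) (ch : cartan_subalgebra l h).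
Hypotheses (mJ : minimal_ideal l J) (pJ : lie_set J J = J) (rR : mx_rep l R).
Hypothesis fR : forall x, J x -> R x = 0 -> x = 0.

Let sl : subalgebra l. Proof. by case: rl. Qed.
Let hl : subspace l. Proof. by case: sl. Qed.
Let iJ : ideal_of l J. Proof. by case: mJ. Qed.
Let hJ : subspace J. Proof. by case: iJ. Qed.
Let Jl : J `<=` l. Proof. by case: iJ. Qed.

Lemma trace_invariant x y z : l x -> l y -> l z ->
  \tr (R (lie z x) *m R y) = - \tr (R x *m R (lie z y)).
Proof.
move=> lx ly lz; have [_ rM] := rR;
  rewrite !rM // mulmxBl mulmxBr !linearB /= opprB.
by rewrite [in X in _ - X]mxtrace_mulC !mulmxA; congr (_ - _);
  rewrite mxtrace_mulC mulmxA.
Qed.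

(** The radical of the form on [J] is an ideal, hence 0 or [J], and Cartan's criterion excludes
    [J]. *)
Lemma trace_form_nondegenerate x : J x ->
  (forall y, J y -> \tr (R x *m R y) = 0) -> x = 0.
Proof.
move=> Jx trx; have [rD _] := rR.
pose I := [set x | J x /\ forall y, J y -> \tr (R x *m R y) = 0].
have iI : ideal_of l I.
  split.
  - split=> [|c u v [Ju eu] [Jv ev]].
      split=> [|y _]; first exact: subspace0.
      by rewrite (mx_rep0 hl rR) mul0mx mxtrace0.
    split=> [|y Jy]; first by apply: subspaceD => //; exact: subspaceZ.
    rewrite rD; try exact: Jl.
    by rewrite mulmxDl -scalemxAl mxtraceD mxtraceZ eu ?ev // mulr0 addr0.
  - by move=> u [/Jl].
  - move=> z u lz [Ju eu]; have [_ _ bJ] := iJ; split=> [|y Jy];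
    first exact: bJ.
    rewrite trace_invariant //; try exact: Jl.
    by rewrite eu ?oppr0 //; exact: bJ.
have [_ _ Jmin] := mJ; have [|I0|IJ] := Jmin _ iI; first by move=> u [].
  by have : I x by []; rewrite I0.
exfalso; apply: (cartan_criterion fl rl ch mJ pJ rR fR) => u v Ju Jv.
by move: Ju; rewrite -IJ => -[_]; apply.
Qed.

(* The Casimir element of J for the trace form.                               *)
Lemma casimir : exists W : 'M[K]_n.+1,
  [/\ \tr W != 0, forall z, l z -> W *m R z = R z *m W &
      exists (r : nat) (B : 'I_r -> 'M[K]_n.+1) (e : 'I_r -> g),
        (forall i, J (e i)) /\ W = \sum_i B i *m R (e i)].
Proof.
have fJ := finite_dim_sub fl hJ Jl.
have [r [e fe]] := finite_dim_frame fJ; have [le ie JE] := fe.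
have Je v : J (e v) by rewrite JE; exists v.
pose E i := R (e (delta_mx 0 i)).
have RE (v : 'rV_r) : R (e v) = \sum_i v 0 i *: E i.
  rewrite {1}[v]row_sum_delta (lin_sum le) (mx_rep_sum hl rR) => [|i].
    apply: eq_bigr => i _; rewrite (linZ le) (mx_repZ hl rR) //; exact/Jl.
  exact/Jl.
pose B := \matrix_(i, j) \tr (E i *m E j).
have Bu : B \in unitmx.
  rewrite -row_free_unit -kermx_eq0; apply/rowV0P => v /sub_kermxP vB.
  apply: ie; rewrite (lin0 le); apply: trace_form_nondegenerate => // y.
  rewrite {1}JE => -[u _ <-].
  transitivity ((v *m B *m u^T) 0 0); last by rewrite vB mul0mx mxE.
  rewrite !RE mulmx_suml linear_sum /= -mulmxA mxE; apply: eq_bigr => i _.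
  rewrite mulmx_sumr linear_sum /= mxE mulr_sumr; apply: eq_bigr => j _.
  by rewrite -scalemxAl -scalemxAr !linearZ /= !mxE mulrCA; ring.
pose C := invmx B.
(* [C] is the inverse Gram matrix, so this is the sum of products over a basis and its dual basis,
   and its trace is [\tr (C *m B)], the dimension of [J]. *)
pose W := \sum_i \sum_j C i j *: (E i *m E j).
have r0 : r != 0%N.
  have [_ J0 _] := mJ; apply/eqP => r0; apply: J0; rewrite eqEsubset;
    split=> [x|_ ->].
    rewrite JE => -[v _ <-] /=; suff -> : v = 0 by exact: lin0 le.
    by apply/rowP => -[i ir]; exfalso; move: ir; rewrite r0.
  exact: subspace0.
exists W; split.
- rewrite /W linear_sum /=.
  have -> : \sum_i \tr (\sum_j C i j *: (E i *m E j)) = \tr (C *m B).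
    apply: eq_bigr => i _; rewrite linear_sum mxE; apply: eq_bigr => j _ /=.
    by rewrite linearZ /= !mxE mxtrace_mulC.
  by rewrite mulVmx // mxtrace1 pnatr_eq0.
- move=> z lz; pose A := frame_mx e (lie z).
  have sz : stable (lie z) J by have [_ _ bJ] := iJ; move=> u; exact: bJ.
  have EZ i : E i *m R z - R z *m E i = \sum_k A i k *: E k.
    have [_ rM] := rR; rewrite -rM //; last exact: Jl.
    rewrite (frame_mxE _ fe (lie_linearr z) sz) -rowE RE.
    by apply: eq_bigr => k _; rewrite mxE.
  (* Invariance of the trace form in coordinates, [A] being the matrix of [lie z]; conjugating by
     [C] gives the invariance of the dual form, which is what commutation with [R z] requires. *)
  have inv : A *m B + B *m A^T = 0.
    apply/matrixP => i j; rewrite !mxE.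
    have -> : \sum_k A i k * B k j = \tr ((E i *m R z - R z *m E i) *m E j).
      rewrite EZ mulmx_suml linear_sum /=; apply: eq_bigr => k _.
      by rewrite -scalemxAl mxtraceZ [B _ _]mxE.
    have -> : \sum_k B i k * A^T k j = \tr (E i *m (E j *m R z - R z *m E j)).
      rewrite EZ mulmx_sumr linear_sum /=; apply: eq_bigr => k _.
      by rewrite -scalemxAr mxtraceZ !mxE mulrC.
    rewrite mulmxBl mulmxBr !linearB /= -[R z *m _ *m _]mulmxA.
    by rewrite [\tr (R z *m _)]mxtrace_mulC !mulmxA addrA subrK subrr.
  have CA : C *m A + A^T *m C = 0.
    have := congr1 (fun X => C *m X *m C) inv.
    rewrite mulmxDr mulmxDl mulmx0 mul0mx !mulmxA mulVmx // mul1mx.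
    by rewrite -!mulmxA mulmxV // mulmx1.
  apply/eqP; rewrite -subr_eq0 /W; apply/eqP.
  have -> : (\sum_i \sum_j C i j *: (E i *m E j)) *m R z -
      R z *m (\sum_i \sum_j C i j *: (E i *m E j)) =
      \sum_i \sum_j C i j *: (E i *m (E j *m R z - R z *m E j)) +
      \sum_i \sum_j C i j *: ((E i *m R z - R z *m E i) *m E j).
    rewrite mulmx_suml mulmx_sumr -sumrB -big_split /=; apply: eq_bigr => i _.
    rewrite mulmx_suml mulmx_sumr -sumrB -big_split /=; apply: eq_bigr => j _.
    rewrite -scalemxAl -scalemxAr -scalerBr -scalerDr; congr (_ *: _).
    by rewrite mulmxBl mulmxBr !mulmxA addrA subrK.
  have -> : \sum_i \sum_j C i j *: (E i *m (E j *m R z - R z *m E j)) =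
      \sum_i \sum_k (C *m A) i k *: (E i *m E k).
    apply: eq_bigr => i _.
    transitivity (\sum_j \sum_k (C i j * A j k) *: (E i *m E k)).
      apply: eq_bigr => j _; rewrite EZ mulmx_sumr scaler_sumr.
      by apply: eq_bigr => k _; rewrite -scalemxAr scalerA.
    by rewrite exchange_big /=; apply: eq_bigr => k _; rewrite mxE scaler_suml.
  have -> : \sum_i \sum_j C i j *: ((E i *m R z - R z *m E i) *m E j) =
      \sum_i \sum_k (A^T *m C) i k *: (E i *m E k).
    rewrite exchange_big [RHS]exchange_big /=; apply: eq_bigr => j _.
    transitivity (\sum_i \sum_k (A i k * C i j) *: (E k *m E j)).
      apply: eq_bigr => i _; rewrite EZ mulmx_suml scaler_sumr.
      by apply: eq_bigr => k _; rewrite -scalemxAl scalerA mulrC.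
    rewrite exchange_big /=; apply: eq_bigr => k _; rewrite mxE scaler_suml.
    by apply: eq_bigr => i _; rewrite [A^T _ _]mxE.
  rewrite -big_split big1 // => i _; rewrite -big_split big1 // => k _ /=.
  by rewrite -scalerDl; have /matrixP/(_ i k) := CA; rewrite !mxE => ->;
    rewrite scale0r.
- exists r, (fun j => \sum_i C i j *: E i), (fun j => e (delta_mx 0 j));
  split=> //.
  rewrite /W exchange_big /=; apply: eq_bigr => j _; rewrite mulmx_suml.
  by apply: eq_bigr => i _; rewrite scalemxAl.
Qed.

End Casimir.

(* What is needed of Weyl's theorem: an invariant functional that kills the   *)
(* invariants is 0.                                                           *)
Section WeakReducibility.
Variables (K : numClosedFieldType) (g : lieAlgType K) (M : lmodType K).
Variables (l h : set g) (rho : g -> M -> M) (U : set M) (f : M -> K).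
Hypotheses (fl : finite_dim l) (rl : reductive l) (ch : cartan_subalgebra l h).
Hypotheses (rr : lie_rep l rho) (fU : finite_dim U) (sU : rstable l rho U).
Hypothesis lf : forall a u v, f (a *: u + v) = a * f u + f v.
Hypothesis f_lU : forall x v, l x -> U v -> f (rho x v) = 0.
Hypothesis f_inv : forall v, U v -> (forall x, l x -> rho x v = 0) -> f v = 0.
Hypothesis centerU :
  forall z v, center_of l z -> U v -> geig (rho z) 0 v -> rho z v = 0.

Let sl : subalgebra l. Proof. by case: rl. Qed.
Let hl : subspace l. Proof. by case: sl. Qed.
Let hU : subspace U. Proof. exact: finite_dim_subspace fU. Qed.

Let hf : subspace [set v | f v = 0].
Proof.
split=> [|c u v fu fv] /=; last by rewrite lf fu fv mulr0 addr0.
by have := lf (-1) 0 0; rewrite scaler0 addr0 mulN1r addNr.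
Qed.

Section Minimal.
Variable C : set M.
Hypotheses (hC : subspace C) (CU : C `<=` U) (sC : rstable l rho C).
Hypothesis minC : forall D, subspace D -> D `<=` C -> rstable l rho D ->
  (exists2 v, D v & f v <> 0) -> D = C.
Hypothesis fC : exists2 v, C v & f v <> 0.

Let fdC : finite_dim C. Proof. exact: finite_dim_sub fU hC CU. Qed.
Let rlin x : l x -> linear (rho x). Proof. by case: rr => H _ _; exact: H. Qed.

Let kernel := [set x | l x /\ forall v, C v -> rho x v = 0].

Lemma kernel_ideal : ideal_of l kernel.
Proof.
have [rL rD rM] := rr; have [_ bl] := sl; split.
- split=> [|c x y [lx kx] [ly ky]].
    by split=> [|v _]; [exact: subspace0|exact: rep0 hl rr].
  split=> [|v Cv]; first by apply: subspaceD => //; exact: subspaceZ.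
  by rewrite rD // kx // ky // scaler0 addr0.
- by move=> x [].
- move=> x y lx [ly ky]; split=> [|v Cv]; first exact: bl.
  have Cxv : C (rho x v) by exact: sC.
  by rewrite rM // (ky v Cv) (ky _ Cxv) (lin0 (rL _ lx)) subr0.
Qed.

(** For [x] in [J], [f] kills the generalized eigenspaces with nonzero eigenvalue, so it is nonzero
    on the one for 0, where [centerU] makes [x] act by 0. The kernel of [x] in [C] is stable, hence
    equal to [C], and [x] lies in [kernel]. *)
Lemma minimal_central J : minimal_ideal l J -> J `<=` center_of l ->
  J `&` kernel = [set 0] -> False.
Proof.
move=> [iJ J0 _] Jc Jk; have [hJ Jl _] := iJ; have [rL rD rM] := rr.
apply: J0; rewrite eqEsubset; split=> [x Jx|_ ->]; last exact: subspace0.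
rewrite -Jk; split=> //; have lx := Jl _ Jx; split=> //.
have [_ xc] := Jc _ Jx;
  have xcomm y v : l y -> rho x (rho y v) = rho y (rho x v).
  move=> ly; apply/eqP; rewrite -subr_eq0 -rM // xc //.
  exact/eqP/(rep0 _ hl rr).
pose D := C `&` [set v | rho x v = 0].
have <- // : D = C; last by move=> v [].
have hD : subspace D.
  apply: subspaceI => //; apply: (@subspace_preim _ _ _ (rho x) _ [set 0]).
    exact: rlin.
  exact: subspace_set0.
apply: minC => //; first by move=> v [].
  move=> y ly v [Cv xv]; split; first exact: sC.
  by rewrite /= xcomm // xv (lin0 (rL _ ly)).
apply: contrapT => nD; have [v Cv] := fC; apply.
have [p p0 pC] := fin_pop (rL _ lx) fdC (sC lx).
apply: (geig_span (rL _ lx) p0 (pC _ Cv) hf) => q a.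
have := @stable_pop _ _ _ q _ hC (sC lx) _ Cv.
move: (pop _ q v) => {Cv}{}v Cv gv; have [a0|a0] := eqVneq a 0; last first.
  apply: (geig_functional lf hC (sC lx) _ Cv a0 gv) => u Cu.
  by apply: f_lU => //; exact: CU.
rewrite a0 in gv; apply: contrapT => fv; apply: nD; exists v => //; split=> //.
by apply: centerU => //; exact: CU.
Qed.

(** The Casimir element [W] commutes with [l], and [f] kills its image. So [f] is nonzero on the
    generalized 0-eigenspace of [W], which by minimality is all of [C]; but [W] has nonzero
    trace. *)
Lemma minimal_perfect J : minimal_ideal l J -> lie_set J J = J ->
  J `&` kernel = [set 0] -> False.
Proof.
move=> mJ pJ Jk; have [iJ _ _] := mJ; have [hJ Jl _] := iJ;
  have [rL rD rM] := rr.
have [[|n] [d fd]] := finite_dim_frame fdC; have [ld id CE] := fd.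
  have [v + fv] := fC; rewrite CE => -[u _ uv]; apply: fv.
  by rewrite -uv thinmx0 (lin0 ld); case: hf.
have Cd u : C (d u) by rewrite CE; exists u.
have dE x v : l x -> rho x (d v) = d (v *m frame_mx d (rho x)).
  by move=> lx; rewrite (frame_mxE _ fd (rL _ lx) (sC lx)).
have rR := frame_mx_rep sl rr fd sC.
have [x Jx Rx|W [trW cW [r [B [e [Je WE]]]]]] := casimir fl rl ch mJ pJ rR.
  suff : (J `&` kernel) x by rewrite Jk.
  split=> //; split; [exact: Jl|move=> v].
  by rewrite CE => -[u _ <-]; rewrite dE ?Rx ?mulmx0 ?(lin0 ld) //; exact: Jl.
pose fd' u := f (d u).
have lfd a u v : fd' (a *: u + v) = a * fd' u + fd' v by rewrite /fd' ld lf.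
have fW u : fd' (u *m W) = 0.
  rewrite /fd' WE mulmx_sumr (lin_sum ld); elim/big_rec: _ => [|i v _ fv].
    by case: hf.
  rewrite -[d _]scale1r lf fv addr0 mulmxA -dE; last exact: Jl.
  by rewrite mul1r f_lU //; [exact: Jl|exact: CU].
have lW := @mulmxr_linear K 1 _ W.
case/negP: trW; apply/eqP; apply: nilpotent_mxtrace => u.
suff DC : d @` [set u | geig (fun v => v *m W) 0 u] = C.
  by have := Cd u; rewrite -{1}DC => -[v gv /id <-].
apply: minC.
- exact: subspace_image (subspace_geig _ lW).
- by move=> _ [v _ <-].
- move=> x lx _ [v [k gv] <-]; rewrite /= dE //;
  exists (v *m frame_mx d (rho x)) => //.
  have it (w : 'rV_n.+1) j :
      iter j (fun u => u *m W - 0 *: u) (w *m frame_mx d (rho x)) =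
      iter j (fun u => u *m W - 0 *: u) w *m frame_mx d (rho x).
    by elim: j => //= j ->; rewrite !scale0r !subr0 -!mulmxA cW.
  by exists k; rewrite it gv mul0mx.
apply: contrapT => nD; have [v] := fC; rewrite CE => -[{}u _ <-]; apply.
pose D := [set u | fd' u = 0]; suff : D u by [].
have hD : subspace D.
  split=> [|c a b fa fb]; first by rewrite /D /= /fd' (lin0 ld); case: hf.
  by rewrite /D /= lfd fa fb mulr0 addr0.
apply: (geig_span lW (char_poly_neq0 W) (char_poly_pop W u) hD) => q a.
move: (pop _ q u) => {}u gu; have [a0|a0] := eqVneq a 0; last first.
  exact: (geig_functional lfd (@subspaceT _ _) _ _ _ a0 gu).
rewrite a0 in gu; apply: contrapT => fu; apply: nD; by exists (d u).
Qed.

(** Take a complement of the kernel of the action on [C]. If it is 0, [C] consists of invariants and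
    [f_inv] applies; otherwise it contains a minimal ideal, which acts faithfully and is central or
    perfect. *)
Lemma minimal_contradiction : False.
Proof.
have [_ rI] := rl; have [I iI [lE kI]] := rI _ kernel_ideal.
have [I0|I0] := pselect (I = [set 0]).
  have [v Cv] := fC; apply; apply: f_inv; first exact: CU.
  move=> x; rewrite lE I0 => -[y [_ ky] [_ -> <-]].
  by rewrite addr0 ky.
have [J mJ JI] := minimal_ideal_ex fl iI I0.
have Jk : J `&` kernel = [set 0].
  have [[hJ _ _] _ _] := mJ; have [hk _ _] := kernel_ideal.
  rewrite eqEsubset; split=> [x [/JI Ix kx]|_ ->].
    by rewrite -kI.
  by split; exact: subspace0.
have [Jc|pJ] := minimal_ideal_cases rl mJ.
  exact: minimal_central mJ Jc Jk.
exact: minimal_perfect mJ pJ Jk.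
Qed.

End Minimal.

Lemma invariant_functional0 v : U v -> f v = 0.
Proof.
move=> Uv; apply: contrapT => fv.
have [C [hC CU [sC fC] Cmin]] := @min_subspace _ _ U
  (fun C => rstable l rho C /\ exists2 v, C v & f v <> 0) fU
  (conj sU (ex_intro2 _ _ v Uv fv)).
apply: (@minimal_contradiction C) => // D hD DC sD fD.
exact: Cmin.
Qed.

End WeakReducibility.

(** * Semisimple elements of reductive Lie algebras *)

Section JordanParts.
Variable K : numClosedFieldType.

(** Additive Jordan decomposition, with the semisimple part given as a polynomial in [X]. *)
Lemma jordan_parts n (X : 'M[K]_n.+1) : exists q,
  (forall a (u : 'rV_n.+1), geig (fun v => v *m X) a u ->
     u *m horner_mx X q = a *: u) /\
  (forall u : 'rV_n.+1, geig (fun v => v *m (X - horner_mx X q)) 0 u).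
Proof.
have lX := @mulmxr_linear K 1 _ X.
have [q qP] := functional_calculus id (char_poly_neq0 X).
have Sg a (u : 'rV_n.+1) : geig (fun v => v *m X) a u -> u *m horner_mx X q = a
  *: u.
  by move=> gu; rewrite -pop_mulmx; apply: qP => //; exact: char_poly_pop.
exists q; split=> // u; set N := X - _.
have lN := @mulmxr_linear K 1 _ N.
apply: (geig_span lX (char_poly_neq0 X) (char_poly_pop X u) (subspace_geig 0
  lN)).
move=> r a; move: (pop _ r u) => {}u [k ku]; exists k.
elim: k u ku => // k IH u; rewrite !iterSr => ku.
have -> : u *m N - 0 *: u = u *m X - a *: u.
  rewrite scale0r subr0 mulmxBr (Sg a) //.
  by exists k.+1; rewrite iterSr.
exact: IH.
Qed.

End JordanParts.

Section CartanSemisimple.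
Variables (K : numClosedFieldType) (g : lieAlgType K) (m h : set g).
Hypotheses (fm : finite_dim m) (rm : reductive m) (ch : cartan_subalgebra m h).

Let sm : subalgebra m. Proof. by case: rm. Qed.
Let hm : subspace m. Proof. by case: sm. Qed.
Let bm x y : m x -> m y -> m (lie x y). Proof. by case: sm => _; apply. Qed.
Let shm : rstable m (@lie _ g) m. Proof. by move=> x mx y; exact: bm. Qed.

Lemma reductive_center_derived x : m x ->
  exists y z, [/\ center_of m y, lie_set m m z & x = y + z].
Proof.
have [_ rI] := rm; have iD := lie_set_ideal (whole_ideal sm) (whole_ideal sm).
have [J iJ [mE DJ]] := rI _ iD; rewrite {1}mE => -[z Dz [y Jy <-]].
have [_ Jm bJ] := iJ.
exists y, z; rewrite addrC; split=> //; split=> [|u mu]; first exact: Jm.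
have : (lie_set m m `&` J) (lie y u).
  by split; [apply: lie_setP => //; exact: Jm|exact: (ideal_opp iJ)].
by rewrite DJ.
Qed.

Lemma center_cartan z : center_of m z -> h z.
Proof.
have [[hh _] hsm _ hN] := ch.
move=> [mz cz]; rewrite -hN; split=> // y hy.
by rewrite cz; [exact: subspace0|exact: hsm].
Qed.

Section Frame.
Variables (n : nat) (d : 'rV[K]_n.+1 -> g).
Hypothesis fd : frame d m.
Let R x := frame_mx d (lie x).

Let ld : linear d. Proof. by case: fd. Qed.
Let md u : m (d u). Proof. by case: fd => _ _ ->; exists u. Qed.
Let mE x : m x -> exists u, d u = x.
Proof. by case: fd => _ _ -> [u _ <-]; exists u. Qed.
Let rR : mx_rep m R. Proof. exact: frame_mx_rep sm (lie_rep_ad m) fd shm. Qed.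
Let dR x u : m x -> lie x (d u) = d (u *m R x).
Proof. by move=> mx; rewrite (frame_mxE _ fd (lie_linearr x) (shm mx)). Qed.

Lemma ad_mx0 x : m x -> R x = 0 <-> center_of m x.
Proof.
move=> mx; split=> [Rx|[_ cx]].
  by split=> // y /mE[u <-]; rewrite dR // Rx mulmx0 (lin0 ld).
apply: (frame_mx_eq fd (lie_linearr x) (shm mx)) => u.
by rewrite cx // mulmx0 (lin0 ld).
Qed.

(** Otherwise the Killing radical meets a complement of the center and contains a minimal ideal
    there; it is not central, so it is perfect, and its form is 0 against Cartan's criterion. *)
Lemma killing_radical x : m x -> (forall y, m y -> \tr (R x *m R y) = 0) ->
  center_of m x.
Proof.
move=> mx trx; have [rD _] := rR; have [_ bm'] := sm.
pose I := [set x | m x /\ forall y, m y -> \tr (R x *m R y) = 0].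
have iI : ideal_of m I.
  split.
  - split=> [|c u v [mu eu] [mv ev]].
      split=> [|y _]; first exact: subspace0.
      by rewrite (mx_rep0 hm rR) mul0mx mxtrace0.
    split=> [|y my]; first by apply: subspaceD => //; exact: subspaceZ.
    by rewrite rD // mulmxDl -scalemxAl mxtraceD mxtraceZ eu ?ev // mulr0 addr0.
  - by move=> u [].
  - move=> z u mz [mu eu]; split=> [|y my]; first exact: bm.
    by rewrite (trace_invariant rR) // eu ?oppr0 //; exact: bm.
have iC := center_ideal sm; have [_ rI] := rm.
have [J iJ [mE' CJ]] := rI _ iC.
have IJ0 : I `&` J = [set 0].
  apply: contrapT => IJ.
  have [L mL LIJ] := minimal_ideal_ex fm (idealI iI iJ) IJ.
  have [[hL Lm bL] L0 _] := mL.
  have LC y : L y -> center_of m y -> y = 0.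
    by move=> /LIJ[_ Jy] Cy; have : (center_of m `&` J) y by []; rewrite CJ.
  have [Lc|pL] := minimal_ideal_cases rm mL.
    apply: L0; rewrite eqEsubset; split=> [y Ly|_ ->]; last exact: subspace0.
    by apply: LC => //; exact: Lc.
  apply: (cartan_criterion fm rm ch mL pL rR) => [y Ly Ry|y z Ly Lz].
    by apply: LC => //; apply/ad_mx0 => //; exact: Lm.
  by have [[_ ey] _] := LIJ _ Ly; apply: ey; exact: Lm.
have := mx; rewrite {1}mE' => -[z Cz [b Jb zb]].
have [_ Jm _] := iJ; have mb := Jm _ Jb; have [mz _] := Cz.
suff b0 : b = 0 by rewrite -zb b0 addr0.
have : (I `&` J) b; last by rewrite IJ0.
split=> //; split=> // y my; have -> : R b = R x.
  by rewrite -zb (mx_repD rR) // (ad_mx0 mz).2 // add0r.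
exact: trx.
Qed.

Variable x : g.
Hypothesis hx : h x.
Let sh : subalgebra h. Proof. by case: ch. Qed.
Let hh : subspace h. Proof. by case: sh. Qed.
Let hsm : h `<=` m. Proof. by case: ch. Qed.
Let mx : m x. Proof. exact: hsm. Qed.

Let q := projT1 (cid (jordan_parts (R x))).
Let Sx := horner_mx (R x) q.
Let S := pop (lie x) q.
Let N v := lie x v - S v.
Let p := char_poly (R x).

Let lS : linear S. Proof. exact: pop_linear (lie_linearr x). Qed.
Let lN : linear N.
Proof.
by move=> c u v; rewrite /N lS lie_linearr scalerBr opprD addrACA.
Qed.

Let dS u : S (d u) = d (u *m Sx).
Proof. by rewrite /S (pop_frame _ _ fd (lie_linearr x) (shm mx)) pop_mulmx. Qed.

Let dN u : N (d u) = d (u *m (R x - Sx)).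
Proof. by rewrite /N dS dR // mulmxBr (linB ld). Qed.

Let mS : stable S m. Proof. by move=> v mv;
  exact: (stable_pop q hm (shm mx)). Qed.
Let mN : stable N m.
Proof. by move=> v mv; apply: subspaceB => //; [exact: bm|exact: mS]. Qed.

Let pm v : m v -> pop (lie x) p v = 0.
Proof.
move=> /mE[u <-]; rewrite (pop_frame _ _ fd (lie_linearr x) (shm mx)).
by rewrite char_poly_pop (lin0 ld).
Qed.

Let geig_d T X a u : (forall v, T (d v) = d (v *m X)) ->
  geig T a (d u) <-> geig (fun v => v *m X) a u.
Proof.
move=> TX; have it k : iter k (fun w => T w - a *: w) (d u) =
    d (iter k (fun v => v *m X - a *: v) u).
  by elim: k => //= k ->; rewrite TX (linB ld) (linZ ld).
split=> -[k ku]; exists k; last by rewrite it ku (lin0 ld).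
by have [_ id _] := fd; apply: id; rewrite -it ku (lin0 ld).
Qed.

Let Sg a v : m v -> geig (lie x) a v -> S v = a *: v.
Proof.
move=> /mE[u <-] /(geig_d _ _ (fun v => dR v mx)) gu; rewrite dS.
by rewrite /Sx /q; case: cid => r /= [rS _]; rewrite (rS a) // (linZ ld).
Qed.

Let Ng v : m v -> geig N 0 v.
Proof.
move=> /mE[u <-]; apply/(geig_d _ _ dN).
by rewrite /Sx /q; case: cid => r /= [].
Qed.

(** The semisimple part of a derivation is a derivation, because brackets add the eigenvalues of
    generalized eigenvectors. *)
Let der_S a b : m a -> m b -> S (lie a b) = lie (S a) b + lie a (S b).
Proof.
move=> ma mb.
have hC (F G : g -> g) : linear F -> linear G -> subspace [set a | F a = G a].
  move=> lF lG; split=> [|c u v /= eu ev]; first by rewrite /= !lin0.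
  by rewrite /= lF lG eu ev.
suff : [set a | S (lie a b) = lie (S a) b + lie a (S b)] a by [].
apply: (geig_span (lie_linearr x) (char_poly_neq0 (R x)) (pm ma)).
  apply: hC; first by move=> c u v; rewrite lie_linearl lS.
  by move=> c u v; rewrite lS !lie_linearl scalerDr addrACA.
move=> r l; have := stable_pop r hm (shm mx) ma.
move: (pop _ r a) => {ma}{}a ma ga.
suff : [set b | S (lie a b) = lie (S a) b + lie a (S b)] b by [].
apply: (geig_span (lie_linearr x) (char_poly_neq0 (R x)) (pm mb)).
  apply: hC; first by move=> c u v; rewrite lie_linearr lS.
  by move=> c u v; rewrite lS !lie_linearr scalerDr addrACA.
move=> r' l'; have := stable_pop r' hm (shm mx) mb.
move: (pop _ r' b) => {mb}{}b mb gb /=.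
rewrite (Sg ma ga) (Sg mb gb) lieZl lieZr -scalerDl; apply: Sg; first exact: bm.
apply: (@geig_bilin _ _ _ _ (@lie _ g) m m (lie x) (lie x)) => //.
- exact: shm.
- exact: shm.
- by move=> v c y z _ _; exact: lie_linearl.
- by move=> v c y z _ _; exact: lie_linearr.
- exact: lie_linearr.
- by move=> y z _ _; exact: lie_der.
Qed.

Let der_N a b : m a -> m b -> N (lie a b) = lie (N a) b + lie a (N b).
Proof.
move=> ma mb; rewrite /N der_S // lie_der.
rewrite (linB (lie_linearr a)) (linB (lie_linearl b)).
by rewrite opprD addrACA.
Qed.

Let N_center z : center_of m z -> N z = 0.
Proof.
move=> [mz cz]; have xz : lie x z = 0 by rewrite lieC cz ?oppr0.
by rewrite /N xz (@Sg 0) ?scale0r ?subr0 //; exists 1;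
  rewrite /= xz scale0r subr0.
Qed.

Let RE (v : 'rV_n.+1) : R (d v) = \sum_i v 0 i *: R (d (delta_mx 0 i)).
Proof.
rewrite {1}[v]row_sum_delta (lin_sum ld) (mx_rep_sum hm rR) => [|i //].
by apply: eq_bigr => i _; rewrite (linZ ld) (mx_repZ hm rR).
Qed.

(** The functional z |-> tr (N ad z) is represented by some [y] through the Killing form. The
    derivation [D = N - ad y] then maps into the Killing radical, i.e. the center, so it kills all
    brackets; it kills the center as well, hence is 0. *)
Lemma nilpotent_part_inner : exists2 y, m y & forall z, m z -> N z = lie y z.
Proof.
have [rD rM] := rR; pose Nx := R x - Sx; pose E i := R (d (delta_mx 0 i)).
pose B := \matrix_(i, j) \tr (E i *m E j).
pose phi : 'rV_n.+1 := \row_j \tr (Nx *m E j).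
have trE X v : \tr (X *m R (d v)) = \sum_i v 0 i * \tr (X *m E i).
  rewrite RE mulmx_sumr linear_sum /=; apply: eq_bigr => i _.
  by rewrite -scalemxAr mxtraceZ.
(* Solvability of the linear system for [y]: a vector annihilated by the Gram matrix [B] is central,
   so its [R] is 0 and [phi] annihilates it too. *)
have : (phi <= B)%MS.
  rewrite submxE; apply/eqP/matrixP => i j; rewrite [RHS]mxE ord1 {i}.
  pose c := col j (cokermx B).
  have Bc : B *m c = 0 by rewrite /c colE mulmxA mulmx_coker mul0mx.
  have cc : center_of m (d c^T).
    apply: killing_radical => // y /mE[u <-].
    rewrite trE big1 // => k _; rewrite mxtrace_mulC trE.
    have /matrixP/(_ k 0) := Bc; rewrite !mxE => Bck.
    rewrite [X in _ * X](_ : _ = 0) ?mulr0 // -[RHS]Bck; apply: eq_bigr => i _.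
    by rewrite [c^T _ _]mxE [B _ _]mxE mulrC.
  transitivity (\tr (Nx *m R (d c^T))); last first.
    by rewrite (ad_mx0 (md _)).2 // mulmx0 mxtrace0.
  rewrite trE mxE; apply: eq_bigr => i _.
  by rewrite !mxE mulrC.
move=> /submxP[u uB]; pose y := d u; have my : m y := md u.
have kap z : m z -> \tr (R y *m R z) = \tr (Nx *m R z).
  move=> /mE[v <-]; rewrite !trE; apply: eq_bigr => i _; congr (_ * _).
  have /rowP/(_ i) := uB; rewrite !mxE => ->.
  rewrite mxtrace_mulC trE; apply: eq_bigr => j _.
  by rewrite [B _ _]mxE mxtrace_mulC.
pose D z := N z - lie y z; have lD : linear D.
  by move=> c a b; rewrite /D lN lie_linearr opprD addrACA -scalerBr.
pose Dx := Nx - R y.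
have dD v : D (d v) = d (v *m Dx) by rewrite /D dN dR // [in RHS]mulmxBr (linB
  ld).
have mD : stable D m by move=> z mz; apply: subspaceB => //;
  [exact: mN|exact: bm].
have der_D a b : m a -> m b -> D (lie a b) = lie (D a) b + lie a (D b).
  move=> ma mb.
  have -> : lie (D a) b = lie (N a) b - lie (lie y a) b.
    exact: linB (lie_linearl b) _ _.
  have -> : lie a (D b) = lie a (N b) - lie a (lie y b).
    exact: linB (lie_linearr a) _ _.
  by rewrite /D der_N // (lie_der y) opprD addrACA.
have RDz z : m z -> R (D z) = R z *m Dx - Dx *m R z.
  move=> mz; apply: (frame_mx_eq fd (lie_linearr _) (shm (mD _ mz))) => v.
  rewrite mulmxBr (linB ld) !mulmxA -dD -dR // -dR // -dD.
  by rewrite der_D // addrK.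
have DC z : m z -> center_of m (D z).
  move=> mz; apply: killing_radical; first exact: mD.
  move=> z' mz'; rewrite RDz // mulmxBl linearB /= mxtrace_mulC mulmxA.
  rewrite -[Dx *m _ *m _]mulmxA [\tr (_ *m Dx)]mxtrace_mulC.
  rewrite -linearB /= -mulmxBr -rM // /Dx mulmxBl linearB /= kap ?subrr //.
  exact: bm.
have D0 z : m z -> D z = 0.
  move=> /reductive_center_derived[a [b [ca Db ->]]]; rewrite (linD lD).
  have -> : D a = 0.
    have [ma za] := ca; rewrite /D N_center // lieC za // oppr0 subr0 //.
  have : lie_set m m `<=` [set b | D b = 0].
    apply: lie_set_sub.
      split=> [|c u' v /= e1 e2]; first by rewrite /= (lin0 lD).
      by rewrite /= lD e1 e2 scaler0 addr0.
    move=> s t ms mt /=; rewrite der_D //.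
    have [_ ->] := DC _ ms; rewrite // add0r lieC.
    by have [_ ->] := DC _ mt; rewrite ?oppr0.
  by move=> /(_ _ Db) /= ->; rewrite addr0.
exists y => // z mz; apply/eqP; rewrite -subr_eq0; exact/eqP/D0.
Qed.

(** On [h] the trace vanishes because [ad y ad z] is nilpotent. A minimal [h]-stable subspace not
    orthogonal to [y] has no part in a nonzero generalized eigenspace of any [z] in [h], by
    invariance of the form, so it lies in [h] by [cartan_engel]. *)
Lemma cartan_killing0 y : h y -> (forall v, m v -> geig (lie y) 0 v) ->
  forall z, m z -> \tr (R y *m R z) = 0.
Proof.
move=> hy ny; have [_ _ nh hN] := ch; have my := hsm hy.
have [rD rM] := rR.
have shh : rstable h (@lie _ g) m by move=> z hz; apply: shm; exact: hsm.
have geig0 (z v : g) : geig (lie z) 0 v <-> exists k, iter k (lie z) v = 0.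
  have e k : iter k (fun u => lie z u - 0 *: u) v = iter k (lie z) v.
    by elim: k => //= k ->; rewrite scale0r subr0.
  by split=> -[k kv]; exists k; rewrite -kv e.
have nil_h u v : h u -> h v -> geig (lie u) 0 v.
  move=> hu hv; apply/geig0; have [k kn] := nh; exists k.
  suff : lower_central h k (iter k (lie u) v) by rewrite kn.
  by elim: (k) => //= j IH; exact: lie_setP.
have kh z : h z -> \tr (R y *m R z) = 0.
  move=> hz; rewrite mxtrace_mulC; apply: nilpotent_mxtrace => u.
  have [k ku] : exists k, iter k (lie y \o lie z) (d u) = 0.
    apply: (nilpotent_mul sh nh (lie_rep_ad h) fm shh hy hz) => // v mv.
    by apply/geig0/ny.
  apply/(geig_d (T := lie y \o lie z)); last first.
    exists k; rewrite -ku; apply: eq_iter => v; by rewrite scale0r subr0.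
  by move=> v; rewrite /= dR ?dR ?mulmxA //; exact: hsm.
move=> z0 mz0; apply: contrapT => kz0.
have [A [hA Am [sA [a Aa ka]] Amin]] := @min_subspace _ _ m
  (fun A => rstable h (@lie _ g) A /\ exists2 a, A a & \tr (R y *m R a) <> 0) fm
  (conj shh (ex_intro2 _ _ z0 mz0 kz0)).
suff Ah : A `<=` h by apply: ka; apply: kh; exact: Ah.
apply: (cartan_engel fm ch hA Am sA) => z b hz Ab; apply/geig0.
have mz := hsm hz.
suff AE : A `&` geig (lie z) 0 = A by move: Ab; rewrite -AE => -[].
apply: Amin.
- exact: subspaceI (subspace_geig _ (lie_linearr z)).
- by move=> v [].
split=> [u hu v [Av gv]|].
  split; first exact: sA.
  rewrite -[0]addr0.
  apply: (@geig_bilin _ _ _ _ (@lie _ g) h A (lie z) (lie z)) => //.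
  - by move=> w hw; have [_ bh] := sh; exact: bh.
  - exact: sA.
  - by move=> w c s t _ _; exact: lie_linearl.
  - by move=> w c s t _ _; exact: lie_linearr.
  - exact: lie_linearr.
  - by move=> s t _ _; exact: lie_der.
  - exact: nil_h.
apply: contrapT => nA; apply: ka.
have fA := finite_dim_sub fm hA Am.
have [r r0 pA] := fin_pop (lie_linearr z) fA (sA _ hz).
pose C := [set v | m v /\ \tr (R y *m R v) = 0]; suff : C a by case.
apply: (geig_span (lie_linearr z) r0 (pA _ Aa)).
  split=> [|c u v [mu eu] [mv ev]].
    by split; [exact: subspace0|rewrite (mx_rep0 hm rR) mulmx0 mxtrace0].
  split; first by apply: subspaceD => //; exact: subspaceZ.
  by rewrite rD // mulmxDr -scalemxAr mxtraceD mxtraceZ eu ev mulr0 addr0.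
move=> s l; have := stable_pop s hA (sA _ hz) Aa.
move: (pop _ s a) => {Aa}{}a Aa ga; split; first exact: Am.
have [l0|l0] := eqVneq l 0.
  apply: contrapT => ka; apply: nA; exists a => //; split=> //.
  by rewrite -l0.
have ma := Am _ Aa.
have : geig (fun _ : K^o => 0 : K^o) (0 + l) (\tr (R y *m R a) : K^o).
  apply: (@geig_bilin _ g g K^o (fun u v => \tr (R u *m R v)) m m (lie z) (lie
    z)) => //.
  - exact: shm.
  - exact: shm.
  - by move=> v c s' t ms mt;
    rewrite rD // mulmxDl -scalemxAl mxtraceD mxtraceZ.
  - by move=> v c s' t ms mt;
    rewrite rD // mulmxDr -scalemxAr mxtraceD mxtraceZ.
  - by move=> c s' t; rewrite scaler0 addr0.
  - by move=> s' t ms mt; rewrite (trace_invariant rR) // addNr.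
  - exact: nil_h.
rewrite add0r => gk; apply: (geig_neq _ gk (c := 0)).
- by move=> c s' t; rewrite scaler0 addr0.
- by rewrite scale0r.
- by rewrite eq_sym.
Qed.

(** The nilpotent part of [lie x] is [lie y]. As a polynomial in [lie x] it preserves [h], so [y]
    normalizes [h] and lies in it; [y] is then Killing-orthogonal to [m], hence central, and the
    nilpotent part is 0. *)
Lemma cartan_ldiag_frame v : m v -> ldiag (lie x) v.
Proof.
have [y my Ny] := nilpotent_part_inner.
have hy : h y.
  have [_ _ _ hN] := ch; rewrite -hN; split=> // z hz; rewrite -Ny;
    last exact: hsm.
  have sx : stable (lie x) h by move=> u hu; have [_ bh] := sh; exact: bh.
  by apply: subspaceB => //; [exact: sx|exact: (stable_pop q hh sx)].
have ny u : m u -> geig (lie y) 0 u.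
  move=> mu; have [k ku] := Ng mu; exists k; rewrite -ku.
  elim: k u mu {ku} => // k IH u mu; rewrite !iterSr Ny // IH // scale0r subr0.
  exact: bm.
have [_ cy] := killing_radical my (cartan_killing0 hy ny).
move=> mv; apply: (geig_ldiag (lie_linearr x) (char_poly_neq0 (R x)) (pm mv)).
move=> r l; have := stable_pop r hm (shm mx) mv.
move: (pop _ r v) => {mv}{}v mv gv; rewrite -(Sg mv gv).
by apply/eqP; rewrite -subr_eq0; apply/eqP; rewrite -[LHS]/(N v) Ny // cy.
Qed.

End Frame.

Lemma cartan_ldiag x v : h x -> m v -> ldiag (lie x) v.
Proof.
move=> hx; have [[|n] [d fd]] := finite_dim_frame fm; last first.
  exact: (cartan_ldiag_frame fd hx).
have [ld _ mE] := fd; rewrite mE => -[u _ <-].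
rewrite thinmx0 (lin0 ld); apply: subspace0;
  exact: subspace_ldiag (lie_linearr x).
Qed.

End CartanSemisimple.

Lemma finite_dim_mx (K : fieldType) n p : finite_dim [set: 'M[K]_(n, p)].
Proof.
apply: (@frame_finite_dim _ _ _ (@vec_mx K n p)); split.
- exact: linearP.
- exact: can_inj vec_mxK.
- by rewrite eqEsubset; split=> // A _; exists (mxvec A); rewrite ?mxvecK.
Qed.

Section SemisimpleExtension.
Variables (K : numClosedFieldType) (g : lieAlgType K) (l m hl hm : set g).
Hypotheses (fl : finite_dim l) (rl : reductive l) (cl : cartan_subalgebra l hl).
Hypotheses (fm : finite_dim m) (rm : reductive m) (cm : cartan_subalgebra m hm).
Hypotheses (lm : l `<=` m) (hlm : hl `<=` hm).

(* The nilpotent part N of ad x on m commutes with ad l, so T |-> tr (N T) is *)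
(* an l-invariant functional on matrices; it kills the T commuting with ad x. *)
Lemma ldiag_extend x : l x -> (forall v, l v -> ldiag (lie x) v) ->
  forall v, m v -> ldiag (lie x) v.
Proof.
move=> lx dx v mv; have [sl _] := rl; have [sm _] := rm.
have [hsl bl] := sl; have [hsm bm] := sm.
have [[|n] [d fd]] := finite_dim_frame fm; have [ld id mE] := fd.
  move: mv; rewrite mE => -[u _ <-]; rewrite thinmx0 (lin0 ld).
  by apply: subspace0; exact: subspace_ldiag (lie_linearr x).
have shm y : m y -> stable (lie y) m by move=> my z; exact: bm.
pose R y := frame_mx d (lie y).
have rRm : mx_rep m R := frame_mx_rep sm (lie_rep_ad m) fd shm.
have [rD rM] := rRm; have md u : m (d u) by rewrite mE; exists u.
have rR : mx_rep l R.
  by split=> [a y z /lm my /lm mz|y z /lm my /lm mz]; [exact: rD|exact: rM].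
have dR y u : m y -> lie y (d u) = d (u *m R y).
  by move=> my; rewrite (frame_mxE _ fd (lie_linearr y) (shm y my)).
pose X := R x; have lX := @mulmxr_linear K 1 _ X; have mx := lm lx.
have [q [Sg Ng]] := jordan_parts X; pose S := horner_mx X q; pose N := X - S.
(* If [[x, y] = b y], then both [X] and its semisimple part [S] have commutator [b *: R y] with
   [R y], so [N = X - S] commutes with it; such [y] span [l]. *)
have NR y : l y -> N *m R y = R y *m N.
  move=> ly; pose C := [set y | l y /\ N *m R y = R y *m N]; suff : C y by case.
  apply: (eig_span (lie_linearr x) (dx y ly)).
    split=> [|c u u' [lu eu] [lu' eu']].
      by split; [exact: subspace0|rewrite (mx_rep0 hsl rR) mulmx0 mul0mx].
    split; first by apply: subspaceD => //; exact: subspaceZ.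
    by rewrite (rD _ _ _ (lm lu) (lm lu')) mulmxDr [in RHS]mulmxDl -scalemxAr
      -scalemxAl eu eu'.
  move=> r b; have := stable_pop r hsl (fun z (lz : l z) => bl _ _ lx lz) ly.
  move: (pop _ r y) => {ly}{}y ly yb; split=> //.
  have RX : R y *m X - X *m R y = b *: R y.
    by rewrite -rM ?yb ?(mx_repZ hsl rR) //; exact: lm.
  have RS : R y *m S - S *m R y = b *: R y.
    apply: mulmx_eq_rows => u.
    pose D := [set u : 'rV_n.+1 | u *m (R y *m S - S *m R y) = u *m (b *: R y)].
    suff : D u by [].
    apply: (geig_span lX (char_poly_neq0 X) (char_poly_pop X u)).
      split=> [|c u1 u2]; first by rewrite /D /= !mul0mx.
      by rewrite /D /= !mulmxDl -!scalemxAl => -> ->.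
    move=> r' a; move: (pop _ r' u) => {}u gu; rewrite /D /=.
    have gub := geig_mx_rep hsl rR sl lx ly gu (geig_eig yb).
    rewrite mulmxBr !mulmxA (Sg _ _ gub) (Sg _ _ gu) -scalemxAl -scalerBl.
    by rewrite addrC addKr -scalemxAr.
  have XR : X *m R y = R y *m X - b *: R y by rewrite -RX subKr.
  have SR : S *m R y = R y *m S - b *: R y by rewrite -RS subKr.
  by rewrite /N mulmxBl mulmxBr XR SR opprB addrA subrK.
pose rho y (T : 'M[K]_n.+1) := T *m R y - R y *m T.
pose f (T : 'M[K]_n.+1) := \tr (N *m T).
have rep : lie_rep l rho.
  split=> [y _ a T T'|a y z T ly lz|y z T ly lz]; rewrite /rho.
  - rewrite mulmxDl mulmxDr -scalemxAl -scalemxAr scalerBr.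
    by rewrite opprD addrACA.
  - rewrite (rD _ _ _ (lm ly) (lm lz)) mulmxDl mulmxDr -scalemxAl -scalemxAr.
    by rewrite scalerBr opprD addrACA.
  - rewrite (rM _ _ (lm ly) (lm lz)) !(mulmxBl, mulmxBr) !mulmxA !opprB !addrA.
    by rewrite [RHS](ACl (1*8*3*6*2*5*4*7)) /= !subrK.
have lf a T T' : f (a *: T + T') = a * f T + f T'.
  by rewrite /f mulmxDr -scalemxAr mxtraceD mxtraceZ.
have f0 T : f T = 0.
  apply: (invariant_functional0 fl rl cl rep (@finite_dim_mx _ _ _) _ lf) => //.
  - move=> y {}T ly _; rewrite /f /rho mulmxBr linearB /= !mulmxA NR //.
    by rewrite -[R y *m N *m T]mulmxA [\tr (R y *m _)]mxtrace_mulC subrr.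
  (* An invariant [T] commutes with [X], hence with [N], and [N T] is nilpotent. *)
  - move=> {}T _ cT; apply: nilpotent_mxtrace => u.
    have TN : T *m N = N *m T.
      have TX : T *m X = X *m T by apply/eqP; rewrite -subr_eq0 [_ - _]cT.
      rewrite /N mulmxBl mulmxBr TX; congr (_ - _).
      exact: comm_mx_horner.
    have [k ku] := Ng u; exists k.
    have -> : iter k (fun v : 'rV_n.+1 => v *m (N *m T) - 0 *: v) u =
        iter k (fun v => v *m N - 0 *: v) u *m (T ^+ k).
      elim: (k) => [|j IH]; first by rewrite expr0 mulmx1.
      have cj : N *m T ^+ j = T ^+ j *m N := commrX j (esym TN).
      rewrite !iterS IH !scale0r !subr0 exprSr -[T ^+ j * T]/(T ^+ j *m T).
      by rewrite !mulmxA -[_ *m T ^+ j *m N]mulmxA -cj !mulmxA.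
    by rewrite ku mul0mx.
  (* The center of [l] lies in [hl], hence in [hm], and is diagonalizable on [m]; so [T] preserves
     the eigenspaces of [R z] and commutes with it. *)
  - move=> z {}T cz _ gT; have lz := cz.1; have mz := lm lz.
    have dz u a : geig (fun v : 'rV_n.+1 => v *m R z) a u -> u *m R z = a *: u.
      move=> gu; apply: id; rewrite -dR // (linZ ld).
      apply: ldiag_geig; first exact: lie_linearr.
        apply: (cartan_ldiag fm rm cm) => //.
        exact/hlm/(center_cartan cl).
      have [k ku] := gu; exists k.
      have -> : iter k (fun w => lie z w - a *: w) (d u) =
          d (iter k (fun v => v *m R z - a *: v) u).
        by elim: (k) => //= j ->; rewrite dR // (linB ld) (linZ ld).
      by rewrite ku (lin0 ld).
    apply: mulmx_eq_rows => u; rewrite mulmx0.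
    pose D := [set u : 'rV_n.+1 | u *m rho z T = 0]; suff : D u by [].
    have lz' := @mulmxr_linear K 1 _ (R z).
    apply: (geig_span lz' (char_poly_neq0 (R z)) (char_poly_pop (R z) u)).
      split=> [|c u1 u2]; first by rewrite /D /= !mul0mx.
      by rewrite /D /= mulmxDl -scalemxAl => -> ->; rewrite scaler0 addr0.
    move=> r a; move: (pop _ r u) => {}u gu; rewrite /D /=.
    have guT : geig (fun v : 'rV_n.+1 => v *m R z) (a + 0) (u *m T).
      apply: (@geig_bilin _ _ _ _ (fun (u : 'rV_n.+1) T => u *m T) setT setT
        (fun u => u *m R z) (rho z)) => //.
      - by move=> B c y y' _ _; rewrite mulmxDl -scalemxAl.
      - by move=> B c y y' _ _; rewrite mulmxDr -scalemxAr.
      - by move=> y B _ _; rewrite /rho mulmxBr !mulmxA addrC subrK.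
    rewrite /rho mulmxBr !mulmxA (dz _ _ guT) (dz _ _ gu) addr0 -scalemxAl.
    exact: subrr.
have N0 : N = 0.
  apply/matrixP => i j; rewrite [RHS]mxE.
  have := f0 (delta_mx j i); rewrite /f mxtrace_mulC /mxtrace.
  rewrite (bigD1 j) //= big1 => [|k kj].
    rewrite addr0 mxE (bigD1 i) //= big1 => [|k ki].
      by rewrite mxE !eqxx mul1r addr0.
    by rewrite mxE (negPf ki) andbF mul0r.
  by rewrite mxE big1 // => k' _; rewrite mxE (negPf kj) mul0r.
have XS : X = S by apply/eqP; rewrite -subr_eq0 -/N N0.
have [p p0 pm] := fin_pop (lie_linearr x) fm (shm x mx).
apply: (geig_ldiag (lie_linearr x) p0 (pm _ mv)) => r a.
have := stable_pop r hsm (shm x mx) mv; move: (pop _ r v) => {mv}{}v.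
rewrite mE => -[u _ <-] [k ku]; rewrite dR // -/X XS (Sg a) ?(linZ ld) //.
exists k; apply: id; rewrite (lin0 ld) -ku.
by elim: (k) => //= j <-; rewrite dR // (linB ld) (linZ ld).
Qed.

End SemisimpleExtension.

(** * Toral subalgebras of root-reductive Lie algebras *)

Section RootReductive.
Variables (K : numClosedFieldType) (g : lieAlgType K) (G H : nat -> set g).
Hypothesis rrG : root_reductive G H.

Lemma root_reductive_mono i j : (i <= j)%N -> G i `<=` G j /\ H i `<=` H j.
Proof.
elim: j => [|j IH]; first by rewrite leqn0 => /eqP ->; split=> v.
rewrite leq_eqVlt ltnS => /orP[/eqP ->|/IH[Gij Hij]]; first by split=> v.
have [Gj _ _ _] := rr_inclusion rrG j.
split; first exact: subset_trans Gj.
by apply: subset_trans Hij _; rewrite (rr_cartanI rrG j) => x [].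
Qed.

Lemma semisimple_eltP x :
  semisimple_elt G x <-> forall v, ldiag (lie x) v.
Proof.
have inG v : exists i, G i v.
  have : (\bigcup_i G i) v by rewrite (rr_union rrG).
  by case=> i _ Giv; exists i.
have sG i y : G i y -> stable (lie y) (G i).
  by move=> Gy z; have [[_ b] _] := rr_reductive rrG i; exact: b.
split=> [[i [Gx ss]] v|dx].
  have [j Gv] := inG v; pose m := maxn i j.
  have [Gim Him] := root_reductive_mono (leq_maxl i j).
  have [Gjm _] := root_reductive_mono (leq_maxr i j).
  apply: (ldiag_extend (rr_finite_dim rrG i) (rr_reductive rrG i)
    (rr_cartan rrG i) (rr_finite_dim rrG m) (rr_reductive rrG m)
    (rr_cartan rrG m) Gim Him Gx); last exact: Gjm.
  exact: (semisimple_ldiag (lie_linearr x) (rr_finite_dim rrG i) (sG _ _ Gx)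
    ss).
have [i Gx] := inG x; exists i; split=> // A hA AG sA.
exact: (ldiag_semisimple (lie_linearr x) (rr_finite_dim rrG i) (sG _ _ Gx)).
Qed.

End RootReductive.

Section Toral.
Variables (K : numClosedFieldType) (g : lieAlgType K) (t : set g).
Hypotheses (st : subalgebra t) (dt : forall x v, t x -> ldiag (lie x) v).

(** If [[x, y] = l y], then [lie y] squared kills [x], so [lie y] kills [x] by diagonalizability;
    such [y] span t. *)
Lemma toral_abelian : abelian_set t.
Proof.
have [ht bt] := st; move=> x y tx ty.
suff : [set y | lie x y = 0] y by [].
apply: (eig_span (lie_linearr x) (dt y tx)).
  split=> [|c u v /= eu ev]; first exact: lie0r.
  by rewrite /= lieDr lieZr eu ev scaler0 addr0.
move=> q l; have := stable_pop q ht (fun z (tz : t z) => bt _ _ tx tz) ty.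
move: (pop _ q y) => {ty}{}y ty xy /=.
rewrite lieC (ldiag_geig (lie_linearr y) (dt x ty) (l := 0)) ?scale0r ?oppr0 //.
exists 2%N; rewrite /= !scale0r !subr0 [lie y x]lieC xy lieNr lieZr liexx.
by rewrite scaler0 oppr0.
Qed.

End Toral.

(** * The Lie algebra of a symplectic form *)

Section TensorRank.
Variables (K : fieldType) (V : lmodType K).
Implicit Types (x : V ⊗t V) (a b : V).

Lemma tensDl a a' b : (a + a') ⊗ b = a ⊗ b + a' ⊗ b.
Proof. by rewrite linearDl. Qed.
Lemma tensDr a b b' : a ⊗ (b + b') = a ⊗ b + a ⊗ b'.
Proof. by rewrite linearDr. Qed.
Lemma tensZl c a b : (c *: a) ⊗ b = c *: (a ⊗ b).
Proof. by rewrite linearZl_LR. Qed.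
Lemma tensZr c a b : a ⊗ (c *: b) = c *: (a ⊗ b).
Proof. by rewrite linearZr_LR. Qed.

Lemma tensNl a b : (- a) ⊗ b = - (a ⊗ b).
Proof. by rewrite -scaleN1r tensZl scaleN1r. Qed.
Lemma tensNr a b : a ⊗ (- b) = - (a ⊗ b).
Proof. by rewrite -scaleN1r tensZr scaleN1r. Qed.
Lemma tens_suml (I : Type) (r : seq I) (P : pred I) (F : I -> V) b :
  (\sum_(i <- r | P i) F i) ⊗ b = \sum_(i <- r | P i) F i ⊗ b.
Proof. by rewrite linear_sumlz. Qed.

Lemma not_lin_indep n (e : 'I_n -> V) : ~ lin_indep e ->
  exists c, exists2 j, \sum_(i < n) c i *: e i = 0 & c j != 0.
Proof.
move=> h; apply: contrapT => nh; apply: h => c ce i.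
by apply/eqP/negPn/negP => ci; apply: nh; exists c, i.
Qed.

Lemma tens_shorten n (a b : 'I_n -> V) : ~ lin_indep a ->
  (n.-1 < n)%N /\
  exists a' b' : 'I_n.-1 -> V, \sum_i a i ⊗ b i = \sum_i a' i ⊗ b' i.
Proof.
case: n a b => [|n] a b /not_lin_indep[c [j ca cj]]; first by case: j cj.
split; first exact: ltnSn.
exists (fun i => a (lift j i)), (fun i => b (lift j i) - (c (lift j i) / c j)
  *: b j).
have aj : a j = - \sum_(i < n) (c (lift j i) / c j) *: a (lift j i).
  apply: (scalerI cj); rewrite scalerN scaler_sumr; apply/eqP.
  rewrite -addr_eq0 -[X in _ == X]ca [X in _ == X](bigD1_ord j) //=.
  apply/eqP; congr (_ + _); apply: eq_bigr => i _.
  by rewrite scalerA mulrCA divff // mulr1.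
rewrite (bigD1_ord j) //= {1}aj tensNl tens_suml -sumrN -big_split /=.
apply: eq_bigr => i _; rewrite tensDr addrC; congr (_ + _).
by rewrite tensNr tensZl tensZr.
Qed.

(** In an expression of least length both families are independent, since a linear relation in
    either would allow shortening. *)
Lemma tens_rank x : exists n (a b : 'I_n -> V),
  [/\ x = \sum_i a i ⊗ b i, lin_indep a & lin_indep b].
Proof.
pose P n := `[< exists a b : 'I_n -> V, x = \sum_i a i ⊗ b i >].
have exP : exists n, P n.
  exists (size (repr x)); apply/asboolP.
  exists (fun i => (nth 0 (repr x) i).1), (fun i => (nth 0 (repr x) i).2).
  by rewrite {1}[x]tensorE (big_nth 0) big_mkord.
have [n /asboolP[a [b xE]] nmin] := ex_minnP exP.
exists n, a, b; split=> //; apply: contrapT.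
  move=> /(tens_shorten b)[n' [a' [b' E]]]; move: n'; rewrite ltnNge => /negP;
    apply.
  by apply: nmin; apply/asboolP; exists a', b'; rewrite xE E.
move=> /(tens_shorten a)[n' [b' [a' E]]]; move: n'; rewrite ltnNge => /negP;
  apply.
apply: nmin; apply/asboolP; exists a', b'; rewrite xE.
have := congr1 (@swap K V) E; rewrite !linear_sum /=.
by under eq_bigr do rewrite swap_tens; move=> ->; apply: eq_bigr => i _;
  rewrite swap_tens.
Qed.

End TensorRank.

Section SymplecticForm.
Variables (K : numClosedFieldType) (V : lmodType K) (w : {skew_symmetric V}).
Hypothesis w_nondeg : nondegenerate_form w.
Implicit Types (a b u v : V) (x y : sp w).

Lemma skewC u v : w u v = - w v u.
Proof. by rewrite hermC /= expr1 mulN1r. Qed.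

Lemma skewDl u u' v : w (u + u') v = w u v + w u' v.
Proof. by rewrite linearDl. Qed.
Lemma skewDr u v v' : w u (v + v') = w u v + w u v'.
Proof. by rewrite linearDr. Qed.
Lemma skewZl c u v : w (c *: u) v = c * w u v.
Proof. by rewrite linearZl_LR. Qed.
Lemma skewZr c u v : w u (c *: v) = c * w u v.
Proof. by rewrite skewC skewZl (skewC u) mulrN. Qed.
Lemma skew0l v : w 0 v = 0.
Proof. by rewrite -[0 in LHS](scale0r 0) skewZl mul0r. Qed.
Lemma skew0r v : w v 0 = 0.
Proof. by rewrite skewC skew0l oppr0. Qed.

Lemma skewxx u : w u u = 0.
Proof. by have /eqP := skewC u u;
  rewrite -addr_eq0 -mulr2n mulrn_eq0 => /eqP. Qed.

Lemma form_neq0 u : u != 0 -> exists v, w v u = 1.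
Proof.
move=> u0; have [v vu] : exists v, w v u != 0.
  apply: contrapT => h; case/eqP: u0; apply: w_nondeg => v.
  rewrite skewC; apply/eqP; rewrite oppr_eq0; apply/negPn/negP => vu.
  by apply: h; exists v.
by exists ((w v u)^-1 *: v); rewrite skewZl mulVf.
Qed.

(** If the vectors [F v] did not fill the row space, a nontrivial combination of the [b i] would be
    orthogonal to all of [V]. *)
Lemma form_separates n (b : 'I_n -> V) j : lin_indep b ->
  exists v, forall i, w v (b i) = (i == j)%:R.
Proof.
move=> ib; pose F v : 'rV[K]_n := \row_i w v (b i).
have lF : linear F.
  by move=> c u v; apply/rowP => i; rewrite !mxE skewDl skewZl.
have [U UP] := subspace_rowspace (subspace_image lF (@subspaceT _ V)).
have fU : row_full U.
  rewrite -cokermx_eq0; apply/eqP/matrixP => i k; rewrite [RHS]mxE.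
  apply: (ib (fun i => cokermx U i k)); apply: w_nondeg => v.
  have : (F v <= U)%MS by apply/UP; exists v.
  rewrite submxE => /eqP/matrixP/(_ 0 k); rewrite !mxE => FU.
  rewrite skewC; apply/eqP; rewrite oppr_eq0; apply/eqP; rewrite -FU.
  have : forall r : seq 'I_n, w v (\sum_(i <- r) cokermx U i k *: b i) =
      \sum_(i <- r) F v 0 i * cokermx U i k.
    elim=> [|i' r IH]; first by rewrite !big_nil skew0r.
    by rewrite !big_cons skewDr skewZr IH [F v 0 _]mxE mulrC.
  by apply.
have /UP[v _ vE] : ((delta_mx 0 j : 'rV_n) <= U)%MS by rewrite submx_full.
exists v => i; have /rowP/(_ i) := vE; rewrite !mxE eqxx /= => ->.
by [].
Qed.

Lemma tens_act_sum (I : Type) (r : seq I) (a b : I -> V) u :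
  tens_act w (\sum_(i <- r) a i ⊗ b i) u = \sum_(i <- r) w u (b i) *: a i.
Proof.
rewrite (lin_sum (@tens_act_linearl _ _ w u)).
by apply: eq_bigr => i _; rewrite tens_act_tens.
Qed.

Lemma tens_act_faithful (x : V ⊗t V) : (forall u, tens_act w x u = 0) -> x = 0.
Proof.
have [n [a [b [-> ia ib]]]] := tens_rank x => h.
rewrite big1 // => i _; have [v vb] := form_separates i ib.
have := h v; rewrite tens_act_sum (bigD1 i) //= big1 => [|j ji].
  by rewrite vb eqxx scale1r addr0 => ->;
    rewrite -[0](scale0r 0) tensZl scale0r.
by rewrite vb (negPf ji) scale0r.
Qed.

Lemma sp_act_linear x : linear (sp_act w x).
Proof. exact: tens_act_linearr. Qed.

Lemma sp_act_linearl u : linear (fun x => sp_act w x u).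
Proof. by move=> c x y; rewrite /sp_act /= tens_act_linearl. Qed.

Lemma sp_act_lie x y u :
  sp_act w (lie x y) u = sp_act w x (sp_act w y u) - sp_act w y (sp_act w x u).
Proof.
rewrite /sp_act -!tens_mul_act.
by rewrite -(linB (@tens_act_linearl _ _ w u)).
Qed.

Lemma sp_act_faithful x y : (forall u, sp_act w x u = sp_act w y u) -> x = y.
Proof.
move=> xy; apply: val_inj; apply/eqP; rewrite -subr_eq0; apply/eqP.
apply: tens_act_faithful => u; rewrite (linB (@tens_act_linearl _ _ w u)).
by have := xy u; rewrite /sp_act => ->; rewrite subrr.
Qed.

Lemma sp_act_amp a b u : sp_act w (amp w a b) u = w u b *: a + w u a *: b.
Proof.
by rewrite /sp_act /= (linD (@tens_act_linearl _ _ w u)) !tens_act_tens.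
Qed.

Lemma ampC a b : amp w a b = amp w b a.
Proof. by apply: val_inj; rewrite /= addrC. Qed.

Lemma amp_linearl b : linear (fun a => amp w a b).
Proof.
move=> c a a'; apply: val_inj => /=.
by rewrite tensDl tensDr tensZl tensZr scalerDr addrACA.
Qed.

Lemma amp_linearr a : linear (amp w a).
Proof. by move=> c b b'; rewrite ![amp w a _]ampC amp_linearl. Qed.

(** In a shortest expression the left factors are values of [x] by [form_separates]; by symmetry so
    are the right ones, and [x] is half the sum of the [amp w (a i) (b i)]. *)
Lemma sp_amp_image x (A : set V) : subspace A ->
  (forall u, A (sp_act w x u)) -> amp_set w A A x.
Proof.
move=> hA xA; have [n [a [b [xE ia ib]]]] := tens_rank (sp_val x).
have Aa i : A (a i).
  have [v vb] := form_separates i ib; have := xA v.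
  rewrite /sp_act xE tens_act_sum (bigD1 i) //= big1 => [|j ji].
    by rewrite vb eqxx scale1r addr0.
  by rewrite vb (negPf ji) scale0r.
have sx : swap (sp_val x) = sp_val x.
  by apply/eqP; rewrite -sp_predE; exact: sp_valP.
have xE' : sp_val x = \sum_i b i ⊗ a i.
  by rewrite -sx xE linear_sum; apply: eq_bigr => i _; rewrite /= swap_tens.
have Ab i : A (b i).
  have [v va] := form_separates i ia; have := xA v.
  rewrite /sp_act xE' tens_act_sum (bigD1 i) //= big1 => [|j ji].
    by rewrite va eqxx scale1r addr0.
  by rewrite va (negPf ji) scale0r.
have -> : x = \sum_i 2^-1 *: amp w (a i) (b i).
  have lv : linear (fun x : sp w => sp_val x) by [].
  apply: val_inj; rewrite /= -scaler_sumr (linZ lv) (lin_sum lv) /=.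
  have : sp_val x + sp_val x = \sum_i (a i ⊗ b i + b i ⊗ a i).
    by rewrite {1}xE xE' -big_split.
  by move=> <-; rewrite -mulr2n -scaler_nat scalerA mulVf ?scale1r // pnatr_eq0.
have hs := subspace_span [set amp w a b | a in A & b in A].
apply: (subspace_sum hs) => i _; apply: (subspaceZ _ hs); apply: mem_span.
by exists (a i) => //; exists (b i).
Qed.

Lemma sp_amp_span x : amp_set w setT setT x.
Proof. by apply: sp_amp_image => //. Qed.

Lemma sp_skew x u v : w (sp_act w x u) v + w u (sp_act w x v) = 0.
Proof.
pose C := [set x | w (sp_act w x u) v + w u (sp_act w x v) = 0].
suff : amp_set w setT setT `<=` C by apply; exact: sp_amp_span.
apply: span_sub => [|_ [a _ [b _ <-]]].
  split=> [|c y z /= ey ez].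
    by rewrite /C /= !(lin0 (sp_act_linearl _)) skew0l skew0r addr0.
  rewrite /C /= !sp_act_linearl skewDl skewDr skewZl skewZr addrACA -mulrDr.
  by rewrite ey ez mulr0 addr0.
rewrite /C /= !sp_act_amp skewDl skewDr !skewZl !skewZr (skewC a v) (skewC b v).
by ring.
Qed.

Lemma lie_amp x a b :
  lie x (amp w a b) = amp w (sp_act w x a) b + amp w a (sp_act w x b).
Proof.
apply: sp_act_faithful => u;
  rewrite sp_act_lie (linD (sp_act_linearl u)) !sp_act_amp.
rewrite (linD (sp_act_linear x)) !(linZ (sp_act_linear x)).
have sk v : w (sp_act w x u) v = - w u (sp_act w x v).
  by apply/eqP; rewrite -addr_eq0 sp_skew.
rewrite !sk !scaleNr opprD !opprK !addrA [RHS](ACl (1*4*3*2)) /=.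
by [].
Qed.

Lemma sp_finite_image x :
  exists2 A : set V, finite_dim A & forall u, A (sp_act w x u).
Proof.
have [A fA sA] := finite_dim_span_seq [seq p.1 | p <- repr (sp_val x)].
exists A => // u; rewrite /sp_act tens_actE big_seq.
have hA := finite_dim_subspace fA.
apply: (subspace_sum hA) => p pr; apply: subspaceZ => //; apply: sA.
by apply/mapP; exists p.
Qed.

(** If <b,a> = 1, then a & a is an eigenvector of ad (a & b) for -2; polarization gives the other
    generators. *)
Lemma sp_perfect : lie_set [set: sp w] [set: sp w] = [set: sp w].
Proof.
rewrite eqEsubset; split=> // x _.
have hs : subspace (lie_set [set: sp w] [set: sp w]) by exact: subspace_span.
have sq a : lie_set [set: sp w] [set: sp w] (amp w a a).
  have [->|a0] := eqVneq a 0.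
    by rewrite (lin0 (amp_linearr 0)); exact: subspace0.
  have [b ba] := form_neq0 a0.
  have E : lie (amp w a b) (amp w a a) = (- 2) *: amp w a a.
    rewrite lie_amp sp_act_amp skewxx scale0r addr0 (skewC a b) ba scaleN1r.
    by rewrite (linN (amp_linearl a)) (linN (amp_linearr a)) scaleNr -opprD
      scaler_nat mulr2n.
  apply: (subspaceZN hs (c := - 2)); first by rewrite oppr_eq0 pnatr_eq0.
  by rewrite -E; exact: lie_setP.
suff : amp_set w setT setT `<=` lie_set [set: sp w] [set: sp w].
  by apply; exact: sp_amp_span.
apply: span_sub => // _ [a _ [b _ <-]].
have E : amp w (a + b) (a + b) - amp w a a - amp w b b = 2 *: amp w a b.
  rewrite (linD (amp_linearl _)) !(linD (amp_linearr _)) (ampC b a).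
  by rewrite scaler_nat mulr2n !addrA [LHS](ACl (2*3*1*5*4*6)) /= !addrK.
apply: (subspaceZN hs (c := 2)); first by rewrite pnatr_eq0.
by rewrite -E; apply: (subspaceB hs) => //; apply: (subspaceB hs).
Qed.

End SymplecticForm.

(** * Weights of toral subalgebras *)

Section WeightForm.
Variables (K : numClosedFieldType) (g : lieAlgType K) (V : lmodType K).
Variables (w : {skew_symmetric V}) (rho : g -> V -> V) (t : set g).
Hypothesis rho_skew : forall x u v, w (rho x u) v + w u (rho x v) = 0.

Lemma weight_geig a u x : weight_space rho t a u -> t x -> geig (rho x) (a x) u.
Proof. by move=> [i _ iu] tx; exists i; exact: iu. Qed.

(** [geig_bilin] for the form, with the zero operator on the scalars: a nonzero value requires
    [l + m = 0]. *)
Lemma form_geig x l m u v : geig (rho x) l u -> geig (rho x) m v ->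
  w u v <> 0 -> m = - l.
Proof.
move=> gu gv uv.
have : geig (fun _ : K^o => 0 : K^o) (l + m) (w u v : K^o).
  apply: (@geig_bilin _ V V K^o (fun u v => w u v) setT setT (rho x) (rho x))
    => //.
  - by move=> z c y y' _ _ /=; rewrite skewDl skewZl.
  - by move=> z c y y' _ _ /=; rewrite skewDr skewZr.
  - by move=> c y y'; rewrite scaler0 addr0.
have [lm _|lm guv] := eqVneq 0 (l + m).
  by apply/eqP; rewrite -addr_eq0 addrC -lm.
exfalso; apply: uv; apply: (geig_neq _ guv _ lm).
  by move=> c y y'; rewrite scaler0 addr0.
by rewrite scale0r.
Qed.

Lemma weight_form a b u v : dual t a -> dual t b ->
  weight_space rho t a u -> weight_space rho t b v -> w u v <> 0 -> b = - a.
Proof.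
move=> [_ da] [_ db] Vu Vv uv; apply/funext => x.
have [tx|ntx] := pselect (t x);
  last by rewrite db // -[RHS]/(- a x) da // oppr0.
exact: form_geig (weight_geig Vu tx) (weight_geig Vv tx) uv.
Qed.

Lemma dualN a : dual t a -> dual t (- a).
Proof.
move=> [da a0]; split=> [c u v tu tv|u /a0 e]; last first.
  by rewrite -[LHS]/(- a u) e oppr0.
by rewrite -[LHS]/(- a _) da // opprD -mulrN.
Qed.

End WeightForm.

(** * Ad-diagonalizable elements acting on V *)

Section Action.
Variables (K : numClosedFieldType) (V : lmodType K) (w : {skew_symmetric V}).
Hypothesis w_nondeg : nondegenerate_form w.
Variables (g : lieAlgType K) (iota : sp w -> g) (rho : g -> V -> V).
Hypotheses (iota_lin : linear iota) (rho_mod : is_module rho).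
Hypothesis rho_iota : forall x v, rho (iota x) v = sp_act w x v.
Hypothesis rho_skew : forall x u v, w (rho x u) v + w u (rho x v) = 0.
(** Equivariance of [iota] for the action on Sym^2(V): [lie_amp] provides it for sp(V) itself,
    [summand_lie_amp] for a summand. *)
Hypothesis lie_iota_amp : forall x a b,
  lie x (iota (amp w a b)) = iota (amp w (rho x a) b + amp w a (rho x b)).
Implicit Types (x z : g) (u v : V) (y : sp w).

Let rl x : linear (rho x). Proof. by case: rho_mod. Qed.
Let rx v : linear (rho ^~ v). Proof. by case: rho_mod. Qed.
Let rM x z v : rho (lie x z) v = rho x (rho z v) - rho z (rho x v).
Proof. by case: rho_mod. Qed.

Lemma iota_inj : injective iota.
Proof.
move=> x y xy; apply: (sp_act_faithful w_nondeg) => u.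
by rewrite -!rho_iota xy.
Qed.

Lemma subspace_range_iota : subspace (range iota).
Proof. exact: subspace_image. Qed.

Lemma lie_iota x y : range iota (lie x (iota y)).
Proof.
have hr := subspace_range_iota.
have : amp_set w setT setT `<=` [set y | range iota (lie x (iota y))].
  apply: span_sub => [|_ [a _ [b _ <-]]].
    have lT : linear (fun y => lie x (iota y)).
      by move=> c u v; rewrite iota_lin lie_linearr.
    exact: (subspace_preim lT hr).
  by rewrite /= lie_iota_amp; exists (amp w (rho x a) b + amp w a (rho x b)).
by apply; exact: sp_amp_span.
Qed.

Section LocallyDiagonal.
Variable x : g.
Hypothesis dx : forall z, ldiag (lie x) z.

(** The image of u & u is the line of [u]. Splitting [iota (amp w u u)] into [lie x]-eigenvectors
    gives operators of finite rank whose images are [x]-stable, so all their values are annihilated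
    by polynomials in [x]. *)
Lemma act_locally_finite u : exists2 p, p != 0 & pop (rho x) p u = 0.
Proof.
pose F : set V := [set u | exists2 p, p != 0 & pop (rho x) p u = 0].
have hF : subspace F.
  split=> [|c u1 u2 [p p0 pu] [q q0 qu]].
    by exists 1; rewrite ?pop1 // oner_neq0.
  exists (p * q); first by rewrite mulf_neq0.
  rewrite (pop_linear _ (rl x)) !popM // qu popMC // pu.
  by rewrite !(lin0 (pop_linear _ (rl x))) scaler0 addr0.
have [->|u0] := eqVneq u 0; first exact: subspace0 hF.
have [v vu] := form_neq0 w_nondeg u0; pose y := amp w u u.
have hr := subspace_range_iota.
have sr : stable (lie x) (range iota) by move=> _ [y' _ <-]; exact: lie_iota.
have : [set z | exists2 y, z = iota y & forall v, F (sp_act w y v)] (iota y).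
  apply: (eig_span (lie_linearr x) (dx (iota y))).
    split=> [|c _ _ [y1 -> F1] [y2 -> F2]].
      by exists 0 => [|v'];
        rewrite ?(lin0 iota_lin) // (lin0 (@sp_act_linearl _ _ w v'));
        exact: subspace0.
    exists (c *: y1 + y2) => [|v']; first by rewrite iota_lin.
    by rewrite sp_act_linearl; apply: subspaceD => //; exact: subspaceZ.
  move=> q l; have : range iota (pop (lie x) q (iota y)).
    by apply: stable_pop => //; exists y.
  case=> y' _ <- xy'; exists y' => // v'.
  have [A fA yA] := sp_finite_image y'.
  have hB : subspace (range (sp_act w y')).
    exact: (subspace_image (@sp_act_linear _ _ w y') (@subspaceT _ V)).
  have fB := finite_dim_sub fA hB (fun _ '(ex_intro2 u _ e) => eq_ind _ A (yA
    u) _ e).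
  have [|p p0 pB] := fin_pop (rl x) fB.
    move=> _ [u' _ <-]; exists (rho x u' + l *: u') => //.
    have := rM x (iota y') u'; rewrite xy' (linZ (rx u')) !rho_iota => E.
    by rewrite (linD (@sp_act_linear _ _ w y')) (linZ (@sp_act_linear _ _ w
      y')) E addrC subrK.
  by exists p => //; apply: pB; exists v'.
case=> y' /iota_inj <- /(_ v); rewrite sp_act_amp vu -scalerDl.
by apply: subspaceZN => //; rewrite -[1 + 1]/(2 : K) pnatr_eq0.
Qed.

(** u & u is a generalized, hence genuine, eigenvector of [lie x] for [2 l]. Evaluating the
    eigenvalue equation at [v] with <v,u> = 1 shows that [rho x u] is a multiple of [u]. *)
Lemma act_geig_eig l u : geig (rho x) l u -> rho x u = l *: u.
Proof.
move=> gu; have [->|u0] := eqVneq u 0; first by rewrite (lin0 (rl x)) scaler0.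
have [v vu] := form_neq0 w_nondeg u0.
have g2 : geig (lie x) (l + l) (iota (amp w u u)).
  apply: (@geig_bilin _ V V g (fun a b => iota (amp w a b)) setT setT
    (rho x) (rho x)) => //.
  - by move=> b c a a' _ _; rewrite amp_linearl iota_lin.
  - by move=> b c a a' _ _; rewrite amp_linearr iota_lin.
  - exact: lie_linearr.
  - by move=> a b _ _; rewrite lie_iota_amp (linD iota_lin).
have := ldiag_geig (lie_linearr x) (dx _) g2.
rewrite lie_iota_amp -(linZ iota_lin) => /iota_inj.
move=> /(congr1 (fun y => sp_act w y v)).
rewrite (linD (@sp_act_linearl _ _ w v)) (linZ (@sp_act_linearl _ _ w v))
  !sp_act_amp vu.
rewrite !scale1r => E; pose c := w v (rho x u).
have XC : rho x u + c *: u = (l + l) *: u.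
  apply: (@scalerI _ _ 2); first by rewrite pnatr_eq0.
  by rewrite !scaler_nat !mulr2n -scalerDr -E -/c [c *: u + _]addrC.
have Xu : rho x u = (l + l - c) *: u by rewrite scalerBl -XC addrK.
have [lc|lc] := eqVneq (l + l - c) l; first by rewrite Xu lc.
by have u00 := geig_neq (rl x) gu Xu lc; rewrite u00 eqxx in u0.
Qed.

Lemma act_ldiag u : ldiag (rho x) u.
Proof.
have [p p0 pu] := act_locally_finite u.
by apply: (geig_ldiag (rl x) p0 pu) => q l; exact: act_geig_eig.
Qed.

End LocallyDiagonal.

Section AmpDiagonal.
Variables u v : V.
Hypothesis uv : w u v != 0.
Let y := amp w u v.

(** [u] and [v] are eigenvectors for <u,v> and <v,u>, and the orthogonal complement of their plane
    is killed. *)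
Lemma amp_act_ldiag a : ldiag (sp_act w y) a.
Proof.
have ly := @sp_act_linear _ _ w y; have hd := subspace_ldiag ly.
have yu : sp_act w y u = w u v *: u by rewrite sp_act_amp skewxx scale0r addr0.
have yv : sp_act w y v = w v u *: v by rewrite sp_act_amp skewxx scale0r add0r.
pose a' := a - (w a v / w u v) *: u - (w a u / w v u) *: v.
have vu : w v u != 0 by rewrite skewC oppr_eq0.
have ya' : sp_act w y a' = 0 *: a'.
  have av : w a' v = 0.
    rewrite /a' -!scaleNr !skewDl !skewZl skewxx mulr0 addr0.
    by rewrite mulNr divfK // subrr.
  have au : w a' u = 0.
    rewrite /a' -!scaleNr !skewDl !skewZl skewxx mulr0 addr0.
    by rewrite mulNr divfK // subrr.
  by rewrite sp_act_amp av au !scale0r addr0.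
have -> : a = a' + (w a u / w v u) *: v + (w a v / w u v) *: u.
  by rewrite /a' !subrK.
have du := eig_ldiag ly yu; have dv := eig_ldiag ly yv.
apply: (subspaceD hd); last exact: subspaceZ.
by apply: (subspaceD hd); [exact: eig_ldiag ya'|exact: subspaceZ].
Qed.

(** On sp(V) the a & c with [a], [c] eigenvectors of [y] are eigenvectors of [D]. As [D] maps all of
    g into sp(V), only generalized eigenvectors outside sp(V) remain to be treated. *)
Lemma iota_amp_ldiag z : ldiag (lie (iota y)) z.
Proof.
set D := lie (iota y); have lD : linear D := lie_linearr _.
have hD := subspace_ldiag lD; have ly := @sp_act_linear _ _ w y.
have dI b : ldiag D (iota b).
  have : amp_set w setT setT `<=` [set b | ldiag D (iota b)].
    apply: span_sub => [|_ [a _ [c _ <-]]];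
      first exact: (subspace_preim iota_lin hD).
    suff : [set a | ldiag D (iota (amp w a c))] a by [].
    apply: (eig_span ly (amp_act_ldiag a)).
      have lf : linear (fun a => iota (amp w a c)).
        by move=> k s r; rewrite amp_linearl iota_lin.
      exact: (subspace_preim lf hD).
    move=> q l; move: (pop _ q a) => {}a ya.
    suff : [set c | ldiag D (iota (amp w a c))] c by [].
    apply: (eig_span ly (amp_act_ldiag c)).
      have lf : linear (fun c => iota (amp w a c)).
        by move=> k s r; rewrite amp_linearr iota_lin.
      exact: (subspace_preim lf hD).
    move=> q' m; move: (pop _ q' c) => {}c yc /=;
      apply: (@eig_ldiag _ _ _ (l + m)) => //.
    rewrite /D lie_iota_amp !rho_iota ya yc.
    rewrite (linZ (@amp_linearl _ _ w c)) (linZ (@amp_linearr _ _ w a))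
      -scalerDl.
    by rewrite (linZ iota_lin).
  by apply; exact: sp_amp_span.
have Dr z' : exists b, D z' = iota b.
  have [b _ E] := lie_iota z' y; exists (- b).
  by rewrite /D lieC -E (linN iota_lin).
have [b E] := Dr z; have [p p0 pb] := ldiag_pop (dI b).
have pz : pop D (p * 'X) z = 0 by rewrite pop_mulX E.
apply: (geig_ldiag lD _ pz); first by rewrite mulf_neq0 // polyX_eq0.
move=> q l; move: (pop D q z) => {E b p p0 pb pz}{}z gz.
have [b E] := Dr z; have gDz : geig D l (D z).
  rewrite -[D z](popX D); have hg := subspace_geig l lD.
  have [k kz] := gz; exists k; rewrite iter_pop // popMC // -iter_pop // kz.
  exact: lin0 (pop_linear _ lD).
have DDz : D (D z) = l *: D z by apply: ldiag_geig => //; rewrite E; exact: dI.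
have [l0|l0] := eqVneq l 0; last first.
  apply/eqP; rewrite -subr_eq0; apply/eqP.
  have ge : geig D l (D z - l *: z).
    apply: subspaceB; [exact: subspace_geig|exact: gDz|].
    by apply: subspaceZ => //; exact: subspace_geig.
  apply: (geig_neq lD ge (c := 0)); last by rewrite eq_sym.
  by rewrite (linB lD) (linZ lD) DDz subrr scale0r.
rewrite l0 scale0r; rewrite l0 scale0r in DDz.
(* Eigenvalue 0: [D z = iota b] with [b] commuting with [y]. On an eigenvector [a] of [y] for [m],
   [b a = (y - m) (z a)] is again an [m]-eigenvector, so [(y - m)] squared kills [z a], and
   diagonalizability of [y] gives [b a = 0]. *)
suff b0 : b = 0 by rewrite E b0 (lin0 iota_lin).
apply: (sp_act_faithful w_nondeg) => a;
  rewrite (lin0 (@sp_act_linearl _ _ w a)).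
have rb a' : sp_act w b a' = sp_act w y (rho z a') - rho z (sp_act w y a').
  by rewrite -!rho_iota -E rM.
suff : [set a | sp_act w b a = 0] a by [].
apply: (eig_span ly (amp_act_ldiag a)).
  exact: (subspace_preim (@sp_act_linear _ _ w b) (@subspace_set0 _ V)).
move=> q' m; move: (pop _ q' a) => {}a ya /=.
have rE : sp_act w b a = sp_act w y (rho z a) - m *: rho z a.
  by rewrite rb ya (linZ (rl z)).
have yb : sp_act w y (sp_act w b a) = m *: sp_act w b a.
  have : rho (D (D z)) a = 0 by rewrite DDz (lin0 (rx a)).
  rewrite rM E !rho_iota ya (linZ (@sp_act_linear _ _ w b)).
  by move/eqP; rewrite subr_eq0 => /eqP.
rewrite rE; apply/eqP; rewrite subr_eq0; apply/eqP.
apply: ldiag_geig => //; first exact: amp_act_ldiag.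
by exists 2%N; rewrite /= -rE yb subrr.
Qed.

End AmpDiagonal.

Section Torus.
Variable t : set g.
Hypotheses (st : subalgebra t) (dt : forall x z, t x -> ldiag (lie x) z).

Let ht : subspace t. Proof. by case: st. Qed.
Let abt : abelian_set t. Proof. exact: toral_abelian. Qed.
Let Vw := weight_space rho t.

Lemma weightP a u : Vw a u <-> forall x, t x -> rho x u = a x *: u.
Proof.
split=> [Vu x tx|h]; last by exists 1%N => // x tx; rewrite /= h // subrr.
by apply: act_geig_eig; [move=> z; exact: dt|exact: weight_geig Vu tx].
Qed.

Lemma subspace_weight a : subspace (Vw a).
Proof.
split=> [|c u v /weightP hu /weightP hv].
  by apply/weightP => x tx; rewrite (lin0 (rl x)) scaler0.
by apply/weightP => x tx; rewrite rl hu // hv // scalerDr !scalerA mulrC.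
Qed.

Definition weight_span : set V := span [set u | exists2 a, dual t a & Vw a u].

(** In a minimal stable counterexample [B] every [x] in t is scalar: an eigenspace of [x] is
    t-stable because t is abelian, so one not contained in the weight span is all of [B]. The
    scalars form a weight. *)
Lemma weight_decomposition A : finite_dim A -> rstable t rho A ->
  A `<=` weight_span.
Proof.
move=> fA sA; apply: contrapT => nA.
have hW : subspace weight_span by exact: subspace_span.
have [B [hB BA [sB nB] Bmin]] := @min_subspace _ _ A
  (fun B => rstable t rho B /\ ~ B `<=` weight_span) fA (conj sA nA).
have fB := finite_dim_sub fA hB BA.
have eigB x : t x -> exists l, forall u, B u -> rho x u = l *: u.
  move=> tx; apply: contrapT => nl; apply: nB => u Bu.
  apply: (eig_span (rl x) (act_ldiag (fun z => dt z tx) u) hW) => q l.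
  have := stable_pop q hB (sB x tx) Bu; move: (pop _ q u) => {Bu}{}u Bu xu.
  apply: contrapT => nu; apply: nl; exists l.
  suff BE : B `&` [set u | rho x u = l *: u] = B by move=> u';
    rewrite -BE => -[].
  apply: Bmin.
  - apply: subspaceI => //; split=> [|c u1 u2 /= e1 e2].
      by rewrite /= (lin0 (rl x)) scaler0.
    by rewrite /= rl e1 e2 scalerDr !scalerA mulrC.
  - by move=> ? [].
  split=> [z tz u' [Bu' xu']|sub]; last by apply: nu; apply: sub.
  split; first exact: sB.
  have := rM x z u'; rewrite abt // (lin0 (rx u')) => /esym/eqP.
  by rewrite subr_eq0 => /eqP /= ->; rewrite xu' (linZ (rl z)).
have [u Bu u0] : exists2 u, B u & u != 0.
  apply: contrapT => h; apply: nB => u Bu.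
  suff -> : u = 0 by exact: subspace0.
  by apply/eqP/negPn/negP => u0; apply: h; exists u.
(* The value 0 off t is what membership in [dual t] demands. *)
pose a x := if pselect (t x) is left tx then projT1 (cid (eigB x tx)) else 0.
have aP x u' : t x -> B u' -> rho x u' = a x *: u'.
  by move=> tx Bu'; rewrite /a; case: pselect => // tx'; case: cid => l /=;
    apply.
apply: nB => u' Bu'; apply: mem_span; exists a;
  last by apply/weightP => x /aP; apply.
split=> [c x z tx tz|x ntx]; last by rewrite /a; case: pselect.
apply/eqP; rewrite -subr_eq0;
  have : (a (c *: x + z) - (c * a x + a z)) *: u = 0.
  rewrite scalerBl scalerDl -scalerA -!aP //; last first.
    by apply: subspaceD => //; exact: subspaceZ.
  by rewrite rx subrr.
by move/eqP; rewrite scaler_eq0 (negPf u0) orbF.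
Qed.

Definition opposite_amps : set (sp w) :=
  [set y | exists a u v, [/\ dual t a, Vw a u, Vw (- a) v & y = amp w u v]].

Lemma weight_amp a b u v x : Vw a u -> Vw b v -> t x ->
  lie x (iota (amp w u v)) = (a x + b x) *: iota (amp w u v).
Proof.
move=> /weightP Vu /weightP Vv tx; rewrite lie_iota_amp Vu // Vv //.
rewrite (linZ (@amp_linearl _ _ w v)) (linZ (@amp_linearr _ _ w u)) -scalerDl.
by rewrite (linZ iota_lin).
Qed.

(* If x acts on z0 by c^-1 <> 0 then z |-> z - c [x, z] kills z0, fixes every *)
(* invariant, and rescales weight vectors.                                    *)
Lemma invariant_sum0 (s : seq g) :
  (forall z, z \in s -> exists2 a : g -> K,
     forall x, t x -> lie x z = a x *: z & exists2 x, t x & a x != 0) ->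
  (forall x, t x -> lie x (\sum_(z <- s) z) = 0) -> \sum_(z <- s) z = 0.
Proof.
have [n] := ubnP (size s); elim: n s => // n IH [|z0 s] /=;
  first by rewrite big_nil.
rewrite ltnS => sn hs inv; have [a0 wa0 [x tx ax0]] := hs z0 (mem_head _ _).
pose phi z := z - (a0 x)^-1 *: lie x z.
have lphi : linear phi.
  move=> c u v; rewrite /phi lie_linearr scalerDr scalerBr opprD addrACA.
  by rewrite !scalerA (mulrC c).
have fix_sum : phi (\sum_(z <- z0 :: s) z) = \sum_(z <- z0 :: s) z.
  by rewrite /phi inv // scaler0 subr0.
have phi0 : phi z0 = 0 by rewrite /phi wa0 // scalerA mulVf // scale1r subrr.
have E : \sum_(z <- z0 :: s) z = \sum_(z <- map phi s) z.
  by rewrite -fix_sum (lin_sum lphi) big_cons phi0 add0r big_map.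
rewrite E; apply: IH; first by rewrite size_map.
  move=> _ /mapP[z zs ->]; have [|a wa ha] := hs z;
    first by rewrite inE zs orbT.
  exists a => // x' tx'; rewrite /phi (wa _ tx) lieDr lieNr !lieZr (wa _ tx').
  by rewrite scalerBr !scalerA; congr (_ - _ *: _); ring.
by move=> x' tx'; rewrite -E inv.
Qed.

(** The image of [y] is finite-dimensional and t-stable, so [y] is a combination of u & v with
    weight vectors u, v. Those of nonopposite weights are t-vectors of nonzero weight, and their
    sum, being invariant, is 0. *)
Lemma centralizer_amp y : (forall x, t x -> lie (iota y) x = 0) ->
  span opposite_amps y.
Proof.
move=> cy; have hO : subspace (span opposite_amps) by exact: subspace_span.
have cxy x : t x -> lie x (iota y) = 0 by move=> tx; rewrite lieC cy // oppr0.
have [A fA yA] := sp_finite_image y.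
have hB : subspace (range (sp_act w y)).
  exact: (subspace_image (@sp_act_linear _ _ w y) (@subspaceT _ V)).
have BA : range (sp_act w y) `<=` A by move=> _ [u _ <-].
have sB : rstable t rho (range (sp_act w y)).
  move=> x tx _ [u _ <-]; exists (rho x u) => //.
  have := rM x (iota y) u; rewrite cxy // (lin0 (rx u)) !rho_iota => /esym/eqP.
  by rewrite subr_eq0 => /eqP.
have yW := weight_decomposition (finite_dim_sub fA hB BA) sB.
pose nonzero : set g := [set z | exists2 a : g -> K,
     forall x, t x -> lie x z = a x *: z & exists2 x, t x & a x != 0].
pose C := [set y | exists y0 (s : seq g), [/\ span opposite_amps y0,
  forall z, z \in s -> nonzero z & iota y = iota y0 + \sum_(z <- s) z]].
have hC : subspace C.
  split.
    exists 0, [::]; split=> //; first exact: subspace0.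
    by rewrite big_nil addr0.
  move=> c y1 y2 [z1 [s1 [O1 n1 E1]]] [z2 [s2 [O2 n2 E2]]].
  exists (c *: z1 + z2), ([seq c *: z | z <- s1 & c != 0] ++ s2); split.
  - by apply: (subspaceD hO) => //; exact: (subspaceZ _ hO).
  - move=> z; rewrite mem_cat => /orP[/mapP[z' + ->]|/n2//].
    rewrite mem_filter => /andP[c0 /n1[a wa ha]]; exists a => // x tx.
    by rewrite lieZr wa // !scalerA mulrC.
  - rewrite !iota_lin E1 E2 big_cat big_map /= scalerDr addrACA;
    congr (_ + (_ + _)).
    have [->|c0] := eqVneq c 0; first by rewrite scale0r big1 // => z _;
      rewrite scale0r.
    by rewrite scaler_sumr filter_predT.
have : amp_set w weight_span weight_span `<=` C.
  apply: span_sub => // _ [u Wu [v Wv <-]].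
  suff : weight_span `<=` [set u | C (amp w u v)] by apply.
  apply: span_sub => [|{Wu}u [a da Vu]].
    exact: (subspace_preim (@amp_linearl _ _ w v) hC).
  suff : weight_span `<=` [set v | C (amp w u v)] by apply.
  apply: span_sub => [|{Wv}v [b db Vv]].
    exact: (subspace_preim (@amp_linearr _ _ w u) hC).
  have [ba|nba] := pselect (b = - a).
    exists (amp w u v), [::]; split=> //; last by rewrite big_nil addr0.
    by apply: mem_span; exists a, u, v; rewrite -ba.
  exists 0, [:: iota (amp w u v)]; split; first exact: subspace0.
    move=> z; rewrite inE => /eqP ->; exists (fun x => a x + b x).
      by move=> x; exact: weight_amp.
    apply: contrapT => h; apply: nba; apply/funext => x.
    have [tx|ntx] := pselect (t x); last first.
      by rewrite db.2 // -[RHS]/(- a x) da.2 // oppr0.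
    apply/eqP; rewrite -addr_eq0 addrC; apply/negPn/negP => abx.
    by apply: h; exists x.
  by rewrite big_seq1 (lin0 iota_lin) add0r.
have hW : subspace weight_span by exact: subspace_span.
have yWW : amp_set w weight_span weight_span y.
  by apply: (sp_amp_image w_nondeg hW) => u; apply: yW; exists u.
move=> /(_ _ yWW)[y0 [s [O0 ns E]]].
have inv0 x : t x -> lie x (iota y0) = 0.
  move=> tx; suff : span opposite_amps `<=` [set y | lie x (iota y) = 0] by
    apply.
  apply: span_sub => [|_ [a [u [v [_ Vu Vv ->]]]]].
    have lf : linear (fun y => lie x (iota y)).
      by move=> c u v; rewrite iota_lin lie_linearr.
    exact: (subspace_preim lf (@subspace_set0 _ g)).
  by rewrite /= (weight_amp Vu Vv tx) -[(- a) x]/(- a x) subrr scale0r.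
suff -> : y = y0 by [].
apply: iota_inj; rewrite E invariant_sum0 ?addr0 // => x tx.
have : lie x (iota y) = 0 by exact: cxy.
by rewrite E lieDr inv0 // add0r.
Qed.

Lemma opposite_weights_centralize a : dual t a ->
  amp_set w (Vw a) (Vw (- a)) `<=` centralizer_in iota t.
Proof.
move=> da; apply: span_sub => [|_ [u Vu [v Vv <-]] x tx].
  split=> [x _|c y y' cy cy' x tx]; first by rewrite (lin0 iota_lin) lie0l.
  by rewrite iota_lin lie_linearl cy // cy' // scaler0 addr0.
by rewrite lieC (weight_amp Vu Vv tx) -[(- a) x]/(- a x) subrr scale0r oppr0.
Qed.

Section Maximal.
(** Maximality in the form to which [toralP] translates [maximal_toral]. *)
Hypothesis maxt : forall t', subalgebra t' ->
  (forall x z, t' x -> ldiag (lie x) z) -> t `<=` t' -> t' = t.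

(** Adding the line of u & v to t keeps it abelian and ad-diagonalizable, so maximality applies. *)
Lemma amp_in_torus u v : w u v != 0 ->
  (forall x, t x -> lie x (iota (amp w u v)) = 0) -> t (iota (amp w u v)).
Proof.
move=> uv cuv; set y := iota _ in cuv *.
pose t' := addset t (range (fun c : K => c *: y)).
have ty' : t' y by apply: subr_addset => //; exists 1; rewrite ?scale1r.
suff <- : t' = t by [].
apply: maxt; last first.
- apply: subl_addset; exact: finite_dim_subspace (finite_dim_line y).
- move=> _ z [x [_ [tx [c _ <-] ->]]].
  have -> : lie (x + c *: y) = (fun z => c *: lie y z + lie x z).
    by apply/funext => z'; rewrite lieDl lieZl addrC.
  apply: ldiag_comm_add; try exact: lie_linearr.
  + by move=> z'; rewrite lie_der cuv // lie0l add0r.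
  + exact: iota_amp_ldiag.
  + by move=> z'; exact: dt.
split.
  by apply: subspace_add => //; exact: finite_dim_subspace (finite_dim_line y).
move=> _ _ [x [_ [tx [c _ <-] ->]]] [x' [_ [tx' [c' _ <-] ->]]].
suff -> : lie (x + c *: y) (x' + c' *: y) = 0.
  by apply: subspace0; apply: subspace_add => //;
    exact: finite_dim_subspace (finite_dim_line y).
rewrite lieDl !lieDr !lieZl !lieZr abt // cuv // liexx (lieC y) cuv // oppr0.
by rewrite !scaler0 !addr0.
Qed.

Lemma opposite_amp_in_torus a u v : Vw a u -> Vw (- a) v -> w u v != 0 ->
  t (iota (amp w u v)).
Proof.
move=> Vu Vv uv; apply: amp_in_torus => // x tx.
by rewrite (weight_amp Vu Vv tx) -[(- a) x]/(- a x) subrr scale0r.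
Qed.

(** Otherwise u & v is in t and scales [u] by <u,v>, although [u] has weight 0. *)
Lemma zero_weight_isotropic u v : Vw 0 u -> Vw 0 v -> w u v = 0.
Proof.
move=> Vu Vv; apply/eqP/negPn/negP => uv.
have ty : t (iota (amp w u v)).
  by apply: (@opposite_amp_in_torus 0) => //; rewrite oppr0.
have /weightP/(_ _ ty) := Vu; rewrite rho_iota sp_act_amp skewxx scale0r addr0.
move/eqP; rewrite scale0r scaler_eq0 (negPf uv) /= => /eqP u0.
by move: uv; rewrite u0 skew0l eqxx.
Qed.

(** e & f is in t, so it acts on the weight space of [a] by its scalar <e,f> on [e]; but it sends
    [u] to <u,f> e, since <u,e> = 0. *)
Lemma weight_line a e f u : dual t a -> a <> 0 -> Vw a e -> Vw (- a) f ->
  w e f != 0 -> Vw a u -> u = (w u f / w e f) *: e.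
Proof.
move=> da a0 Ve Vf ef Vu; have ty := opposite_amp_in_torus Ve Vf ef.
have ye : sp_act w (amp w e f) e = w e f *: e.
  by rewrite sp_act_amp skewxx scale0r addr0.
have ue : w u e = 0.
  apply: contrapT => /(weight_form rho_skew da da Vu Ve) aa; apply: a0.
  apply/funext => x; have : a x = - a x by rewrite {1}aa.
  by move/eqP; rewrite -addr_eq0 -mulr2n mulrn_eq0 => /eqP.
have e0 : e != 0 by apply: contraNneq ef => ->; rewrite skew0l.
have aE : a (iota (amp w e f)) = w e f.
  have /weightP/(_ _ ty) := Ve; rewrite rho_iota ye => /eqP.
  by rewrite -subr_eq0 -scalerBl scaler_eq0 (negPf e0) orbF subr_eq0 => /eqP.
have /weightP/(_ _ ty) := Vu; rewrite rho_iota sp_act_amp ue scale0r addr0 aE.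
move=> E; apply: (scalerI ef).
by rewrite -E scalerA mulrCA divff // mulr1.
Qed.

Lemma paired_dim1 a e f : dual t a -> a <> 0 -> Vw a e -> Vw (- a) f ->
  w e f != 0 -> has_dim (Vw a) 1.
Proof.
move=> da a0 Ve Vf ef; have e0 : e != 0.
  by apply: contraNneq ef => ->; rewrite skew0l.
exists (fun=> e); split=> [c|].
  rewrite big_ord1 => /eqP; rewrite scaler_eq0 (negPf e0) orbF => /eqP c0 i.
  by rewrite ord1.
rewrite eqEsubset; split=> [u Vu|].
  rewrite (weight_line da a0 Ve Vf ef Vu).
  have hs := subspace_span (range (fun _ : 'I_1 => e)).
  by apply: (subspaceZ _ hs); apply: mem_span; exists ord0.
by apply: span_sub; [exact: subspace_weight|move=> _ [_ _ <-]].
Qed.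

(** If the weight spaces of [a] and [- a] pair, [y] is a multiple of an element of t, and [y']
    centralizes t. If not, the vectors of [y] are orthogonal to those of [y']. *)
Lemma opposite_amps_commute y y' :
  opposite_amps y -> opposite_amps y' -> lie y y' = 0.
Proof.
move=> [a [u [u' [da Vu Vu' ->]]]] [b [v [v' [db Vv Vv' ->]]]].
have [[e [f [Ve Vf ef]]]|np] :=
    pselect (exists e f, [/\ Vw a e, Vw (- a) f & w e f != 0]).
  have a0 : a <> 0.
    move=> a0; move: ef; rewrite zero_weight_isotropic ?eqxx //;
      first by rewrite -a0.
    by rewrite -[0]oppr0 -a0.
  have na0 : - a <> 0 by move=> /eqP; rewrite oppr_eq0 => /eqP.
  have fe : w f e != 0 by rewrite skewC oppr_eq0.
  have Ve' : Vw (- - a) e by rewrite opprK.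
  rewrite (weight_line da a0 Ve Vf ef Vu).
  rewrite (weight_line (dualN da) na0 Vf Ve' fe Vu').
  rewrite (linZ (@amp_linearl _ _ w _)) (linZ (@amp_linearr _ _ w _)) !lieZl.
  suff -> : lie (amp w e f) (amp w v v') = 0 by rewrite !scaler0.
  apply: iota_inj; rewrite (lin0 iota_lin) (lie_amp w_nondeg) -!rho_iota
    -lie_iota_amp.
  have ty := opposite_amp_in_torus Ve Vf ef.
  by rewrite (weight_amp Vv Vv' ty) -[(- b) _]/(- b _) subrr scale0r.
have unpaired e f : Vw a e -> Vw (- a) f -> w e f = 0.
  by move=> Ve Vf; apply/eqP/negPn/negP => ef; apply: np; exists e, f.
have dna := dualN da; have dnb := dualN db.
have vu' : w v u' = 0.
  apply: contrapT => vu'; have e := weight_form rho_skew db dna Vv Vu' vu'.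
  by apply: vu'; apply: unpaired => //; rewrite -[a]opprK e opprK.
have vu : w v u = 0.
  apply: contrapT => vu; have e := weight_form rho_skew db da Vv Vu vu.
  by apply: vu; rewrite skewC unpaired ?oppr0 // e opprK.
have v'u' : w v' u' = 0.
  apply: contrapT => nz; have e := weight_form rho_skew dnb dna Vv' Vu' nz.
  by apply: nz; apply: unpaired => //; rewrite -[a]opprK e opprK.
have v'u : w v' u = 0.
  apply: contrapT => nz; have e := weight_form rho_skew dnb da Vv' Vu nz.
  by apply: nz; rewrite skewC unpaired ?oppr0 // e opprK.
rewrite (lie_amp w_nondeg) !sp_act_amp vu vu' v'u v'u' !scale0r !addr0.
by rewrite (lin0 (@amp_linearl _ _ w _)) (lin0 (@amp_linearr _ _ w _)) addr0.
Qed.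

Lemma centralizer_abelian : abelian_set (centralizer_in iota t).
Proof.
move=> y y' cy cy'.
have Oy : span opposite_amps y by exact: centralizer_amp.
have Oy' : span opposite_amps y' by exact: centralizer_amp.
have hl (s : sp w) : subspace [set r | lie r s = 0].
  by split=> [|c a b /= ea eb];
    rewrite /= ?lie0l // lie_linearl ea eb scaler0 addr0.
have hr (s : sp w) : subspace [set r | lie s r = 0].
  by split=> [|c a b /= ea eb];
    rewrite /= ?lie0r // lie_linearr ea eb scaler0 addr0.
suff : span opposite_amps `<=` [set r | lie r y' = 0] by apply.
apply: span_sub => // s Os.
suff : span opposite_amps `<=` [set r | lie s r = 0] by apply.
by apply: span_sub => // r Or; exact: opposite_amps_commute.
Qed.

End Maximal.

End Torus.

End Action.

(** * Toral subalgebras of sp(V) *)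

Section SymplecticTori.
Variables (K : numClosedFieldType) (V : lmodType K) (w : {skew_symmetric V}).
Hypothesis w_nondeg : nondegenerate_form w.
Implicit Types (x y : sp w) (u v e f : V).

Lemma sp_module : is_module (sp_act w).
Proof.
by split=> [v|x|x y v];
  [exact: sp_act_linearl|exact: sp_act_linear|exact: sp_act_lie].
Qed.

(** Such [x] maps [V] into [A] and kills [A], so it squares to 0. *)
Lemma Sym2_spP (A : set V) x : subspace A -> Sym2_sp w A x ->
  (forall u v, A u -> A v -> w u v = 0) -> (forall v, ldiag (sp_act w x) v) ->
  x = 0.
Proof.
move=> hA [Ax _] isoA dx; apply: (sp_act_faithful w_nondeg) => u.
rewrite (lin0 (@sp_act_linearl _ _ w u)).
have imA v : A (sp_act w x v).
  suff : tens_set A A `<=` [set y | A (tens_act w y v)] by apply.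
  apply: span_sub => [|_ [a Aa [b Ab <-]]].
    exact: (subspace_preim (@tens_act_linearl _ _ w v) hA).
  by rewrite /= tens_act_tens; exact: subspaceZ.
have kerA v : A v -> sp_act w x v = 0.
  move=> Av; suff : tens_set A A `<=` [set y | tens_act w y v = 0] by apply.
  apply: span_sub => [|_ [a Aa [b Ab <-]]].
    exact: (subspace_preim (@tens_act_linearl _ _ w v) (@subspace_set0 _ V)).
  by rewrite /= tens_act_tens isoA // scale0r.
rewrite (ldiag_geig (@sp_act_linear _ _ w x) (dx u) (l := 0)) ?scale0r //.
by exists 2%N; rewrite /= !scale0r !subr0 kerA.
Qed.

Lemma amp_set_Sym2 (A : set V) x : amp_set w A A x -> Sym2_sp w A x.
Proof.
move=> Ax; split; last by apply/eqP; rewrite -sp_predE; exact: sp_valP.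
have hT : subspace (tens_set A A) by exact: subspace_span.
suff : amp_set w A A `<=` [set y : sp w | tens_set A A (sp_val y)] by apply.
have lv : linear (fun y : sp w => sp_val y) by [].
apply: span_sub => [|_ [a Aa [b Ab <-]]]; first exact: (subspace_preim lv hT).
by apply: (subspaceD hT); apply: mem_span; [exists a => //;
  exists b|exists b => //; exists a].
Qed.

Lemma amp_setC (A B : set V) : amp_set w A B = amp_set w B A.
Proof.
rewrite eqEsubset; split; apply: span_mono => _ [a Aa [b Bb <-]];
  by exists b => //; exists a => //; exact: ampC.
Qed.

Section SubalgebraWeights.
Variable t : set (sp w).
Hypothesis ht : subspace t.
Let Vw := weight_space (sp_act w) t.
Let S := supp (sp_act w) t.

Lemma supp_weight a u : (u != 0) -> dual t a -> Vw a u -> S a.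
Proof.
by move=> u0 da Vu; split=> // V0; move: Vu; rewrite /Vw V0 => /eqP;
  rewrite (negPf u0).
Qed.

Lemma sp_weight_form a b u v : dual t a -> dual t b -> Vw a u -> Vw b v ->
  w u v <> 0 -> b = - a.
Proof. exact: (@weight_form K (sp w) V w (sp_act w) t (sp_skew w_nondeg)). Qed.

Lemma half_system : S = [set - a | a in S] ->
  exists I : set (sp w -> K), I `|` [set - a | a in I] = S `\ 0 /\
    I `&` [set - a | a in I] = set0.
Proof.
move=> Sopp; pose P (a : sp w -> K) := [set b | b = a \/ b = - a].
have PN a : P (- a) = P a.
  rewrite eqEsubset; split=> b [->|->]; rewrite /P /= ?opprK.
  - by right.
  - by left.
  - by right.
  - by left.
(* The choice depends on the set [P a] alone, so [a] and [- a] get the same representative. *)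
pose c a := xget (0 : sp w -> K) (P a).
have cP a : P a (c a) by apply: (xgetI _ (x := a)); left.
have SN a : S a -> S (- a) by rewrite [in X in _ -> X]Sopp => Sa; exists a.
pose I := [set a | [/\ S a, a <> 0 & c a = a]].
have aN (a : sp w -> K) : a <> 0 -> - a <> a.
  move=> a0 e; apply: a0; apply/funext => x;
    have : - a x = a x by rewrite -{2}e.
  by move/esym/eqP; rewrite -addr_eq0 -mulr2n mulrn_eq0 => /eqP.
exists I; split; rewrite eqEsubset; split=> a.
- case=> [[Sa a0 _]//|[b [Sb b0 _] <-]]; split; first exact: SN.
  by move=> /eqP; rewrite oppr_eq0 => /eqP.
- move=> [Sa a0]; have [ca|ca] := cP a; first by left.
  right; exists (- a); rewrite ?opprK //; split; first exact: SN.
    by move=> /eqP; rewrite oppr_eq0 => /eqP.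
  by rewrite /c PN.
- move=> [[Sa a0 ca] [b [Sb b0 cb] ba]]; apply: (aN b b0).
  by rewrite ba -ca -cb -ba /c PN.
- by [].
Qed.

End SubalgebraWeights.

Section MaximalTorus.
Variable t : set (sp w).
Hypotheses (st : subalgebra t) (dt : forall x z, t x -> ldiag (lie x) z).
Let Vw := weight_space (sp_act w) t.
Let S := supp (sp_act w) t.
(** The results on a summand are used with [g] equal to [sp w] and [iota] the identity. *)
Let id_lin : linear (@id (sp w)). Proof. by []. Qed.
Let id_act x v : sp_act w (id x) v = sp_act w x v. Proof. by []. Qed.
Let ht : subspace t. Proof. by case: st. Qed.
Let abt : abelian_set t. Proof. exact: toral_abelian. Qed.

Lemma sp_weight_subspace a : subspace (Vw a).
Proof.
exact: (@subspace_weight _ _ w w_nondeg (sp w) id (sp_act w) id_lin sp_module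
  id_act
  (lie_amp w_nondeg) t dt).
Qed.

Lemma sp_weightP a u : Vw a u <-> forall x, t x -> sp_act w x u = a x *: u.
Proof.
exact: (@weightP _ _ w w_nondeg (sp w) id (sp_act w) id_lin sp_module id_act
  (lie_amp w_nondeg) t dt).
Qed.

(** Choose [x] in t with [a x] nonzero, [e] of weight [a] and [b] with <b,e> = 1. Then <e, x b> is
    nonzero, and [x b], lying in the finite-dimensional image of [x], is a sum of weight vectors,
    one of which pairs with [e]. *)
Lemma supp_pairs a : S a -> a <> 0 ->
  exists e f, [/\ Vw a e, Vw (- a) f & w e f != 0].
Proof.
move=> [da Va0] a0.
have [x ax0] : exists x, a x != 0.
  apply: contrapT => h; apply: a0; apply/funext => x;
    apply/eqP/negPn/negP => ax.
  by apply: h; exists x.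
have tx : t x by apply: contrapT => /da.2 ax; rewrite ax eqxx in ax0.
have [e Ve e0] : exists2 e, Vw a e & e != 0.
  apply: contrapT => h; apply: Va0; rewrite eqEsubset; split=> [u Vu|_ ->].
    by apply/eqP/negPn/negP => u0; apply: h; exists u.
  exact: subspace0 (sp_weight_subspace a).
have [b be] := form_neq0 w_nondeg e0.
have xe : sp_act w x e = a x *: e by move/sp_weightP: Ve; apply.
have exb : w e (sp_act w x b) != 0.
  apply: contraNneq ax0 => exb; have := sp_skew w_nondeg x e b.
  rewrite exb addr0 xe skewZl skewC be mulrN1 => /eqP.
  by rewrite oppr_eq0.
have [A fA xA] := sp_finite_image x.
have hB : subspace (range (sp_act w x)).
  exact: (subspace_image (@sp_act_linear _ _ w x) (@subspaceT _ V)).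
have BA : range (sp_act w x) `<=` A by move=> _ [u _ <-].
have sB : rstable t (sp_act w) (range (sp_act w x)).
  move=> z tz _ [u _ <-]; exists (sp_act w z u) => //.
  have := sp_act_lie z x u; rewrite abt // (lin0 (@sp_act_linearl _ _ w u)).
  by move/esym/eqP; rewrite subr_eq0 => /eqP.
have dec := weight_decomposition w_nondeg id_lin sp_module id_act
  (lie_amp w_nondeg) st dt (finite_dim_sub fA hB BA) sB.
apply: contrapT => h; case/eqP: exb.
have : weight_span (sp_act w) t `<=` [set u | w e u = 0].
  apply: span_sub => [|u [c dc Vu]].
    by split=> [|k u u' /= eu eu'];
      rewrite /= ?skew0r // skewDr skewZr eu eu' mulr0 addr0.
  apply/eqP/negPn/negP => eu; apply: h; exists e, u; split=> //.
  by rewrite -(sp_weight_form da dc Ve Vu (elimN eqP eu)).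
by apply; apply: dec; exists b.
Qed.

Lemma sp_centralizer_sum (T : set (sp w)) x : subspace T ->
  (forall a, S a -> a <> 0 -> amp_set w (Vw a) (Vw (- a)) `<=` T) ->
  (forall z, t z -> lie x z = 0) ->
  exists y z, [/\ T y, amp_set w (Vw 0) (Vw 0) z & x = y + z].
Proof.
move=> hT ST cx; have hA : subspace (amp_set w (Vw 0) (Vw 0)) by exact:
  subspace_span.
have : span (@opposite_amps K V w (sp w) (sp_act w) t) x.
  exact: (@centralizer_amp _ _ w w_nondeg (sp w) id (sp_act w) id_lin sp_module
    id_act
    (lie_amp w_nondeg) t st dt).
suff : span (@opposite_amps K V w (sp w) (sp_act w) t) `<=` addset T (amp_set w
  (Vw 0) (Vw 0)).
  by apply.
have hTA := subspace_add hT hA.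
apply: span_sub => // _ [a [u [v [da Vu Vv ->]]]].
have [a0|a0] := pselect (a = 0).
  apply: subr_addset => //; apply: mem_span; exists u; first by rewrite -a0.
  by exists v => //; rewrite -[0]oppr0 -a0.
have [u0|u0] := eqVneq u 0.
  by rewrite u0 (lin0 (@amp_linearl _ _ w v)); exact: subspace0.
apply: subl_addset => //; apply: (ST a) => //.
  exact: supp_weight Vu.
by apply: mem_span; exists u => //; exists v.
Qed.

Section Maximal.
Hypothesis maxt : forall t', subalgebra t' ->
  (forall x z, t' x -> ldiag (lie x) z) -> t `<=` t' -> t' = t.

Let iso0 u v : Vw 0 u -> Vw 0 v -> w u v = 0.
Proof.
exact: (@zero_weight_isotropic _ _ w w_nondeg (sp w) id (sp_act w) id_lin
  sp_module
  id_act (lie_amp w_nondeg) t st dt maxt).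
Qed.

Let pair_line a e f u : dual t a -> a <> 0 -> Vw a e -> Vw (- a) f ->
  w e f != 0 -> Vw a u -> u = (w u f / w e f) *: e.
Proof.
exact: (@weight_line _ _ w w_nondeg (sp w) id (sp_act w) id_lin sp_module id_act
  (sp_skew w_nondeg) (lie_amp w_nondeg) t st dt maxt).
Qed.

Lemma maximal_torus_supp : S = [set - a | a in S] /\
  (forall a, S a -> a <> 0 -> has_dim (Vw a) 1).
Proof.
have SN a : S a -> S (- a).
  move=> Sa; have [a0|a0] := pselect (a = 0); first by rewrite a0 oppr0 -a0.
  have [e [f [Ve Vf ef]]] := supp_pairs Sa a0.
  apply: supp_weight Vf; last exact: dualN Sa.1.
  by apply: contraNneq ef => ->; rewrite skew0r.
split=> [|a Sa a0].
  rewrite eqEsubset; split=> a => [Sa|[b Sb <-]]; last exact: SN.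
  by exists (- a); rewrite ?opprK //; exact: SN.
have [e [f [Ve Vf ef]]] := supp_pairs Sa a0.
exact: (@paired_dim1 _ _ w w_nondeg (sp w) id (sp_act w) id_lin sp_module id_act
  (sp_skew w_nondeg) (lie_amp w_nondeg) t st dt maxt a e f Sa.1 a0 Ve Vf ef).
Qed.

Let opp_neq0 (a : sp w -> K) : a <> 0 -> - a <> 0.
Proof. by move=> a0 /eqP; rewrite oppr_eq0 => /eqP. Qed.

Lemma maximal_torus_amp a : S a -> a <> 0 ->
  exists e f, [/\ Vw a e, Vw (- a) f, w e f != 0, t (amp w e f) &
    amp_set w (Vw a) (Vw (- a)) `<=` [set c *: amp w e f | c in [set: K]]].
Proof.
move=> Sa a0; have [e [f [Ve Vf ef]]] := supp_pairs Sa a0; have da := Sa.1.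
exists e, f; split=> //.
  exact: (@opposite_amp_in_torus _ _ w w_nondeg (sp w) id (sp_act w) id_lin
    sp_module
    id_act (lie_amp w_nondeg) t st dt maxt a e f Ve Vf ef).
apply: span_sub => [|_ [u Vu [v Vv <-]]].
  exact: (finite_dim_subspace (finite_dim_line (amp w e f))).
have fe : w f e != 0 by rewrite skewC oppr_eq0.
have Ve' : Vw (- - a) e by rewrite opprK.
rewrite (pair_line da a0 Ve Vf ef Vu).
rewrite (pair_line (dualN da) (opp_neq0 a0) Vf Ve' fe Vv).
rewrite (linZ (@amp_linearl _ _ w _)) (linZ (@amp_linearr _ _ w _)) scalerA.
by exists (w u f / w e f * (w v e / w f e)).
Qed.

Lemma maximal_torus_Sym2 : Sym2_sp w (Vw 0) `&` t = [set 0].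
Proof.
rewrite eqEsubset; split=> [x [Sx tx]|_ ->]; last first.
  by split; [apply: amp_set_Sym2; apply: subspace0;
    exact: subspace_span|exact: subspace0].
apply: (Sym2_spP (sp_weight_subspace 0) Sx iso0) => v.
exact: (@act_ldiag _ _ w w_nondeg (sp w) id (sp_act w) id_lin sp_module id_act
  (lie_amp w_nondeg) x (fun z => dt z tx) v).
Qed.

(** An element of t centralizes t, so it is a sum over nonzero weights, which lies in t, plus a
    tensor in Sym^2(V^0), which is then in t and so is 0. *)
Lemma maximal_torus_sum (I : set (sp w -> K)) :
  I `|` [set - a | a in I] = S `\ 0 -> I `&` [set - a | a in I] = set0 ->
  direct_sum I (fun a => amp_set w (Vw a) (Vw (- a))) t.
Proof.
move=> IS Idisj; have IS' a : I a -> S a /\ a <> 0.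
  by move=> Ia; have : (S `\ 0) a by rewrite -IS; left.
have hs (J : set (sp w -> K)) :
    subspace (span (\bigcup_(a in J) amp_set w (Vw a) (Vw (- a)))).
  exact: subspace_span.
have Dt : span (\bigcup_(a in I) amp_set w (Vw a) (Vw (- a))) `<=` t.
  apply: span_sub => // x [a /IS'[Sa a0] Dx].
  have [e [f [_ _ _ tef sub]]] := maximal_torus_amp Sa a0.
  by have [c _ <-] := sub _ Dx; exact: subspaceZ.
split.
  rewrite eqEsubset; split=> // x tx.
  have [a Sa a0 x' Dx'|z tz|y [z [Dy Az xE]]] := @sp_centralizer_sum _ x (hs I).
  - have : (I `|` [set - a | a in I]) a by rewrite IS; split.
    case=> [Ia|[b Ib ba]]; apply: mem_span; first by exists a.
    by exists b => //; move: Dx'; rewrite -ba opprK amp_setC.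
  - exact: abt tx tz.
  have z0 : z = 0.
    have : (Sym2_sp w (Vw 0) `&` t) z.
      split; first exact: amp_set_Sym2.
      have -> : z = x - y by rewrite xE addrC addKr.
      by apply: subspaceB => //; exact: Dt.
    by rewrite maximal_torus_Sym2.
  by rewrite xE z0 addr0.
move=> a Ia; have [Sa a0] := IS' _ Ia.
have [e [f [Ve Vf ef tef sub]]] := maximal_torus_amp Sa a0.
rewrite eqEsubset; split=> [y [Dy sy]|_ ->]; last first.
  by split; apply: subspace0; [exact: subspace_span|exact: hs].
have [c _ yE] := sub _ Dy.
(* Evaluation at [e] separates the summands: those for other weights of [I] kill [e], while e & f
   does not. *)
suff : sp_act w y e = 0.
  rewrite -yE (linZ (@sp_act_linearl _ _ w e)) sp_act_amp skewxx scale0r addr0.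
  move=> /eqP; rewrite !scaler_eq0 (negPf ef) /=.
  have e0 : e != 0 by apply: contraNneq ef => ->; rewrite skew0l.
  by rewrite (negPf e0) orbF => /eqP ->; rewrite /= scale0r.
have : span (\bigcup_(b in I `\ a) amp_set w (Vw b) (Vw (- b))) `<=`
    [set y | sp_act w y e = 0].
  have hk := subspace_preim (@sp_act_linearl _ _ w e) (@subspace_set0 _ V).
  apply: span_sub => // x [b [Ib ba]]; move: x; apply: span_sub => //.
  move=> _ [u Vu [v Vv <-]] /=; rewrite sp_act_amp.
  have db := (IS' _ Ib).1.1; have da := Sa.1.
  have -> : w e v = 0.
    apply: contrapT => ev; apply: ba.
    by have /oppr_inj := sp_weight_form da (dualN db) Ve Vv ev.
  have -> : w e u = 0.
    apply: contrapT => eu; have e1 := sp_weight_form da db Ve Vu eu.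
    have : (I `&` [set - a | a in I]) b by split=> //; exists a.
    by rewrite Idisj.
  by rewrite !scale0r addr0.
by apply.
Qed.

End Maximal.
End MaximalTorus.

(** * Sufficiency of (3), (5), (6) in sp(V) *)

Section Converse.
Variables (t : set (sp w)).
Hypothesis st : subalgebra t.
Let Vw := weight_space (sp_act w) t.
Let S := supp (sp_act w) t.
Hypothesis iso0 : forall u v, Vw 0 u -> Vw 0 v -> w u v = 0.
Hypothesis dim1 : forall a, S a -> a <> 0 -> has_dim (Vw a) 1.
Hypothesis SN : forall a, S a -> S (- a).
Variable I : set (sp w -> K).
Hypothesis IS : I `|` [set - a | a in I] = S `\ 0.
Hypothesis Idisj : I `&` [set - a | a in I] = set0.
Hypothesis tE : t = span (\bigcup_(a in I) amp_set w (Vw a) (Vw (- a))).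

Let ht : subspace t. Proof. by case: st. Qed.
Let id_lin : linear (@id (sp w)). Proof. by []. Qed.
Let id_act x v : sp_act w (id x) v = sp_act w x v. Proof. by []. Qed.
Let IS' a : I a -> S a /\ a <> 0.
Proof. by move=> Ia; have : (S `\ 0) a by rewrite -IS; left. Qed.

Lemma has_dim1P (A : set V) : has_dim A 1 ->
  exists2 e, A e & forall u, A u -> exists c, u = c *: e.
Proof.
move=> [e [_ ->]]; have hl := finite_dim_subspace (finite_dim_line (e ord0)).
exists (e ord0); first by apply: mem_span; exists ord0.
suff : span (range e) `<=` range (fun c : K => c *: e ord0).
  by move=> sub u /sub[c _ <-]; exists c.
by apply: span_sub => // _ [i _ <-]; exists 1; rewrite // scale1r (ord1 i).
Qed.

Let gen y := exists a u v, [/\ I a, Vw a u, Vw (- a) v & y = amp w u v].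

Lemma torus_gen_sub (C : set (sp w)) : subspace C -> gen `<=` C -> t `<=` C.
Proof.
move=> hC gC; rewrite tE; apply: span_sub => // x [a Ia]; move: x.
by apply: span_sub => // _ [u Vu [v Vv <-]]; apply: gC; exists a, u, v.
Qed.

(* Otherwise t would kill e, contradicting a <> 0.                            *)
Lemma torus_paired a e f : I a -> Vw a e -> Vw (- a) f -> e != 0 ->
  (forall v, Vw (- a) v -> exists c, v = c *: f) -> w e f != 0.
Proof.
move=> Ia Ve Vf e0 lf; apply/negP => /eqP ef; have [Sa a0] := IS' Ia.
have te0 : t `<=` [set x | sp_act w x e = 0].
  apply: torus_gen_sub.
    exact: (subspace_preim (@sp_act_linearl _ _ w e) (@subspace_set0 _ V)).
  move=> _ [b [u [v [Ib Vu Vv ->]]]] /=; have [Sb b0] := IS' Ib.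
  have da := Sa.1; have db := Sb.1; rewrite sp_act_amp.
  have -> : w e v = 0.
    apply: contrapT => ev;
      have /oppr_inj ba := sp_weight_form da (dualN db) Ve Vv ev.
    by apply: ev; rewrite ba in Vv; have [c ->] := lf _ Vv;
      rewrite skewZr ef mulr0.
  have -> : w e u = 0.
    apply: contrapT => eu; have ba := sp_weight_form da db Ve Vu eu.
    have : (I `&` [set - a | a in I]) b by split=> //; exists a.
    by rewrite Idisj.
  by rewrite !scale0r addr0.
apply: a0; apply/funext => x; have [tx|/Sa.1.2//] := pselect (t x).
apply/eqP/negPn/negP => ax; case/eqP: e0.
apply: (geig_neq (@sp_act_linear _ _ w x) (weight_geig Ve tx) (c := 0)).
  by rewrite scale0r; exact: te0.
by rewrite eq_sym.
Qed.

Lemma torus_pair a : I a -> exists e f, [/\ Vw a e, Vw (- a) f, w e f != 0 &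
  forall u v, Vw a u -> Vw (- a) v -> exists c, amp w u v = c *: amp w e f].
Proof.
move=> Ia; have [Sa a0] := IS' Ia.
have na0 : - a <> 0 by move=> /eqP; rewrite oppr_eq0 => /eqP.
have [e Ve le] := has_dim1P (dim1 Sa a0).
have [f Vf lf] := has_dim1P (dim1 (SN Sa) na0).
have [z Vz z0] : exists2 z, Vw a z & z != 0.
  apply: contrapT => h; apply: Sa.2; rewrite eqEsubset; split=> [z Vz|_ ->].
    by apply/eqP/negPn/negP => z0; apply: h; exists z.
  exists 1%N => // x _ /=.
  by rewrite (lin0 (@sp_act_linear _ _ w x)) scaler0 subr0.
have e0 : e != 0.
  by have [k zE] := le _ Vz; apply: contraNneq z0 => e0; rewrite zE e0 scaler0.
exists e, f; split=> //; first exact: torus_paired Ia Ve Vf e0 lf.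
move=> u v /le[c ->] /lf[d ->]; exists (c * d).
by rewrite (linZ (@amp_linearl _ _ w _)) (linZ (@amp_linearr _ _ w _)) scalerA.
Qed.

(** For equal weights both are multiples of one e & f; for different weights of [I] all four
    pairings vanish, since the weights are neither equal nor opposite. *)
Lemma torus_gen_commute y z : gen y -> gen z -> lie y z = 0.
Proof.
move=> [a [u [v [Ia Vu Vv ->]]]] [b [u' [v' [Ib Vu' Vv' ->]]]].
have [Sa a0] := IS' Ia; have [Sb b0] := IS' Ib; have [da db] := (Sa.1, Sb.1).
have dna := dualN da; have dnb := dualN db.
have [e [f [Ve Vf ef ampE]]] := torus_pair Ia.
have [c ->] := ampE _ _ Vu Vv; have [ab|nab] := pselect (a = b).
  have [c' ->] : exists c', amp w u' v' = c' *: amp w e f.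
    by apply: ampE; rewrite ab.
  by rewrite lieZl lieZr liexx !scaler0.
have nanb : a <> - b.
  move=> ab; have : (I `&` [set - a | a in I]) a by split=> //; exists b.
  by rewrite Idisj.
rewrite lieZl (lie_amp w_nondeg) !sp_act_amp.
have -> : w u' f = 0.
  by apply: contrapT => /(sp_weight_form db dna Vu' Vf) /oppr_inj.
have -> : w u' e = 0.
  by apply: contrapT => /(sp_weight_form db da Vu' Ve).
have -> : w v' f = 0.
  apply: contrapT => /(sp_weight_form dnb dna Vv' Vf) ab.
  by apply: nanb; rewrite -[a]opprK ab opprK.
have -> : w v' e = 0.
  by apply: contrapT => /(sp_weight_form dnb da Vv' Ve); rewrite opprK.
rewrite !scale0r !addr0 (lin0 (@amp_linearl _ _ w _)) (lin0 (@amp_linearr _ _ w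
  _)).
by rewrite addr0 scaler0.
Qed.

Lemma torus_commutes : abelian_set t.
Proof.
have hl (s : sp w) : subspace [set r | lie r s = 0].
  by split=> [|c a b /= ea eb];
    rewrite /= ?lie0l // lie_linearl ea eb scaler0 addr0.
have hr (s : sp w) : subspace [set r | lie s r = 0].
  by split=> [|c a b /= ea eb];
    rewrite /= ?lie0r // lie_linearr ea eb scaler0 addr0.
move=> y z ty tz; suff : t `<=` [set r | lie r z = 0] by apply.
apply: torus_gen_sub => // s gs; suff : t `<=` [set r | lie s r = 0] by apply.
by apply: torus_gen_sub => // r gr; exact: torus_gen_commute.
Qed.

Lemma torus_ldiag x z : t x -> ldiag (lie x) z.
Proof.
(* Keeping [t x] in the set makes its members commute, as [ldiag_comm_add] requires for sums. *)
move=> tx; suff : t `<=` [set x | t x /\ forall z, ldiag (lie x) z].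
  by move=> /(_ _ tx)[_]; apply.
apply: torus_gen_sub; last first.
  move=> _ [a [u [v [Ia Vu Vv ->]]]]; split.
    rewrite tE; apply: mem_span; exists a => //.
    by apply: mem_span; exists u => //; exists v.
  move=> z'; have [e [f [Ve Vf ef ampE]]] := torus_pair Ia.
  have [c ->] := ampE _ _ Vu Vv.
  have dy := @iota_amp_ldiag _ _ w w_nondeg (sp w) id (sp_act w) id_lin
    sp_module
    id_act (lie_amp w_nondeg) e f ef.
  have d0 z1 : ldiag (fun _ : sp w => 0) z1.
    by apply: (@eig_ldiag _ _ _ 0); [move=> k r r';
      rewrite scaler0 addr0|rewrite scale0r].
  have -> : lie (c *: amp w e f) = (fun z => c *: lie (amp w e f) z + 0).
    by apply/funext => r; rewrite lieZl addr0.
  apply: ldiag_comm_add => //; first exact: lie_linearr.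
    by move=> k r r'; rewrite scaler0 addr0.
  by move=> r; rewrite lie0r.
split=> [|c x1 x2 [tx1 d1] [tx2 d2]]; split.
- exact: subspace0.
- move=> z'; apply: (@eig_ldiag _ _ _ 0); first exact: lie_linearr.
  by rewrite lie0l scale0r.
- by apply: subspaceD => //; exact: subspaceZ.
move=> z'; have -> : lie (c *: x1 + x2) = (fun z => c *: lie x1 z + lie x2 z).
  by apply/funext => r; exact: lie_linearl.
apply: ldiag_comm_add => //; try exact: lie_linearr.
by move=> r; rewrite lie_der (torus_commutes tx2 tx1) lie0l add0r.
Qed.

(** [t'] is abelian, so each of its elements centralizes t and splits into an element of t and a
    tensor in Sym^2(V^0); the latter is in [t'], so it is diagonalizable and hence 0. *)
Lemma torus_maximal t' : subalgebra t' -> (forall x z, t' x -> ldiag (lie x) z)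
  ->
  t `<=` t' -> t' = t.
Proof.
move=> st' dt' tt'; rewrite eqEsubset; split=> // x t'x.
have ab' := toral_abelian st' dt'; have [ht' _] := st'.
have [a Sa a0 x' Dx'|z tz|y [z [ty Az xE]]] :=
    @sp_centralizer_sum _ st torus_ldiag _ x ht.
- have : (I `|` [set - a | a in I]) a by rewrite IS; split.
  rewrite tE; case=> [Ia|[b Ib ba]]; apply: mem_span; first by exists a.
  by exists b => //; move: Dx'; rewrite -ba opprK amp_setC.
- by apply: ab' => //; exact: tt'.
have t'z : t' z.
  have -> : z = x - y by rewrite xE addrC addKr.
  by apply: subspaceB => //; exact: tt'.
have z0 : z = 0.
  apply: (Sym2_spP (sp_weight_subspace torus_ldiag 0) (amp_set_Sym2 Az) iso0)
    => v.
  exact: (@act_ldiag _ _ w w_nondeg (sp w) id (sp_act w) id_lin sp_module id_act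
    (lie_amp w_nondeg) z (fun z' => dt' _ z' t'z) v).
by rewrite xE z0 addr0.
Qed.

End Converse.
End SymplecticTori.

(** * Maximal toral subalgebras *)

Section Summand.
Variables (K : numClosedFieldType) (V : lmodType K) (w : {skew_symmetric V}).
Hypothesis w_nondeg : nondegenerate_form w.
Variables (g : lieAlgType K) (iota : sp w -> g) (k : set g) (rho : g -> V -> V).
Hypotheses (sum_iota : derived_summand iota k) (rho_mod : is_module rho).
Hypothesis rho_iota : forall x v, rho (iota x) v = sp_act w x v.
Hypothesis rho_skew : forall x u v, w (rho x u) v + w u (rho x v) = 0.

(* sp(V) is perfect, so as an ideal of [g, g] it is also an ideal of g.       *)
Lemma summand_lie_amp x a b :
  lie x (iota (amp w a b)) = iota (amp w (rho x a) b + amp w a (rho x b)).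
Proof.
have [[il ib] _ [_ _ idl] _ _] := sum_iota; have [rx rl rM] := rho_mod.
have hr : subspace (range iota) := subspace_image il (@subspaceT _ _).
have xI y : range iota (lie x (iota y)).
  suff : lie_set [set: sp w] [set: sp w] `<=` [set y | range iota (lie x (iota
    y))].
    by apply; rewrite sp_perfect.
  apply: lie_set_sub.
    have lf : linear (fun y => lie x (iota y)).
      by move=> c u v; rewrite il lie_linearr.
    exact: (subspace_preim lf hr).
  move=> y' z _ _ /=; rewrite ib lie_der; apply: (subspaceD hr).
    by apply: idl; [exact: lie_setP|exists z].
  rewrite lieC; apply: (subspaceN hr); apply: idl; last by exists y'.
  exact: lie_setP.
have [y _ yE] := xI (amp w a b); rewrite -yE; congr iota.
apply: (sp_act_faithful w_nondeg) => u.
rewrite -rho_iota yE rM !rho_iota (linD (@sp_act_linearl _ _ w u)) !sp_act_amp.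
rewrite (linD (rl x)) !(linZ (rl x)).
have sk v : w (rho x u) v = - w u (rho x v).
  by apply/eqP; rewrite -addr_eq0 rho_skew.
by rewrite !sk !scaleNr opprD !opprK !addrA [RHS](ACl (1*4*3*2)).
Qed.

End Summand.

Section MaximalToral.
Variable K : numClosedFieldType.

Lemma toralP (g : lieAlgType K) (G H : nat -> set g) t : root_reductive G H ->
  toral G t <-> subalgebra t /\ forall x z, t x -> ldiag (lie x) z.
Proof.
move=> rrG; split=> [[st tt]|[st tt]]; split=> //.
  by move=> x z /tt/(semisimple_eltP rrG).
by move=> x tx; apply/(semisimple_eltP rrG) => z; exact: tt.
Qed.

Variables (V : lmodType K) (w : {skew_symmetric V}).
Hypothesis w_nondeg : nondegenerate_form w.

Lemma maximal_toral_summand (g : lieAlgType K) (G H : nat -> set g)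
    (iota : sp w -> g) (k : set g) (rho : g -> V -> V) (t : set g) :
  root_reductive G H -> derived_summand iota k -> is_module rho ->
  (forall x v, rho (iota x) v = sp_act w x v) ->
  (forall x u v, w (rho x u) v + w u (rho x v) = 0) ->
  maximal_toral G t ->
  let Vw := weight_space rho t in
  let Z := centralizer_in iota t in
  [/\ forall a b, dual t a -> dual t b ->
        (exists u v, [/\ Vw a u, Vw b v & w u v <> 0]) ->
        b = - a /\ (a <> 0 -> has_dim (Vw a) 1 /\ has_dim (Vw (- a)) 1),
      forall a, dual t a -> amp_set w (Vw a) (Vw (- a)) `<=` center_of Z,
      (forall u v, Vw 0 u -> Vw 0 v -> w u v = 0) /\
        Sym2_sp w (Vw 0) `&` iota @^-1` t = [set 0]
    & abelian_set Z].
Proof.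
move=> rrG sI rm ri rs [tt tmax] Vw Z.
have lia := summand_lie_amp w_nondeg sI rm ri rs.
have [[il _] _ _ _ _] := sI; have [st dt] := (toralP t rrG).1 tt.
have maxt t' : subalgebra t' -> (forall x z, t' x -> ldiag (lie x) z) ->
    t `<=` t' -> t' = t.
  by move=> st' dt'; apply: tmax; apply/(toralP t' rrG).
have cZ := centralizer_abelian w_nondeg il rm ri rs lia st dt maxt.
have iso0 := zero_weight_isotropic w_nondeg il rm ri lia st dt maxt.
split=> //.
- move=> a b da db [u [v [Vu Vv uv]]].
  have ba := weight_form rs da db Vu Vv uv; split=> // a0.
  have uv0 : w u v != 0 by apply/eqP.
  rewrite ba in Vv; split.
    exact: (paired_dim1 w_nondeg il rm ri rs lia st dt maxt da a0 Vu Vv uv0).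
  have na0 : - a <> 0 by move=> /eqP; rewrite oppr_eq0 => /eqP.
  apply: (paired_dim1 w_nondeg il rm ri rs lia st dt maxt (dualN da) na0 Vv (f
    := u)).
    by rewrite opprK.
  by rewrite skewC oppr_eq0.
- move=> a da y Dy.
  have sub := opposite_weights_centralize w_nondeg il rm ri lia dt da.
  by split=> [|z Zz]; [exact: sub|apply: cZ => //; exact: sub].
split; first exact: iso0.
have h0 : subspace (Vw 0) := subspace_weight w_nondeg il rm ri lia dt 0.
rewrite eqEsubset; split=> [x [Sx tx]|_ ->].
  apply: (Sym2_spP w_nondeg h0 Sx iso0) => v;
    rewrite (_ : sp_act w x = rho (iota x)).
    exact: (act_ldiag w_nondeg il rm ri lia (fun z => dt _ z tx)).
  by apply/funext => u; rewrite ri.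
split; last by rewrite /preimage /= (lin0 il); case: st => /subspace0.
by apply: amp_set_Sym2; apply: subspace0; exact: subspace_span.
Qed.

Lemma maximal_toral_sp (G H : nat -> set (sp w)) (t : set (sp w)) :
  root_reductive G H -> subalgebra t ->
  let Vw := weight_space (sp_act w) t in
  let S := supp (sp_act w) t in
  maximal_toral G t <->
  [/\ (forall u v, Vw 0 u -> Vw 0 v -> w u v = 0) /\
        Sym2_sp w (Vw 0) `&` t = [set 0],
      S = [set - a | a in S] /\
        (forall a, S a -> a <> 0 -> has_dim (Vw a) 1)
    & exists I : set (sp w -> K),
        [/\ I `|` [set - a | a in I] = S `\ 0,
            I `&` [set - a | a in I] = set0
          & direct_sum I (fun a => amp_set w (Vw a) (Vw (- a))) t]].
Proof.
move=> rrG st Vw S; split=> [[tt tmax]|[[iso0 _] [SS dim1] [I [IS Id [tE _]]]]].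
  have [_ dt] := (toralP t rrG).1 tt.
  have maxt t' : subalgebra t' -> (forall x z, t' x -> ldiag (lie x) z) ->
      t `<=` t' -> t' = t.
    by move=> st' dt'; apply: tmax; apply/(toralP t' rrG).
  have id_lin : linear (@id (sp w)) by [].
  have id_act x v : sp_act w (id x) v = sp_act w x v by [].
  have supp_t := maximal_torus_supp w_nondeg st dt maxt.
  split=> //.
    split; last exact: (maximal_torus_Sym2 w_nondeg st dt maxt).
    exact: (@zero_weight_isotropic _ _ w w_nondeg (sp w) id (sp_act w) id_lin
      (sp_module w) id_act (lie_amp w_nondeg) t st dt maxt).
  have [I [IS Id]] := half_system supp_t.1.
  by exists I; split=> //; exact: (maximal_torus_sum w_nondeg st dt maxt IS Id).
have SN a : S a -> S (- a) by move=> Sa; rewrite SS; exists a.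
have dt := torus_ldiag w_nondeg st dim1 SN IS Id tE.
split; first exact/(toralP t rrG).
move=> t' /(toralP t' rrG)[st' dt'].
exact: (torus_maximal w_nondeg st iso0 dim1 SN IS Id tE st' dt').
Qed.

End MaximalToral.

Local Open Scope complex_scope.

Theorem theorem4p5 (R : realType) (V : lmodType R[i])
    (w : {skew_symmetric V})
    (w_nondeg : nondegenerate_form w)
    (V_dim : countably_infinite_dim V) :
  (forall (g : lieAlgType R[i]) (G H : nat -> set g)
      (iota : sp w -> g) (k : set g) (rho : g -> V -> V) (t : set g),
    root_reductive G H ->
    derived_summand iota k ->
    is_module rho ->
    (forall x v, rho (iota x) v = sp_act w x v) ->
    (forall y v, k y -> rho y v = 0) ->
    (forall x u v, w (rho x u) v + w u (rho x v) = 0) ->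
    maximal_toral G t ->
    let Vw := weight_space rho t in
    let Z := centralizer_in iota t in
    [/\ (* (1) *)
        forall a b, dual t a -> dual t b ->
          (exists u v, [/\ Vw a u, Vw b v & w u v <> 0]) ->
          b = - a /\ (a <> 0 -> has_dim (Vw a) 1 /\ has_dim (Vw (- a)) 1),
        (* (2) *)
        forall a, dual t a ->
          (forall u v, Vw a u -> Vw (- a) v -> w u v = 0) ->
          amp_set w (Vw a) (Vw (- a)) `<=` center_of Z,
        (* (3) *)
        (forall u v, Vw 0 u -> Vw 0 v -> w u v = 0) /\
          Sym2_sp w (Vw 0) `&` iota @^-1` t = [set 0]
      & (* (4) *)
        abelian_set Z])
  /\
  (forall (G H : nat -> set (sp w)) (t : set (sp w)),
    root_reductive G H ->
    subalgebra t ->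
    let Vw := weight_space (sp_act w) t in
    let S := supp (sp_act w) t in
    maximal_toral G t <->
    [/\ (* (3) *)
        (forall u v, Vw 0 u -> Vw 0 v -> w u v = 0) /\
          Sym2_sp w (Vw 0) `&` t = [set 0],
        (* (5) *)
        S = [set - a | a in S] /\
          (forall a, S a -> a <> 0 -> has_dim (Vw a) 1)
      & (* (6) *)
        exists I : set (sp w -> R[i]),
          [/\ I `|` [set - a | a in I] = S `\ 0,
              I `&` [set - a | a in I] = set0
            & direct_sum I (fun a => amp_set w (Vw a) (Vw (- a))) t]]).
Proof.
split=> [g G H iota k rho t rrG sI rm ri _ rs mt Vw Z|G H t rrG st].
  have [h1 h2 h3 h4] := maximal_toral_summand w_nondeg rrG sI rm ri rs mt.
  by split=> // a da _; exact: h2.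
exact: (maximal_toral_sp w_nondeg rrG st).
Qed.
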